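(* Let $N\ge3$, assume (K0) and (F0), and let $p>p_S(\alpha)$. Then for every $\mu\in\mathbb{R}$ there is a unique $u\in C^2(0,\infty)$, denoted $u^*_\mu$, solving $$u''+\frac{N-1}{r}u'+K(r)\max\{u,0\}^p+\mu f(r)=0\ \ (r>0),\qquad \lim_{r\to0}r^{\theta}u(r)=\gamma.$$ Furthermore: (1) $(r,\mu)\mapsto u^*_\mu(r)$ is $C^1$; (2) for each $r>0$ the set $\mathcal{P}_r:=\{\mu\in\mathbb{R}: u^*_\mu(\rho)>0\text{ for all }\rho\in(0,r]\}$ is an open subset of $\mathbb{R}$, and $\mu\mapsto u^*_\mu(r)$ and $\mu\mapsto \frac{d}{dr}u^*_\mu(r)$ are real analytic on each connected component of $\mathcal{P}_r$.
   Context: (K0): $K:(0,\infty)\to(0,\infty)$ is continuous and $K(r)=(k_0+o(1))r^{\alpha}$ as $r\to0$ for some $\alpha>-2$, $k_0>0$. (F0): $f:(0,\infty)\to[0,\infty)$ is continuous, not identically zero, and $f(r)=O(r^{\nu})$ as $r\to0$ for some $\nu>-2$. $p_S(\alpha)=\frac{N+2+2\alpha}{N-2}$, $\theta:=\frac{2+\alpha}{p-1}$, $\gamma:=k_0^{-1/(p-1)}\big(\theta(N-2-\theta)\big)^{1/(p-1)}$. *)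

(* Defs.v *)
From Stdlib Require Import Reals Lra.
From Coquelicot Require Import Coquelicot.
Open Scope R_scope.

(* x_+^p := max{x,0}^p, for p > 0 (so that 0^p = 0). *)
Definition pospow (x p : R) : R :=
  if Rlt_dec 0 x then Rpower x p else 0.

Definition pS (N : nat) (alpha : R) : R := (INR N + 2 + 2 * alpha) / (INR N - 2).

Definition theta_of (alpha p : R) : R := (2 + alpha) / (p - 1).

Definition gamma_of (N : nat) (k0 alpha p : R) : R :=
  let th := theta_of alpha p in
  Rpower k0 (- (1 / (p - 1))) * Rpower (th * (INR N - 2 - th)) (1 / (p - 1)).

Definition hyp_K0 (K : R -> R) (alpha k0 : R) : Prop :=
  alpha > -2 /\ k0 > 0 /\
  (forall r, 0 < r -> continuous K r) /\
  (forall r, 0 < r -> 0 < K r) /\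
  filterlim (fun r => K r / Rpower r alpha) (at_right 0) (locally k0).

Definition hyp_F0 (f : R -> R) (nu : R) : Prop :=
  nu > -2 /\
  (forall r, 0 < r -> continuous f r) /\
  (forall r, 0 < r -> 0 <= f r) /\
  (exists r, 0 < r /\ f r <> 0) /\
  (exists C delta, 0 < delta /\
     forall r, 0 < r < delta -> Rabs (f r) <= C * Rpower r nu).

Definition C2_pos (u : R -> R) : Prop :=
  forall r, 0 < r ->
    ex_derive u r /\ ex_derive (Derive u) r /\ continuous (Derive_n u 2) r.

Definition is_singular_solution (N : nat) (K f : R -> R) (k0 alpha p mu : R)
    (u : R -> R) : Prop :=
  C2_pos u /\
  (forall r, 0 < r ->
     Derive_n u 2 r + (INR N - 1) / r * Derive u r
       + K r * pospow (u r) p + mu * f r = 0) /\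
  filterlim (fun r => Rpower r (theta_of alpha p) * u r) (at_right 0)
    (locally (gamma_of N k0 alpha p)).

Definition C1_param (U : R -> R -> R) : Prop :=
  forall mu r, 0 < r ->
    ex_derive (fun m => U m r) mu /\
    ex_derive (fun s => U mu s) r /\
    continuous (fun x : R * R => Derive (fun m => U m (snd x)) (fst x)) (mu, r) /\
    continuous (fun x : R * R => Derive (fun s => U (fst x) s) (snd x)) (mu, r).

Definition open_subset (S : R -> Prop) : Prop :=
  forall x, S x -> exists eps, 0 < eps /\ forall y, Rabs (y - x) < eps -> S y.

Definition is_interval (C : R -> Prop) : Prop :=
  forall x y z, C x -> C z -> x <= y <= z -> C y.

Definition is_component (S C : R -> Prop) : Prop :=
  (exists x, C x) /\ (forall x, C x -> S x) /\ is_interval C /\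
  (forall D : R -> Prop, is_interval D -> (forall x, D x -> S x) ->
     (exists x, D x /\ C x) -> forall x, D x -> C x).

Definition analytic_at (g : R -> R) (x0 : R) : Prop :=
  exists (a : nat -> R) (delta : R), 0 < delta /\
    forall x, Rabs (x - x0) < delta -> is_pseries a (x - x0) (g x).

Definition analytic_on (C : R -> Prop) (g : R -> R) : Prop :=
  forall x, C x -> analytic_at g x.

Definition Pset (U : R -> R -> R) (r : R) (mu : R) : Prop :=
  forall rho, 0 < rho <= r -> 0 < U mu rho.

(* Main.v *)
(* In the variables t = ln r and z = r^theta u - gamma the problem becomes
     z'' + a z' + h z = F mu t z,   z -> 0 as t -> -oo,
   with a, h > 0 exactly because p > p_S(alpha), and F has a small Lipschitz constant in z near -oo.
   The damped oscillator on the left has an exponentially decaying kernel, so solutions bounded at -oo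
   are controlled by their sources (stability) and fixed points of truncations of F exist; an a priori
   upper bound, from the factorization (D - theta)(D + b) of the linear part, removes the truncation.
   Uniqueness and C^1 dependence on mu follow from stability applied to differences and to the
   remainder of the linearization.  For analyticity, w = gamma + z and q = w^p are expanded formally
   in mu - mu0 along a positive solution: the identity w q' = p w' q makes the recursion for the
   coefficients quadratic, so they grow at most geometrically, and stability shows that the partial
   sums of the series converge to the solution. *)
Require Import Defs.
From Stdlib Require Import Reals Lra Lia Psatz Classical IndefiniteDescription
  FunctionalExtensionality.
From Coquelicot Require Import Coquelicot.
Open Scope R_scope.

(** * Calculus preliminaries *)

(** With D = d/dt, w = r^theta u and b = N - 2 - theta, the equation reads (D - theta)(D + b) w + k
    w_+^p + mu g = 0, where k = K / r^alpha tends to k0 and g = r^(theta + 2) f tends to 0 at -oo.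
    As k0 gamma^(p-1) = theta b =: A, moving p A z to the left gives h = (p - 1) A and cancels the
    limiting derivative of the right side at z = 0; hence the small Lipschitz constant. The datum is
    prescribed at -oo, so neither local Cauchy theory nor Gronwall's inequality on a bounded
    interval applies. One weighted norm serves instead, with weight 1 + exp(4 C L (t - T0)): the
    damping controls the constant part before T0, and the exponential absorbs any Lipschitz constant
    L afterwards. It yields a gain of 1/2, used both for stability and for Picard iteration. The
    exponent p may be below 2, and then w_+^p is only C^1: dependence on mu has to rest on uniform
    continuity of the derivative. On the other hand w_+^p vanishes for w <= 0, so its Lipschitz
    constants depend on an upper bound for w alone, and a one-sided a priori bound suffices. *)

Lemma is_derive_eq (f : R -> R) (x l l' : R) : is_derive f x l -> l = l' -> is_derive f x l'.
Proof. intros H <-; exact H. Qed.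

Lemma is_derive_continuous (f : R -> R) (x l : R) : is_derive f x l -> continuous f x.
Proof. intros H; apply (ex_derive_continuous (V := R_NormedModule)); now exists l. Qed.

Lemma is_derive_add (f g : R -> R) (x l l' : R) :
  is_derive f x l -> is_derive g x l' -> is_derive (fun s => f s + g s) x (l + l').
Proof. exact (is_derive_plus (V := R_NormedModule) f g x l l'). Qed.

Lemma is_derive_sub (f g : R -> R) (x l l' : R) :
  is_derive f x l -> is_derive g x l' -> is_derive (fun s => f s - g s) x (l - l').
Proof. exact (is_derive_minus (V := R_NormedModule) f g x l l'). Qed.

Lemma derive_nonneg_le (f f' : R -> R) (x y : R) :
  x <= y -> (forall s, x <= s <= y -> is_derive f s (f' s)) ->
  (forall s, x <= s <= y -> 0 <= f' s) -> f x <= f y.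
Proof.
intros Hxy Hd Hp.
destruct (MVT_gen f x y f') as [s [Hs E]].
- rewrite Rmin_left, Rmax_right by lra; intros; apply Hd; lra.
- rewrite Rmin_left, Rmax_right by lra; intros s Hs.
  apply continuity_pt_filterlim, (is_derive_continuous _ _ (f' s)), Hd; lra.
- rewrite Rmin_left, Rmax_right in Hs by lra.
  generalize (Hp s Hs); nra.
Qed.

(** Both [g - f] and [g + f] are nondecreasing. This takes the place of estimating an integral by an
    integral: sources are later bounded through explicit primitives [g]. *)
Lemma derive_abs_le (f f' g g' : R -> R) (x y : R) :
  x <= y -> (forall s, x <= s <= y -> is_derive f s (f' s)) ->
  (forall s, x <= s <= y -> is_derive g s (g' s)) ->
  (forall s, x <= s <= y -> Rabs (f' s) <= g' s) -> Rabs (f y - f x) <= g y - g x.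
Proof.
intros Hxy Hf Hg Hb.
assert (H1 : g x - f x <= g y - f y).
{ apply (derive_nonneg_le (fun s => g s - f s) (fun s => g' s - f' s)); auto.
  - intros s Hs; apply is_derive_sub; auto.
  - intros s Hs; generalize (Hb s Hs) (Rle_abs (f' s)); lra. }
assert (H2 : g x + f x <= g y + f y).
{ apply (derive_nonneg_le (fun s => g s + f s) (fun s => g' s + f' s)); auto.
  - intros s Hs; apply is_derive_add; auto.
  - intros s Hs; generalize (Hb s Hs) (Rle_abs (- f' s)); rewrite Rabs_Ropp; lra. }
apply Rabs_le; lra.
Qed.

Lemma exp_neg_lt (c eps : R) : 0 < c -> 0 < eps ->
  exists S, forall s, s <= S -> exp (c * s) <= eps.
Proof.
intros Hc He; exists (ln eps / c); intros s Hs.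
rewrite <- (exp_ln eps He).
destruct (Rle_lt_or_eq_dec s (ln eps / c) Hs) as [Hl| ->].
- left; apply exp_increasing.
  apply (Rmult_lt_compat_l c) in Hl; auto.
  replace (c * (ln eps / c)) with (ln eps) in Hl by (field; lra); exact Hl.
- right; f_equal; field; lra.
Qed.

Lemma exp_le (x y : R) : x <= y -> exp x <= exp y.
Proof. intros [H| ->]; [left; now apply exp_increasing|lra]. Qed.

(** * The damped oscillator *)

(** [G] is the fundamental solution of D^2 + a D + h with data (0, 1) at 0, written out for complex,
    double and distinct real characteristic roots; the roots have negative real part, which gives
    the rate [c]. *)
Lemma oscillator_kernel (a h : R) : 0 < a -> 0 < h ->
  exists (G G1 : R -> R) (C c : R), 0 < C /\ 0 < c /\ G 0 = 0 /\ G1 0 = 1 /\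
  (forall t, is_derive G t (G1 t)) /\
  (forall t, is_derive G1 t (- a * G1 t - h * G t)) /\
  (forall t, 0 <= t -> Rabs (G t) <= C * exp (- c * t)) /\
  (forall t, 0 <= t -> Rabs (G1 t) <= C * exp (- c * t)).
Proof.
intros Ha Hh.
destruct (Rtotal_order (a * a / 4) h) as [Hlt|[Heq|Hgt]].
- set (w := sqrt (h - a * a / 4)).
  assert (Hw : 0 < w) by (apply sqrt_lt_R0; lra).
  assert (Hw2 : h = w * w + a * a / 4) by (unfold w; rewrite sqrt_sqrt; lra).
  set (E := fun t => exp (- (a / 2) * t)).
  exists (fun t => E t * (sin (w * t) / w)),
    (fun t => E t * (cos (w * t) - a / 2 * (sin (w * t) / w))),
    (1 + / w + a / w), (a / 2).
  assert (Hiw : 0 < / w) by now apply Rinv_0_lt_compat.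
  assert (Haw : 0 < a / w) by (apply Rdiv_lt_0_compat; lra).
  assert (Hs : forall x, Rabs (sin x / w) <= / w).
  { intros x; unfold Rdiv; rewrite Rabs_mult, (Rabs_pos_eq (/ w)) by lra.
    assert (Rabs (sin x) <= 1) by (apply Rabs_le, SIN_bound); nra. }
  assert (Hc : forall x, Rabs (cos x) <= 1) by (intros x; apply Rabs_le, COS_bound).
  repeat match goal with |- _ /\ _ => split end; try lra.
  + rewrite Rmult_0_r, sin_0; unfold Rdiv; ring.
  + unfold E; rewrite !Rmult_0_r, exp_0, sin_0, cos_0; unfold Rdiv; ring.
  + intros t; unfold E; auto_derive; auto. field; lra.
  + intros t; unfold E; auto_derive; auto. rewrite Hw2; field; lra.
  + intros t _; rewrite Rabs_mult, (Rabs_pos_eq (E t)) by (left; apply exp_pos).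
    rewrite Rmult_comm; apply Rmult_le_compat_r; [left; apply exp_pos|].
    generalize (Hs (w * t)); lra.
  + intros t _; rewrite Rabs_mult, (Rabs_pos_eq (E t)) by (left; apply exp_pos).
    rewrite Rmult_comm; apply Rmult_le_compat_r; [left; apply exp_pos|].
    eapply Rle_trans; [apply Rabs_triang|]. rewrite Rabs_Ropp, Rabs_mult, (Rabs_pos_eq (a / 2)) by lra.
    generalize (Hs (w * t)) (Hc (w * t)); unfold Rdiv in *; nra.
(* Double root: half of the rate a / 2 is given up to absorb the factor t, by 1 + a t / 4 <= exp(a t
   / 4). *)
- exists (fun t => t * exp (- (a / 2) * t)), (fun t => (1 - a / 2 * t) * exp (- (a / 2) * t)),
    (3 + 4 / a), (a / 4).
  assert (Hia : 0 < 4 / a) by (apply Rdiv_lt_0_compat; lra).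
  assert (Ht : forall t, 0 <= t -> t * exp (- (a / 2) * t) <= 4 / a * exp (- (a / 4) * t)).
  { intros t Ht; replace (- (a / 2) * t) with (- (a / 4 * t) + - (a / 4) * t) by field.
    rewrite exp_plus, exp_Ropp, <- Rmult_assoc.
    apply Rmult_le_compat_r; [left; apply exp_pos|].
    generalize (exp_ineq1_le (a / 4 * t)) (exp_pos (a / 4 * t)); intros H1 H2.
    apply (Rmult_le_reg_r (exp (a / 4 * t))); auto.
    rewrite Rmult_assoc, Rinv_l by lra.
    apply (Rle_trans _ (4 / a * (1 + a / 4 * t))); [|apply Rmult_le_compat_l; lra].
    replace (4 / a * (1 + a / 4 * t)) with (4 / a + t) by (field; lra); lra. }
  assert (He : forall t, 0 <= t -> exp (- (a / 2) * t) <= exp (- (a / 4) * t)).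
  { intros t Ht'; apply exp_le; nra. }
  repeat match goal with |- _ /\ _ => split end; try lra.
  + rewrite !Rmult_0_r, exp_0; ring.
  + intros t; auto_derive; auto. field.
  + intros t; auto_derive; auto. rewrite <- Heq; field.
  + intros t Ht'; rewrite Rabs_pos_eq; [|apply Rmult_le_pos; [lra|left; apply exp_pos]].
    generalize (Ht t Ht') (exp_pos (- (a / 4) * t)); nra.
  + intros t Ht'; replace ((1 - a / 2 * t) * exp (- (a / 2) * t))
      with (exp (- (a / 2) * t) + - (a / 2 * (t * exp (- (a / 2) * t)))) by ring.
    eapply Rle_trans; [apply Rabs_triang|].
    rewrite Rabs_Ropp, !Rabs_pos_eq; try (left; apply exp_pos).
    2:{ apply Rmult_le_pos; [lra|]. apply Rmult_le_pos; [lra|left; apply exp_pos]. }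
    generalize (Ht t Ht') (He t Ht') (exp_pos (- (a / 4) * t)); intros H1 H2 H3.
    assert (a / 2 * (t * exp (- (a / 2) * t)) <= 2 * exp (- (a / 4) * t)).
    { apply (Rle_trans _ (a / 2 * (4 / a * exp (- (a / 4) * t)))).
      apply Rmult_le_compat_l; lra. right; field; lra. }
    nra.
- set (w := sqrt (a * a / 4 - h)).
  assert (Hw : 0 < w) by (apply sqrt_lt_R0; lra).
  assert (Hw2 : h = a * a / 4 - w * w) by (unfold w; rewrite sqrt_sqrt; lra).
  (* [h > 0] enters here: the slower of the two rates, [a / 2 - w], is positive. *)
  assert (Hwa : w < a / 2) by nra.
  exists (fun t => (exp ((w - a / 2) * t) - exp ((- w - a / 2) * t)) / (2 * w)),
    (fun t => ((w - a / 2) * exp ((w - a / 2) * t) - (- w - a / 2) * exp ((- w - a / 2) * t)) / (2 * w)),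
    (1 + / w + a / w), (a / 2 - w).
  assert (Hiw : 0 < / w) by now apply Rinv_0_lt_compat.
  assert (Haw : 0 < a / w) by (apply Rdiv_lt_0_compat; lra).
  assert (He : forall t, 0 <= t -> 0 < exp ((- w - a / 2) * t) <= exp (- (a / 2 - w) * t)).
  { intros t Ht; split; [apply exp_pos|apply exp_le; nra]. }
  assert (Hi2 : / (2 * w) = / w / 2) by (field; lra).
  repeat match goal with |- _ /\ _ => split end; try lra.
  + rewrite !Rmult_0_r; unfold Rdiv; ring.
  + rewrite !Rmult_0_r, exp_0; field; lra.
  + intros t; auto_derive; auto. field; lra.
  + intros t; auto_derive; auto. rewrite Hw2; field; lra.
  + intros t Ht; generalize (He t Ht); intros H1.
    replace ((w - a / 2) * t) with (- (a / 2 - w) * t) by ring.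
    set (x := exp (- (a / 2 - w) * t)) in *; set (y := exp ((- w - a / 2) * t)) in *.
    unfold Rdiv; rewrite Hi2, Rabs_mult, (Rabs_pos_eq (/ w / 2)), Rabs_pos_eq by lra.
    assert ((x - y) * (/ w / 2) <= x * / w) by nra. nra.
  + intros t Ht; generalize (He t Ht); intros H1.
    replace ((w - a / 2) * t) with (- (a / 2 - w) * t) by ring.
    set (x := exp (- (a / 2 - w) * t)) in *; set (y := exp ((- w - a / 2) * t)) in *.
    unfold Rdiv; rewrite Hi2, Rabs_mult, (Rabs_pos_eq (/ w / 2)) by lra.
    assert (Hn : Rabs ((w - a * / 2) * x - (- w - a * / 2) * y) <= 2 * a * x).
    { apply Rabs_le; split; nra. }
    apply (Rle_trans _ (2 * a * x * (/ w / 2))); [apply Rmult_le_compat_r; lra|].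
    replace (2 * a * x * (/ w / 2)) with (a * / w * x) by (field; lra).
    unfold Rdiv in Haw; nra.
Qed.

(** [auto_derive] leaves [Derive g x] for functions known only through a hypothesis; these are
    replaced by the derivatives found in the context. The hypotheses are stated at points such as
    [t + - s], the form that [auto_derive] produces. *)
Ltac derive_known :=
  auto_derive;
  [ repeat match goal with |- _ /\ _ => split end; auto; try (eexists; eassumption)
  | repeat match goal with |- context [Derive ?g ?x] =>
      match goal with D : is_derive ?f x ?l |- _ =>
        replace (Derive g x) with l by (symmetry; exact (is_derive_unique f x l D)) end end;
    unfold Rminus; try ring ].

(** * Equations on a half-line and functions bounded at -oo *)

Definition solves (a h T : R) (v v1 H : R -> R) : Prop :=
  forall t, t <= T ->
    is_derive v t (v1 t) /\ is_derive v1 t (H t - a * v1 t - h * v t).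

(** Replaces initial data: for a, h > 0 a nonzero solution of the homogeneous equation is unbounded
    at -oo, so boundedness there singles out one solution. *)
Definition past_bounded (v : R -> R) : Prop :=
  exists B T, forall t, t <= T -> Rabs (v t) <= B.

Lemma past_bounded_minus (v w : R -> R) :
  past_bounded v -> past_bounded w -> past_bounded (fun t => v t - w t).
Proof.
intros [B [T HB]] [B' [T' HB']]; exists (B + B'), (Rmin T T'); intros t Ht.
assert (H := Rmin_l T T'); assert (H' := Rmin_r T T').
eapply Rle_trans; [apply Rabs_triang|]; rewrite Rabs_Ropp.
apply Rplus_le_compat; [apply HB|apply HB']; lra.
Qed.

Lemma solves_minus (a h T : R) (v v1 H w w1 H' : R -> R) :
  solves a h T v v1 H -> solves a h T w w1 H' ->
  solves a h T (fun t => v t - w t) (fun t => v1 t - w1 t) (fun t => H t - H' t).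
Proof.
intros Hv Hw t Ht; destruct (Hv t Ht) as [A B], (Hw t Ht) as [A' B']; split.
- now apply is_derive_sub.
- eapply is_derive_eq; [apply is_derive_sub; eassumption|ring].
Qed.

Lemma solves_ext (a h T : R) (v v1 H H' : R -> R) :
  (forall t, t <= T -> H t = H' t) -> solves a h T v v1 H -> solves a h T v v1 H'.
Proof. intros E Hv t Ht; rewrite <- E; auto. Qed.

(** A bound on [v] controls [v1] at some point of each unit interval. Arbitrarily early times of
    this kind are enough to send the boundary terms of variation of constants to zero. *)
Lemma past_slope_bounded (v v1 : R -> R) (T B : R) :
  (forall t, t <= T -> is_derive v t (v1 t)) ->
  (forall t, t <= T -> Rabs (v t) <= B) ->
  forall S, exists s, s <= S /\ s <= T /\ Rabs (v1 s) <= 2 * B.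
Proof.
intros Hd Hb S; set (y := Rmin S T).
assert (Hy1 : y <= S) by apply Rmin_l; assert (Hy2 : y <= T) by apply Rmin_r.
destruct (MVT_gen v (y - 1) y v1) as [s [Hs E]].
- rewrite Rmin_left, Rmax_right by lra; intros; apply Hd; lra.
- rewrite Rmin_left, Rmax_right by lra; intros s Hs.
  apply continuity_pt_filterlim, (is_derive_continuous _ _ (v1 s)), Hd; lra.
- rewrite Rmin_left, Rmax_right in Hs by lra.
  exists s; repeat split; try lra.
  replace (v1 s) with (v y + - v (y - 1)) by lra.
  eapply Rle_trans; [apply Rabs_triang|]; rewrite Rabs_Ropp.
  generalize (Hb y ltac:(lra)) (Hb (y - 1) ltac:(lra)); lra.
Qed.

Lemma le_of_forall_eps (x y : R) : (forall eps, 0 < eps -> x <= y + eps) -> x <= y.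
Proof.
intros H; apply Rnot_lt_le; intros Hl; generalize (H ((x - y) / 2) ltac:(lra)); lra.
Qed.

Lemma derive_zero_const (f : R -> R) : (forall s, is_derive f s 0) -> forall x y, f x = f y.
Proof.
intros H x y; destruct (MVT_gen f x y (fun _ => 0)) as [s [_ E]]; [auto| |lra].
intros s _; apply continuity_pt_filterlim; exact (is_derive_continuous f s 0 (H s)).
Qed.

Lemma antiderivative_exists (phi : R -> R) :
  (forall t, continuous phi t) -> exists Phi, forall t, is_derive Phi t (phi t).
Proof.
intros H; exists (RInt phi 0); intros t.
apply (is_derive_RInt phi (RInt phi 0) 0 t); auto.
apply filter_forall; intros x; apply (RInt_correct (V := R_CompleteNormedModule)).
apply (ex_RInt_continuous (V := R_CompleteNormedModule)); auto.
Qed.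

Lemma is_lim_seq_abs_le (u : nat -> R) (l x K : R) (N : nat) :
  is_lim_seq u l -> (forall n, (N <= n)%nat -> Rabs (x - u n) <= K) -> Rabs (x - l) <= K.
Proof.
intros Hu Hb; apply le_of_forall_eps; intros eps He.
apply is_lim_seq_spec in Hu; destruct (Hu (mkposreal eps He)) as [M HM]; simpl in HM.
specialize (HM (max N M) (Nat.le_max_r _ _)); specialize (Hb (max N M) (Nat.le_max_l _ _)).
replace (x - l) with ((x - u (max N M)) + (u (max N M) - l)) by ring.
eapply Rle_trans; [apply Rabs_triang|lra].
Qed.

(** The primitive that vanishes at -oo, without improper integrals: by the exponential bound any
    primitive is Cauchy along [S - INR n], and its limit is subtracted. *)
Lemma antiderivative_tail (phi : R -> R) (M c S : R) : 0 < c ->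
  (forall t, continuous phi t) -> (forall s, s <= S -> Rabs (phi s) <= M * exp (c * s)) ->
  exists Phi, (forall t, is_derive Phi t (phi t)) /\
    forall s, s <= S -> Rabs (Phi s) <= M / c * exp (c * s).
Proof.
intros Hc Hcont Hb.
assert (HM : 0 <= M).
{ generalize (Hb S ltac:(lra)) (exp_pos (c * S)) (Rabs_pos (phi S)); nra. }
destruct (antiderivative_exists phi Hcont) as [Phi HPhi].
assert (HMc : 0 <= M / c) by now apply Rdiv_le_0_compat.
assert (Hd : forall x y, x <= y -> y <= S -> Rabs (Phi y - Phi x) <= M / c * exp (c * y)).
{ intros x y Hxy Hy.
  apply (Rle_trans _ (M / c * exp (c * y) - M / c * exp (c * x))).
  - apply (derive_abs_le Phi phi (fun x => M / c * exp (c * x)) (fun x => M * exp (c * x))); auto.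
    + intros s Hs; auto_derive; auto; field; lra.
    + intros s Hs; apply Hb; lra.
  - generalize (exp_pos (c * x)); nra. }
destruct (proj2 (ex_lim_seq_cauchy_corr (fun n => Phi (S - INR n)))) as [l Hl].
{ intros [eps He]; simpl.
  destruct (exp_neg_lt c (eps / (2 * (M / c + 1)))) as [S1 HS1]; auto.
  { apply Rdiv_lt_0_compat; lra. }
  destruct (nfloor_ex (Rmax 0 (S - S1))) as [N [_ HN]]; [apply Rmax_l|].
  assert (HN' : S - S1 < INR N + 1) by (eapply Rle_lt_trans; [apply Rmax_r|apply HN]).
  assert (Hsm : forall n, (N + 1 <= n)%nat -> M / c * exp (c * (S - INR n)) < eps).
  { intros n Hn; apply le_INR in Hn; rewrite plus_INR in Hn; simpl in Hn.
    specialize (HS1 (S - INR n) ltac:(lra)).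
    apply (Rle_lt_trans _ (M / c * (eps / (2 * (M / c + 1))))).
    - now apply Rmult_le_compat_l.
    - apply (Rmult_lt_reg_r (2 * (M / c + 1))); [lra|].
      replace (M / c * (eps / (2 * (M / c + 1))) * (2 * (M / c + 1))) with (M / c * eps) by (field; lra).
      nra. }
  exists (N + 1)%nat; intros n m Hn Hm.
  assert (Hn' := pos_INR n); assert (Hm' := pos_INR m).
  destruct (Rle_lt_dec (INR n) (INR m)).
  - eapply Rle_lt_trans; [apply Hd; lra|now apply Hsm].
  - rewrite Rabs_minus_sym; eapply Rle_lt_trans; [apply Hd; lra|now apply Hsm]. }
exists (fun t => Phi t - l); split.
- intros t; eapply is_derive_eq; [apply is_derive_sub; [apply HPhi|apply is_derive_const]|].
  apply Rminus_0_r.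
- intros s Hs; destruct (nfloor_ex (S - s)) as [N [_ HN]]; [lra|].
  apply (is_lim_seq_abs_le _ _ _ _ (N + 1) Hl); intros n Hn.
  apply le_INR in Hn; rewrite plus_INR in Hn; simpl in Hn.
  apply Hd; lra.
Qed.

Lemma small_half_pow (K eps : R) : 0 < eps -> exists n, K / 2 ^ n <= eps.
Proof.
intros He; destruct (pow_lt_1_zero (/ 2)) with (y := eps / (Rabs K + 1)) as [n Hn].
{ rewrite Rabs_pos_eq; lra. }
{ apply Rdiv_lt_0_compat; [lra|generalize (Rabs_pos K); lra]. }
exists n; specialize (Hn n (le_n n)).
rewrite Rabs_pos_eq, pow_inv in Hn by (apply pow_le; lra).
assert (HK := Rle_abs K); assert (HK' := Rabs_pos K).
assert (0 < / 2 ^ n) by (apply Rinv_0_lt_compat, pow_lt; lra).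
apply (Rle_trans _ ((Rabs K + 1) * (eps / (Rabs K + 1)))).
- unfold Rdiv at 1; apply (Rle_trans _ ((Rabs K + 1) * / 2 ^ n)); nra.
- right; field; lra.
Qed.

Lemma geometric_limit (u : nat -> R) (K : R) :
  (forall n, Rabs (u (S n) - u n) <= K / 2 ^ n) ->
  exists l, is_lim_seq u (Finite l) /\ forall n, Rabs (u n - l) <= 2 * K / 2 ^ n.
Proof.
intros Hu.
assert (HK : 0 <= K).
{ generalize (Rabs_pos (u 1%nat - u 0%nat)) (Hu 0%nat); simpl; lra. }
(* The factor [1 - / 2 ^ k] lets the induction on [k] close with equality. *)
assert (Hnk : forall k n, Rabs (u n - u (n + k)%nat) <= 2 * K / 2 ^ n * (1 - / 2 ^ k)).
{ induction k; intros n.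
  - rewrite Nat.add_0_r, Rminus_diag, Rabs_R0; simpl; rewrite Rinv_1; lra.
  - replace (u n - u (n + S k)%nat) with (- (u (S n) - u n) + (u (S n) - u (S n + k)%nat))
      by (rewrite Nat.add_succ_r; simpl; ring).
    eapply Rle_trans; [apply Rabs_triang|]; rewrite Rabs_Ropp.
    eapply Rle_trans; [apply Rplus_le_compat; [apply Hu|apply IHk]|].
    right; simpl; field; split; apply pow_nonzero; lra. }
assert (Hb : forall m n, (n <= m)%nat -> Rabs (u n - u m) <= 2 * K / 2 ^ n).
{ intros m n Hnm; replace m with (n + (m - n))%nat by lia.
  eapply Rle_trans; [apply Hnk|].
  assert (0 <= 2 * K / 2 ^ n) by (apply Rdiv_le_0_compat; [lra|apply pow_lt; lra]).
  assert (0 < / 2 ^ (m - n)) by (apply Rinv_0_lt_compat, pow_lt; lra). nra. }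
destruct (proj2 (ex_lim_seq_cauchy_corr u)) as [l Hl].
{ intros [eps He]; simpl.
  destruct (small_half_pow (2 * K) (eps / 4)) as [N HN]; [lra|].
  exists N; intros n m Hn Hm.
  replace (u n - u m) with (- (u N - u n) + (u N - u m)) by ring.
  eapply Rle_lt_trans; [apply Rabs_triang|]; rewrite Rabs_Ropp.
  generalize (Hb n N Hn) (Hb m N Hm); lra. }
exists l; split; auto.
intros n; apply (is_lim_seq_abs_le _ _ _ _ n Hl); intros m Hm; now apply Hb.
Qed.

Lemma continuous_eps (f : R -> R) (x : R) :
  (forall eps, 0 < eps -> exists d, 0 < d /\ forall y, Rabs (y - x) < d -> Rabs (f y - f x) < eps) ->
  continuous f x.
Proof.
intros H; apply filterlim_locally; intros [eps He]; simpl.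
destruct (H eps He) as [d [Hd Hy]]; exists (mkposreal d Hd); intros y Hb; now apply Hy.
Qed.

Lemma continuous_eps_elim (f : R -> R) (x : R) : continuous f x ->
  forall eps, 0 < eps -> exists d, 0 < d /\ forall y, Rabs (y - x) < d -> Rabs (f y - f x) < eps.
Proof.
intros H eps He; apply filterlim_locally with (eps := mkposreal eps He) in H.
destruct H as [[d Hd] Hy]; exists d; split; auto.
Qed.

Lemma continuous_of_local_approx (f : R -> R) (x : R) :
  (forall eps, 0 < eps -> exists g, continuous g x /\
     exists d, 0 < d /\ forall y, Rabs (y - x) < d -> Rabs (g y - f y) <= eps) ->
  continuous f x.
Proof.
intros H; apply continuous_eps; intros eps He.
destruct (H (eps / 4) ltac:(lra)) as [g [Hg [d [Hd Hgf]]]].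
destruct (continuous_eps_elim g x Hg (eps / 4) ltac:(lra)) as [d' [Hd' Hgx]].
exists (Rmin d d'); split; [now apply Rmin_pos|]; intros y Hy.
assert (H1 : Rabs (y - x) < d) by (eapply Rlt_le_trans; [apply Hy|apply Rmin_l]).
assert (H2 : Rabs (y - x) < d') by (eapply Rlt_le_trans; [apply Hy|apply Rmin_r]).
assert (H3 := Hgf x); rewrite Rminus_diag, Rabs_R0 in H3; specialize (H3 Hd).
specialize (Hgf y H1); specialize (Hgx y H2).
replace (f y - f x) with (- (g y - f y) + ((g y - g x) + (g x - f x))) by ring.
eapply Rle_lt_trans; [apply Rabs_triang|]; rewrite Rabs_Ropp.
eapply Rle_lt_trans; [apply Rplus_le_compat_l, Rabs_triang|lra].
Qed.

Lemma bounded_upto (v : R -> R) (T : R) :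
  (forall t, t <= T -> continuous v t) -> past_bounded v ->
  exists B, 0 <= B /\ forall t, t <= T -> Rabs (v t) <= B.
Proof.
intros Hc' [B [S HB]].
destruct (Rle_lt_dec T S) as [Hl|Hl].
- exists (Rmax 0 B); split; [apply Rmax_l|].
  intros t Ht; eapply Rle_trans; [apply HB; lra|apply Rmax_r].
- destruct (continuity_ab_maj (fun t => Rabs (v t)) S T) as [x [Hx _]]; [lra| |].
  + intros y Hy; apply continuity_pt_filterlim, continuous_comp; [apply Hc'; lra|].
    apply continuous_Rabs.
  + exists (Rmax B (Rabs (v x))); split.
    * eapply Rle_trans; [apply Rabs_pos|apply Rmax_r].
    * intros t Ht; destruct (Rle_lt_dec t S) as [Hl'|Hl'].
      -- eapply Rle_trans; [apply HB; lra|apply Rmax_l].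
      -- eapply Rle_trans; [apply Hx; lra|apply Rmax_r].
Qed.

Lemma solves_continuous (a h T : R) (v v1 H : R -> R) (t : R) :
  solves a h T v v1 H -> t <= T -> continuous v t.
Proof. intros Hv Ht; exact (is_derive_continuous v t (v1 t) (proj1 (Hv t Ht))). Qed.

(** * Variation of constants, stability and solvability *)

Section Oscillator.

Variables (a h C c : R) (G G1 : R -> R).
Hypothesis Ha : 0 < a.
Hypothesis Hh : 0 < h.
Hypothesis HC : 0 < C.
Hypothesis Hc : 0 < c.
Hypothesis HG0 : G 0 = 0.
Hypothesis HG10 : G1 0 = 1.
Hypothesis HG : forall t, is_derive G t (G1 t).
Hypothesis HG1 : forall t, is_derive G1 t (- a * G1 t - h * G t).
Hypothesis HGb : forall t, 0 <= t -> Rabs (G t) <= C * exp (- c * t).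
Hypothesis HG1b : forall t, 0 <= t -> Rabs (G1 t) <= C * exp (- c * t).

(* Variation of constants without integrals: if [v] solves the equation with source [H], then
   [flow v v1 t t = v t] and the derivative of [flow v v1 t] at [s] is [G (t - s) * H s];
   [flow1] plays the same role for [v1 t]. *)
Let flow (v v1 : R -> R) (t s : R) : R :=
  v s * (G1 (t - s) + a * G (t - s)) + v1 s * G (t - s).
Let flow1 (v v1 : R -> R) (t s : R) : R :=
  - h * v s * G (t - s) + v1 s * G1 (t - s).

Lemma is_derive_flow (v v1 H : R -> R) (T t s : R) :
  solves a h T v v1 H -> s <= T ->
  is_derive (flow v v1 t) s (G (t - s) * H s) /\
  is_derive (flow1 v v1 t) s (G1 (t - s) * H s).
Proof.
intros Hv Hs; destruct (Hv s Hs) as [Dv Dv1]; unfold flow, flow1.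
assert (DG := HG (t + - s)); assert (DG1 := HG1 (t + - s)).
split.
- derive_known.
- derive_known.
Qed.

Lemma flow_diag (v v1 : R -> R) (t : R) : flow v v1 t t = v t /\ flow1 v v1 t t = v1 t.
Proof.
unfold flow, flow1; replace (t - t) with 0 by ring; rewrite HG0, HG10; lra.
Qed.

(** A comparison principle: the derivative in s of C exp(-c (t - s)) psi(s) is C exp(-c (t - s))
    (psi1 + c psi), which dominates the derivatives of [flow] and [flow1]. Its primitive equals
    [C * psi t] at s = t; the contribution of early times vanishes because [v] is bounded and the
    kernel decays. *)
Lemma kernel_estimate (T : R) (v v1 H psi psi1 : R -> R) :
  solves a h T v v1 H -> past_bounded v ->
  (forall t, t <= T -> 0 <= psi t) ->
  (forall t, t <= T -> is_derive psi t (psi1 t)) ->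
  (forall t, t <= T -> Rabs (H t) <= psi1 t + c * psi t) ->
  forall t, t <= T -> Rabs (v t) <= C * psi t /\ Rabs (v1 t) <= C * psi t.
Proof.
intros Hv [B [S HB]] Hpos Hpsi HH t Ht.
assert (HBpos : 0 <= B) by (eapply Rle_trans; [apply Rabs_pos|apply (HB S); lra]).
(* At a suitable early time s, [v] is at most [B], [v1] at most [2 * B] and the kernels at most C
   exp(-c (t - s)), so K exp(-c (t - s)) bounds [flow] and [flow1]. *)
set (K := C * (B * (1 + a) + 2 * B + h * B) + 1).
assert (HK : 0 < K).
{ unfold K; assert (0 <= B * (1 + a) + 2 * B + h * B) by nra.
  assert (0 <= C * (B * (1 + a) + 2 * B + h * B)) by (apply Rmult_le_pos; lra); lra. }
assert (Hsmall : forall eps, 0 < eps ->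
  exists s, s <= t /\ Rabs (flow v v1 t s) <= eps /\ Rabs (flow1 v v1 t s) <= eps).
{ intros eps He.
  destruct (exp_neg_lt c (eps * exp (c * t) / K)) as [S' HS']; auto.
  { apply Rdiv_lt_0_compat; auto; apply Rmult_lt_0_compat; auto; apply exp_pos. }
  destruct (past_slope_bounded v v1 (Rmin S t) B) with (S := Rmin S' t) as [s [H1 [H2 H3]]].
  { intros s Hs; apply Hv; eapply Rle_trans; [apply Hs|]; eapply Rle_trans; [apply Rmin_r|lra]. }
  { intros s Hs; apply HB; eapply Rle_trans; [apply Hs|apply Rmin_l]. }
  assert (Hs1 : s <= S') by (eapply Rle_trans; [apply H1|apply Rmin_l]).
  assert (Hs2 : s <= t) by (eapply Rle_trans; [apply H1|apply Rmin_r]).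
  assert (Hs3 : s <= S) by (eapply Rle_trans; [apply H2|apply Rmin_l]).
  assert (Hvs := HB s Hs3).
  assert (HGs := HGb (t - s) ltac:(lra)); assert (HG1s := HG1b (t - s) ltac:(lra)).
  assert (He' : exp (- c * (t - s)) <= eps / K).
  { replace (- c * (t - s)) with (c * s + - (c * t)) by ring.
    rewrite exp_plus, exp_Ropp.
    apply (Rle_trans _ (eps * exp (c * t) / K * / exp (c * t))).
    - apply Rmult_le_compat_r; [left; apply Rinv_0_lt_compat, exp_pos|now apply HS'].
    - right; field; split; [lra|apply Rgt_not_eq, exp_pos]. }
  set (e := exp (- c * (t - s))) in *.
  assert (Hep : 0 < e) by apply exp_pos.
  assert (HKe : K * e <= eps).
  { apply (Rle_trans _ (K * (eps / K))); [apply Rmult_le_compat_l; lra|right; field; lra]. }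
  assert (Hmul : forall x y X Y, Rabs x <= X -> Rabs y <= Y -> Rabs (x * y) <= X * Y).
  { intros x y X Y Hx Hy; rewrite Rabs_mult; apply Rmult_le_compat; auto; apply Rabs_pos. }
  exists s; split; auto; split.
  - unfold flow; eapply Rle_trans; [|apply HKe].
    eapply Rle_trans; [apply Rabs_triang|].
    apply (Rle_trans _ (B * (C * e + a * (C * e)) + 2 * B * (C * e))).
    + apply Rplus_le_compat; apply Hmul; auto.
      eapply Rle_trans; [apply Rabs_triang|]; apply Rplus_le_compat; auto.
      apply Hmul; auto; rewrite Rabs_pos_eq; lra.
    + unfold K; assert (0 <= h * B * (C * e)) by (repeat apply Rmult_le_pos; lra). nra.
  - unfold flow1; eapply Rle_trans; [|apply HKe].
    eapply Rle_trans; [apply Rabs_triang|].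
    apply (Rle_trans _ (h * B * (C * e) + 2 * B * (C * e))).
    + apply Rplus_le_compat; apply Hmul; auto.
      apply Hmul; auto; rewrite Rabs_Ropp, Rabs_pos_eq; lra.
    + unfold K; assert (0 <= B * (1 + a) * (C * e)) by (repeat apply Rmult_le_pos; lra). nra. }
assert (Hmain : forall s, s <= t ->
  Rabs (flow v v1 t t - flow v v1 t s) <= C * psi t /\
  Rabs (flow1 v v1 t t - flow1 v v1 t s) <= C * psi t).
{ intros s Hs.
  set (g := fun x => C * (exp (- c * (t - x)) * psi x)).
  set (g1 := fun x => C * exp (- c * (t - x)) * (psi1 x + c * psi x)).
  assert (Dg : forall x, s <= x <= t -> is_derive g x (g1 x)).
  { intros x Hx; unfold g, g1.
    assert (D := Hpsi x ltac:(lra)).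
    derive_known. }
  assert (Hg : g t - g s <= C * psi t).
  { unfold g; replace (- c * (t - t)) with 0 by ring; rewrite exp_0.
    assert (0 <= C * (exp (- c * (t - s)) * psi s)).
    { apply Rmult_le_pos; [lra|apply Rmult_le_pos; [left; apply exp_pos|apply Hpos; lra]]. }
    lra. }
  assert (Hb : forall (K : R -> R) x, (forall y, 0 <= y -> Rabs (K y) <= C * exp (- c * y)) ->
    s <= x <= t -> Rabs (K (t - x) * H x) <= g1 x).
  { intros K' x HK' Hx; rewrite Rabs_mult; unfold g1; apply Rmult_le_compat; try apply Rabs_pos.
    apply HK'; lra. apply HH; lra. }
  split; (eapply Rle_trans; [|apply Hg]).
  - apply (derive_abs_le _ (fun x => G (t - x) * H x) g g1); auto.
    intros x Hx; apply (is_derive_flow v v1 H T t x); auto; lra.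
  - apply (derive_abs_le _ (fun x => G1 (t - x) * H x) g g1); auto.
    intros x Hx; apply (is_derive_flow v v1 H T t x); auto; lra. }
destruct (flow_diag v v1 t) as [E E1]; rewrite E, E1 in Hmain.
split; apply le_of_forall_eps; intros eps He; destruct (Hsmall eps He) as [s [Hs [H1 H2]]];
  destruct (Hmain s Hs) as [H3 H4].
- replace (v t) with ((v t - flow v v1 t s) + flow v v1 t s) by ring.
  eapply Rle_trans; [apply Rabs_triang|lra].
- replace (v1 t) with ((v1 t - flow1 v v1 t s) + flow1 v v1 t s) by ring.
  eapply Rle_trans; [apply Rabs_triang|lra].
Qed.

(** The kernel turns a bounded source into a solution at most [C / c] times as large, so a source
    with Lipschitz constant [e0] gains a factor 1/2. *)
Let e0 := c / (2 * C).
(** With psi = B / (2 C) weight, the term c psi equals e0 B weight, which suffices up to [T0];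
    afterwards psi' = 2 L B exp(4 C L (t - T0)) is at least L B weight, because the exponential is
    then at least 1. *)
Let weight (L T0 t : R) : R := 1 + exp (4 * C * L * (t - T0)).

Lemma weight_ge1 (L T0 t : R) : 1 <= weight L T0 t.
Proof. unfold weight; generalize (exp_pos (4 * C * L * (t - T0))); lra. Qed.

Lemma weight_past (L T0 t : R) : 0 <= L -> t <= T0 -> weight L T0 t <= 2.
Proof.
intros HL Ht; unfold weight; rewrite <- exp_0.
assert (exp (4 * C * L * (t - T0)) <= exp 0); [apply exp_le|rewrite exp_0 in *; lra].
assert (0 <= 4 * C * L) by nra; nra.
Qed.

Lemma weight_mono (L T0 t T : R) : 0 <= L -> t <= T -> weight L T0 t <= weight L T0 T.
Proof.
intros HL Ht; unfold weight; apply Rplus_le_compat_l, exp_le.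
assert (0 <= 4 * C * L) by nra; nra.
Qed.

(* Halving of the weighted norm: a source of size [e0 * B * weight] near -oo and
   [L * B * weight] later produces a solution of size [B / 2 * weight]. *)
Lemma weighted_gain (T T0 L B eta : R) (v v1 H : R -> R) :
  0 <= L -> 0 <= B -> 0 <= eta ->
  solves a h T v v1 H -> past_bounded v ->
  (forall t, t <= T -> t <= T0 -> Rabs (H t) <= e0 * (B * weight L T0 t) + eta) ->
  (forall t, t <= T -> T0 <= t -> Rabs (H t) <= L * (B * weight L T0 t) + eta) ->
  forall t, t <= T -> Rabs (v t) <= B / 2 * weight L T0 t + C / c * eta /\
    Rabs (v1 t) <= B / 2 * weight L T0 t + C / c * eta.
Proof.
intros HL HB Heta Hv Hvb H1 H2 t Ht.
set (psi := fun t => B / (2 * C) * weight L T0 t + eta / c).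
set (psi1 := fun t => B / (2 * C) * (4 * C * L * exp (4 * C * L * (t - T0)))).
assert (HiC : 0 < / C) by now apply Rinv_0_lt_compat.
assert (HBC : 0 <= B / (2 * C)) by (apply Rdiv_le_0_compat; lra).
assert (HeC : 0 <= eta / c) by (apply Rdiv_le_0_compat; lra).
replace (B / 2 * weight L T0 t + C / c * eta) with (C * psi t) by (unfold psi; field; lra).
revert t Ht; apply (kernel_estimate T v v1 H psi psi1); auto.
- intros t Ht; unfold psi; generalize (weight_ge1 L T0 t); nra.
- intros t Ht; unfold psi, psi1, weight; auto_derive; auto; unfold Rminus; field; lra.
- intros t Ht.
  assert (Hce : c * (eta / c) = eta) by (field; lra).
  destruct (Rle_lt_dec t T0) as [Hl|Hl].
  + eapply Rle_trans; [now apply H1|].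
    unfold psi, psi1, e0.
    replace (c / (2 * C) * (B * weight L T0 t)) with (c * (B / (2 * C) * weight L T0 t)) by (field; lra).
    assert (0 <= B / (2 * C) * (4 * C * L * exp (4 * C * L * (t - T0)))).
    { apply Rmult_le_pos; [exact HBC|]; apply Rmult_le_pos; [nra|left; apply exp_pos]. }
    lra.
  + eapply Rle_trans; [apply H2; lra|].
    unfold psi, psi1; unfold weight.
    assert (He : 1 <= exp (4 * C * L * (t - T0))).
    { rewrite <- exp_0; apply exp_le. apply Rmult_le_pos; [nra|lra]. }
    set (E := exp (4 * C * L * (t - T0))) in *.
    replace (B / (2 * C) * (4 * C * L * E)) with (L * (B * (E + E))) by (field; lra).
    assert (0 <= c * (B / (2 * C) * (1 + E))) by (apply Rmult_le_pos; [lra|nra]).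
    assert (L * (B * (1 + E)) <= L * (B * (E + E))) by (apply Rmult_le_compat_l; [lra|nra]).
    lra.
Qed.

(** The gain improves a bound [B * weight] to [(B / 2 + D) * weight] with D = (C / c) eta. Iteration
    forgets the initial bound, known only to be finite, and leaves the fixed point [2 * D],
    proportional to [eta]. *)
Lemma stability (T T0 L eta : R) (v v1 H : R -> R) :
  0 <= L -> 0 <= eta -> solves a h T v v1 H -> past_bounded v ->
  (forall t, t <= T -> t <= T0 -> Rabs (H t) <= e0 * Rabs (v t) + eta) ->
  (forall t, t <= T -> T0 <= t -> Rabs (H t) <= L * Rabs (v t) + eta) ->
  forall t, t <= T -> Rabs (v t) <= 2 * (C / c) * weight L T0 t * eta /\
    Rabs (v1 t) <= 2 * (C / c) * weight L T0 t * eta.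
Proof.
intros HL Heta Hv Hvb H1 H2.
set (D := C / c * eta).
assert (HCc : 0 < C / c) by now apply Rdiv_lt_0_compat.
assert (HD : 0 <= D) by (unfold D; nra).
assert (He0 : 0 < e0) by (unfold e0; apply Rdiv_lt_0_compat; lra).
destruct (bounded_upto v T) as [B0 [HB0 HvB0]]; auto.
{ intros t Ht; eapply solves_continuous; eauto. }
assert (Step : forall B, 0 <= B ->
  (forall t, t <= T -> Rabs (v t) <= B * weight L T0 t) ->
  forall t, t <= T -> Rabs (v t) <= (B / 2 + D) * weight L T0 t /\
    Rabs (v1 t) <= (B / 2 + D) * weight L T0 t).
{ intros B HB Hb t Ht.
  destruct (weighted_gain T T0 L B eta v v1 H) with (t := t) as [A A1]; auto.
  - intros s Hs Hs'; eapply Rle_trans; [now apply H1|].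
    apply Rplus_le_compat_r, Rmult_le_compat_l; [lra|now apply Hb].
  - intros s Hs Hs'; eapply Rle_trans; [now apply H2|].
    apply Rplus_le_compat_r, Rmult_le_compat_l; [lra|now apply Hb].
  - fold D in A, A1; generalize (weight_ge1 L T0 t); intros; nra. }
assert (Iter : forall n, forall t, t <= T -> Rabs (v t) <= (B0 / 2 ^ n + 2 * D) * weight L T0 t).
{ induction n; intros t Ht.
  - generalize (weight_ge1 L T0 t) (HvB0 t Ht); simpl; unfold Rdiv; rewrite Rinv_1; nra.
  - assert (0 < 2 ^ n) by (apply pow_lt; lra).
    assert (0 <= B0 / 2 ^ n) by now apply Rdiv_le_0_compat.
    destruct (Step (B0 / 2 ^ n + 2 * D)) with (t := t) as [A _]; auto; [lra|].
    eapply Rle_trans; [apply A|right; simpl; f_equal; field; lra]. }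
assert (Lim : forall t, t <= T -> Rabs (v t) <= 2 * D * weight L T0 t).
{ intros t Ht; apply le_of_forall_eps; intros eps He.
  set (W := weight L T0 t); assert (HW : 1 <= W) by apply weight_ge1.
  destruct (pow_lt_1_zero (/ 2)) with (y := eps / (B0 * W + 1)) as [n Hn].
  { rewrite Rabs_pos_eq; lra. }
  { apply Rdiv_lt_0_compat; [lra|nra]. }
  specialize (Hn n (le_n n)); rewrite Rabs_pos_eq in Hn by (apply pow_le; lra).
  eapply Rle_trans; [apply (Iter n t Ht)|]; fold W.
  rewrite pow_inv in Hn.
  assert (B0 * W * / 2 ^ n <= eps).
  { apply (Rle_trans _ ((B0 * W + 1) * (eps / (B0 * W + 1)))).
    - assert (0 < / 2 ^ n) by (apply Rinv_0_lt_compat, pow_lt; lra).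
      apply Rmult_le_compat; try lra; nra.
    - right; field; nra. }
  unfold Rdiv; nra. }
intros t Ht; split.
- eapply Rle_trans; [now apply Lim|]; right; unfold D; ring.
- destruct (Step (2 * D) ltac:(lra) Lim t Ht) as [_ A].
  eapply Rle_trans; [apply A|]; right; unfold D; field; lra.
Qed.

(** For the homogeneous solution x -> G(x - s), [flow] and [flow1] do not depend on their last
    argument; the two sides are the values at [t] and at 0. The separated form lets a convolution
    with [G] be written through primitives in which [t] no longer occurs. *)
Lemma kernel_addition (t s : R) :
  G (t - s) = G1 (- s) * G t + G (- s) * (G1 t + a * G t) /\
  G1 (t - s) = G1 (- s) * G1 t - h * G (- s) * G t.
Proof.
assert (Hs : forall T, solves a h T (fun x => G (x - s)) (fun x => G1 (x - s)) (fun _ => 0)).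
{ intros T x _; assert (DG := HG (x + - s)); assert (DG1 := HG1 (x + - s)); split; derive_known. }
destruct (flow_diag (fun x => G (x - s)) (fun x => G1 (x - s)) t) as [E E1].
rewrite <- E, <- E1.
rewrite (derive_zero_const (flow (fun x => G (x - s)) (fun x => G1 (x - s)) t)) with (y := 0).
2:{ intros x; destruct (is_derive_flow _ _ _ x t x (Hs x) (Rle_refl x)) as [D1 D2].
  exact (is_derive_eq _ _ _ _ D1 (Rmult_0_r _)). }
rewrite (derive_zero_const (flow1 (fun x => G (x - s)) (fun x => G1 (x - s)) t)) with (y := 0).
2:{ intros x; destruct (is_derive_flow _ _ _ x t x (Hs x) (Rle_refl x)) as [D1 D2].
  exact (is_derive_eq _ _ _ _ D2 (Rmult_0_r _)). }
unfold flow, flow1; rewrite !Rminus_0_r, Rminus_0_l; split; ring.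
Qed.

(** The solution is the integral of G(t - s) H(s) over s < t, with the kernel split by
    [kernel_addition]; [P] and [Q] are the primitives from -oo of G1(-s) H(s) and G(-s) H(s). *)
Lemma linear_exists (H : R -> R) :
  (forall t, continuous H t) -> past_bounded H ->
  exists v v1, (forall T, solves a h T v v1 H) /\ past_bounded v.
Proof.
intros Hcont [B [S HB]].
assert (HBpos : 0 <= B) by (eapply Rle_trans; [apply Rabs_pos|apply (HB S); lra]).
(* The kernel bounds hold for nonnegative arguments, so -s >= 0 is required. *)
set (S' := Rmin S 0).
assert (HS1 : S' <= S) by apply Rmin_l; assert (HS2 : S' <= 0) by apply Rmin_r.
assert (Hk : forall (K : R -> R), (forall t, continuous K t) ->
  (forall t, 0 <= t -> Rabs (K t) <= C * exp (- c * t)) ->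
  exists Phi, (forall t, is_derive Phi t (K (- t) * H t)) /\
    forall s, s <= S' -> Rabs (Phi s) <= C * B / c * exp (c * s)).
{ intros K HK HKb; apply antiderivative_tail; auto.
  - intros t; apply (continuous_mult (K := R_AbsRing)); auto.
    apply continuous_comp; auto. apply (continuous_opp (V := R_NormedModule)), continuous_id.
  - intros s Hs; rewrite Rabs_mult.
    replace (C * B * exp (c * s)) with (C * exp (- c * - s) * B)
      by (replace (- c * - s) with (c * s) by ring; ring).
    apply Rmult_le_compat; try apply Rabs_pos; [apply HKb; lra|apply HB; lra]. }
destruct (Hk G1) as [P [DP HP]]; auto.
{ intros t; exact (is_derive_continuous _ _ _ (HG1 t)). }
destruct (Hk G) as [Q [DQ HQ]]; auto.
{ intros t; exact (is_derive_continuous _ _ _ (HG t)). }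
exists (fun t => G t * P t + (G1 t + a * G t) * Q t), (fun t => G1 t * P t - h * G t * Q t).
split.
- intros T t _.
  assert (D1 := HG t); assert (D2 := HG1 t); assert (D3 := DP t); assert (D4 := DQ t).
  destruct (kernel_addition t t) as [E E1].
  replace (t - t) with 0 in E, E1 by ring; rewrite HG0 in E; rewrite HG10 in E1.
  split; derive_known.
  + apply Rminus_diag_uniq.
    transitivity ((G1 (- t) * G t + G (- t) * (G1 t + a * G t)) * H t); [ring|rewrite <- E; ring].
  + apply Rminus_diag_uniq.
    transitivity ((G1 (- t) * G1 t - h * G (- t) * G t) * H t - 1 * H t); [ring|rewrite <- E1; ring].
- exists (C * B / c + 1), S'; intros t Ht.
  set (X := Rabs (G t) + Rabs (G1 t + a * G t)).
  assert (HX : 0 <= X) by (unfold X; generalize (Rabs_pos (G t)) (Rabs_pos (G1 t + a * G t)); lra).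
  set (M := C * B / c) in *.
  assert (HM : 0 <= M) by (unfold M; apply Rdiv_le_0_compat; [apply Rmult_le_pos; lra|lra]).
  destruct (exp_neg_lt c (/ (M * X + 1))) as [S1 HS3]; auto.
  { apply Rinv_0_lt_compat; nra. }
  set (s := Rmin S1 t); assert (Hs1 : s <= S1) by apply Rmin_l; assert (Hs2 : s <= t) by apply Rmin_r.
  specialize (HS3 s Hs1).
  (* With [t] frozen in the kernel, [Psi t] is the solution at [t] and the derivative of [Psi] at s
     is G(t - s) H(s), whose total is at most C B / c. The two summands of the solution may each be
     unbounded. *)
  set (Psi := fun s => G t * P s + (G1 t + a * G t) * Q s).
  assert (HPsi : Rabs (Psi s) <= 1).
  { unfold Psi; eapply Rle_trans; [apply Rabs_triang|]; rewrite !Rabs_mult.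
    assert (H1 := HP s ltac:(lra)); assert (H2 := HQ s ltac:(lra)).
    assert (H3 : M * exp (c * s) <= M * / (M * X + 1)) by (apply Rmult_le_compat_l; auto).
    apply (Rle_trans _ (X * (M * / (M * X + 1)))).
    - unfold X; rewrite Rmult_plus_distr_r; apply Rplus_le_compat;
        apply Rmult_le_compat_l; try apply Rabs_pos; fold X; lra.
    - apply (Rmult_le_reg_r (M * X + 1)); [nra|].
      replace (X * (M * / (M * X + 1)) * (M * X + 1)) with (M * X) by (field; nra); lra. }
  assert (HPt : Rabs (Psi t - Psi s) <= M).
  { set (g := fun x => M * exp (- c * (t - x))).
    apply (Rle_trans _ (g t - g s)).
    - apply (derive_abs_le Psi (fun x => G (t - x) * H x) g (fun x => C * exp (- c * (t - x)) * B)); auto.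
      + intros x Hx; assert (D3 := DP x); assert (D4 := DQ x); unfold Psi; derive_known.
        fold (t - x); destruct (kernel_addition t x) as [-> _]; ring.
      + intros x Hx; unfold g, M; auto_derive; auto; unfold Rminus; field; lra.
      + intros x Hx; rewrite Rabs_mult; apply Rmult_le_compat; try apply Rabs_pos;
          [apply HGb; lra|apply HB; lra].
    - unfold g; replace (- c * (t - t)) with 0 by ring; rewrite exp_0.
      generalize (exp_pos (- c * (t - s))); nra. }
  change (Rabs (Psi t) <= M + 1).
  replace (Psi t) with ((Psi t - Psi s) + Psi s) by ring.
  eapply Rle_trans; [apply Rabs_triang|lra].
Qed.

(** * Picard iteration for contractive nonlinearities *)

Section FixedPoint.

Variables (F : R -> R -> R) (T0 : R).
Hypothesis Fcont : forall z, (forall t, continuous z t) -> forall t, continuous (fun t => F t (z t)) t.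
Hypothesis Fpast : forall t x y, t <= T0 -> Rabs (F t x - F t y) <= e0 * Rabs (x - y).
Hypothesis Flip : forall T, exists L, 0 <= L /\
  forall t x y, t <= T -> Rabs (F t x - F t y) <= L * Rabs (x - y).
Hypothesis F0 : past_bounded (fun t => F t 0).

Lemma past_bounded_comp (z : R -> R) : past_bounded z -> past_bounded (fun t => F t (z t)).
Proof.
intros [B [S HB]]; destruct F0 as [B' [S' HB']].
assert (He0 : 0 < e0) by (unfold e0; apply Rdiv_lt_0_compat; lra).
exists (e0 * B + B'), (Rmin T0 (Rmin S S')); intros t Ht.
assert (H1 := Rmin_l T0 (Rmin S S')); assert (H2 := Rmin_r T0 (Rmin S S')).
assert (H3 := Rmin_l S S'); assert (H4 := Rmin_r S S').
replace (F t (z t)) with ((F t (z t) - F t 0) + F t 0) by ring.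
eapply Rle_trans; [apply Rabs_triang|]; apply Rplus_le_compat; [|apply HB'; lra].
eapply Rle_trans; [apply Fpast; lra|].
apply Rmult_le_compat_l; [lra|]; rewrite Rminus_0_r; apply HB; lra.
Qed.

(** By [weighted_gain], successive Picard differences halve in the weighted norm. The weight depends
    on the Lipschitz constant up to [T], so the estimate is made for each [T] separately, while the
    limit [z] is defined pointwise, independently of [T]. *)
Lemma contraction_fixed_point :
  exists z z1, (forall T, solves a h T z z1 (fun t => F t (z t))) /\ past_bounded z.
Proof.
assert (He0 : 0 < e0) by (unfold e0; apply Rdiv_lt_0_compat; lra).
(* A solution operator for the linear equation, with zero as default value where [H] is not an
   admissible source. *)
destruct (functional_choice (fun (H : R -> R) (w : (R -> R) * (R -> R)) =>
  (forall t, continuous H t) -> past_bounded H ->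
  (forall T, solves a h T (fst w) (snd w) H) /\ past_bounded (fst w))) as [S HS].
{ intros H; destruct (classic ((forall t, continuous H t) /\ past_bounded H)) as [[H1 H2]|Hn].
  - destruct (linear_exists H H1 H2) as [v [v1 Hv]]; exists (v, v1); auto.
  - exists ((fun _ => 0), (fun _ => 0)); tauto. }
set (sol := fun z => S (fun t => F t (z t))).
assert (Hsol : forall z, (forall t, continuous z t) -> past_bounded z ->
  (forall T, solves a h T (fst (sol z)) (snd (sol z)) (fun t => F t (z t))) /\
  past_bounded (fst (sol z)) /\ forall t, continuous (fst (sol z)) t).
{ intros z Hz Hzb; destruct (HS (fun t => F t (z t))) as [H1 H2]; auto.
  { now apply past_bounded_comp. }
  split; [exact H1|split; [exact H2|intros t]].
  exact (solves_continuous _ _ t _ _ _ t (H1 t) (Rle_refl t)). }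
set (it := fun n => Nat.iter n (fun z => fst (sol z)) (fun _ => 0)).
assert (Hit : forall n, (forall t, continuous (it n) t) /\ past_bounded (it n)).
{ induction n as [|n [IH1 IH2]].
  - split; [intros t; apply continuous_const|].
    exists 0, 0; intros; simpl; rewrite Rabs_R0; lra.
  - destruct (Hsol (it n) IH1 IH2) as [_ [H1 H2]]; split; auto. }
assert (Hits : forall n T, solves a h T (it (Datatypes.S n)) (snd (sol (it n))) (fun t => F t (it n t))).
{ intros n; destruct (Hit n) as [H1 H2]; apply (Hsol (it n) H1 H2). }
assert (Hgain : forall T, exists L B, 0 <= L /\ 0 <= B /\
  (forall t x y, t <= T -> Rabs (F t x - F t y) <= L * Rabs (x - y)) /\
  forall n t, t <= T -> Rabs (it (Datatypes.S n) t - it n t) <= B * weight L T0 t / 2 ^ n).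
{ intros T; destruct (Flip T) as [L [HL Hlip]].
  destruct (bounded_upto (it 1%nat) T) as [B [HB HbB]].
  { intros; apply Hit. } { apply Hit. }
  exists L, B; repeat match goal with |- _ /\ _ => split end; auto.
  induction n; intros t Ht.
  - simpl; unfold Rdiv; rewrite Rinv_1, Rmult_1_r, Rminus_0_r.
    generalize (HbB t Ht) (weight_ge1 L T0 t); simpl; nra.
  - assert (Hp : 0 < 2 ^ n) by (apply pow_lt; lra).
    destruct (weighted_gain T T0 L (B / 2 ^ n) 0
      (fun t => it (Datatypes.S (Datatypes.S n)) t - it (Datatypes.S n) t)
      (fun t => snd (sol (it (Datatypes.S n))) t - snd (sol (it n)) t)
      (fun t => F t (it (Datatypes.S n) t) - F t (it n t))) with (t := t) as [A _]; auto; try lra.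
    + now apply Rdiv_le_0_compat.
    + apply solves_minus; apply Hits.
    + apply past_bounded_minus; apply Hit.
    + intros s Hs Hs'; rewrite Rplus_0_r; eapply Rle_trans; [now apply Fpast|].
      apply Rmult_le_compat_l; [lra|]; eapply Rle_trans; [now apply IHn|right; field; lra].
    + intros s Hs Hs'; rewrite Rplus_0_r; eapply Rle_trans; [now apply Hlip|].
      apply Rmult_le_compat_l; [lra|]; eapply Rle_trans; [now apply IHn|right; field; lra].
    + eapply Rle_trans; [apply A|right; simpl; field; lra]. }
destruct (functional_choice (fun t l => is_lim_seq (fun n => it n t) (Finite l))) as [z Hz].
{ intros t; destruct (Hgain t) as [L [B [HL [HB [_ Hg]]]]].
  destruct (geometric_limit (fun n => it n t) (B * weight L T0 t)) as [l [Hl _]].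
  { intros n; apply Hg; lra. }
  now exists l. }
assert (Hzn : forall T L B, 
  (forall n t, t <= T -> Rabs (it (Datatypes.S n) t - it n t) <= B * weight L T0 t / 2 ^ n) ->
  forall n t, t <= T -> Rabs (it n t - z t) <= 2 * (B * weight L T0 t) / 2 ^ n).
{ intros T L B Hg n t Ht.
  destruct (geometric_limit (fun n => it n t) (B * weight L T0 t)) as [l [Hl Hb]].
  { intros m; now apply Hg. }
  assert (E : l = z t).
  { generalize (is_lim_seq_unique _ _ Hl) (is_lim_seq_unique _ _ (Hz t)); congruence. }
  rewrite <- E; apply Hb. }
assert (Hzc : forall t, continuous z t).
{ intros t; destruct (Hgain (t + 1)) as [L [B [HL [HB [_ Hg]]]]].
  specialize (Hzn _ _ _ Hg).
  apply continuous_of_local_approx; intros eps He.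
  set (W := weight L T0 (t + 1)).
  assert (HW : 1 <= W) by apply weight_ge1.
  destruct (small_half_pow (2 * (B * W)) eps) as [n Hn]; auto.
  exists (it n); split; [apply Hit|]; exists 1; split; [lra|]; intros s Hs.
  apply Rabs_def2 in Hs.
  eapply Rle_trans; [apply Hzn; lra|].
  eapply Rle_trans; [|apply Hn].
  apply Rmult_le_compat_r; [left; apply Rinv_0_lt_compat, pow_lt; lra|].
  apply Rmult_le_compat_l; [lra|]; apply Rmult_le_compat_l; [lra|].
  apply weight_mono; lra. }
assert (Hzb : past_bounded z).
{ destruct (Hgain T0) as [L [B [HL [HB [_ Hg]]]]].
  exists (2 * (B * 2)), T0; intros t Ht.
  specialize (Hzn _ _ _ Hg 0%nat t Ht); simpl in Hzn.
  rewrite <- Rabs_Ropp; replace (- z t) with (0 - z t) by ring.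
  eapply Rle_trans; [apply Hzn|]; unfold Rdiv; rewrite Rinv_1, Rmult_1_r.
  apply Rmult_le_compat_l; [lra|]; apply Rmult_le_compat_l; [lra|].
  now apply weight_past. }
destruct (Hsol z Hzc Hzb) as [Hy1 [Hy2 Hy3]].
(* Both sides are close to the iterate of index n + 1: the left one by one more gain, the right one
   by convergence. *)
assert (E : forall t, fst (sol z) t = z t).
{ intros t; destruct (Hgain t) as [L [B [HL [HB [Hlip Hg]]]]].
  specialize (Hzn _ _ _ Hg).
  set (W := weight L T0 t).
  assert (HW : 1 <= W) by apply weight_ge1.
  apply Rminus_diag_uniq, Rabs_eq_0, Rle_antisym; [|apply Rabs_pos].
  apply le_of_forall_eps; intros eps He; rewrite Rplus_0_l.
  destruct (small_half_pow (2 * (B * W)) eps) as [n Hn]; auto.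
  assert (Hp : 0 < 2 ^ n) by (apply pow_lt; lra).
  destruct (weighted_gain t T0 L (2 * B / 2 ^ n) 0
      (fun t => fst (sol z) t - it (Datatypes.S n) t)
      (fun t => snd (sol z) t - snd (sol (it n)) t)
      (fun t => F t (z t) - F t (it n t))) with (t := t) as [A _]; auto; try lra.
  - apply Rdiv_le_0_compat; lra.
  - apply solves_minus; auto.
  - apply past_bounded_minus; auto. apply Hit.
  - intros s Hs Hs'; rewrite Rplus_0_r; eapply Rle_trans; [now apply Fpast|].
    apply Rmult_le_compat_l; [lra|]; rewrite Rabs_minus_sym.
    eapply Rle_trans; [now apply Hzn|right; field; lra].
  - intros s Hs Hs'; rewrite Rplus_0_r; eapply Rle_trans; [now apply Hlip|].
    apply Rmult_le_compat_l; [lra|]; rewrite Rabs_minus_sym.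
    eapply Rle_trans; [now apply Hzn|right; field; lra].
  - replace (fst (sol z) t - z t) with
      ((fst (sol z) t - it (Datatypes.S n) t) + (it (Datatypes.S n) t - z t)) by ring.
    eapply Rle_trans; [apply Rabs_triang|].
    eapply Rle_trans; [|apply Hn].
    eapply Rle_trans; [apply Rplus_le_compat; [apply A|apply Hzn; lra]|].
    fold W; right; simpl; field; lra. }
exists z, (snd (sol z)); split; auto.
intros T t Ht; destruct (Hy1 T t Ht) as [D1 D2]; split.
- eapply is_derive_ext; [exact E|exact D1].
- rewrite <- (E t) at 2; exact D2.
Qed.

End FixedPoint.

End Oscillator.

(* In [past_stable] the constant does not depend on the time [T] up to which the source is controlled. *)
Definition past_stable (a h e0 D0 : R) : Prop :=
  forall T eta v v1 H, 0 <= eta -> solves a h T v v1 H -> past_bounded v ->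
  (forall t, t <= T -> Rabs (H t) <= e0 * Rabs (v t) + eta) ->
  forall t, t <= T -> Rabs (v t) <= D0 * eta /\ Rabs (v1 t) <= D0 * eta.

(** Here [L] may be large; [D] depends on [T], [T0] and [L], but neither on the solution nor on the
    source. *)
Definition locally_stable (a h e0 : R) : Prop :=
  forall T T0 L, 0 <= L -> exists D, 0 < D /\
  forall eta v v1 H, 0 <= eta -> solves a h T v v1 H -> past_bounded v ->
  (forall t, t <= T -> t <= T0 -> Rabs (H t) <= e0 * Rabs (v t) + eta) ->
  (forall t, t <= T -> T0 <= t -> Rabs (H t) <= L * Rabs (v t) + eta) ->
  forall t, t <= T -> Rabs (v t) <= D * eta /\ Rabs (v1 t) <= D * eta.

Definition contraction_solvable (a h e0 : R) : Prop :=
  forall (F : R -> R -> R) (T0 : R),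
  (forall z, (forall t, continuous z t) -> forall t, continuous (fun t => F t (z t)) t) ->
  (forall t x y, t <= T0 -> Rabs (F t x - F t y) <= e0 * Rabs (x - y)) ->
  (forall T, exists L, 0 <= L /\
    forall t x y, t <= T -> Rabs (F t x - F t y) <= L * Rabs (x - y)) ->
  past_bounded (fun t => F t 0) ->
  exists z z1, (forall T, solves a h T z z1 (fun t => F t (z t))) /\ past_bounded z.

Lemma oscillator_theory (a h : R) : 0 < a -> 0 < h ->
  exists e0 D0, 0 < e0 /\ 0 < D0 /\
    past_stable a h e0 D0 /\ locally_stable a h e0 /\ contraction_solvable a h e0.
Proof.
intros Ha Hh.
destruct (oscillator_kernel a h Ha Hh) as (G & G1 & C & c & HC & Hc & HG0 & HG10 & HG & HG1 & HGb & HG1b).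
assert (He : 0 < c / (2 * C)) by (apply Rdiv_lt_0_compat; lra).
assert (HCc : 0 < C / c) by now apply Rdiv_lt_0_compat.
(* [stability] is used with [T0 = T] and [L = e0]; the weight is then at most 2, and
   [2 * (C / c) * weight] at most [4 * (C / c)]. *)
exists (c / (2 * C)), (4 * (C / c)).
split; [exact He|]; split; [lra|]; split; [|split].
- intros T eta v v1 H Heta Hv Hvb HH t Ht.
  assert (St := stability a h C c G G1 Ha Hh HC Hc HG0 HG10 HG HG1 HGb HG1b T T (c / (2 * C)) eta v v1 H).
  destruct St with (t := t) as [A A1]; auto; try lra.
  assert (W := weight_past C HC (c / (2 * C)) T t ltac:(lra) Ht); cbv beta in W.
  set (w := 1 + exp _) in *; set (q := C / c) in *; clearbody w q; clear - HCc W A A1 Heta.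
  split; (eapply Rle_trans; [eassumption|]); apply Rmult_le_compat_r; nra.
- intros T T0 L HL.
  assert (W := weight_ge1 C L T0 T).
  exists (2 * (C / c) * (1 + exp (4 * C * L * (T - T0)))); split; [nra|].
  intros eta v v1 H Heta Hv Hvb H1 H2 t Ht.
  assert (St := stability a h C c G G1 Ha Hh HC Hc HG0 HG10 HG HG1 HGb HG1b T T0 L eta v v1 H).
  destruct St with (t := t) as [A A1]; auto.
  assert (W' := weight_mono C HC L T0 t T HL Ht); cbv beta in W, W'.
  set (w := 1 + exp (_ * (t - T0))) in *; set (w' := 1 + exp _) in *; set (q := C / c) in *.
  clearbody w w' q; clear - HCc W W' A A1 Heta.
  split; (eapply Rle_trans; [eassumption|]); apply Rmult_le_compat_r; nra.
- intros F T0.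
  exact (contraction_fixed_point a h C c G G1 Ha Hh HC Hc HG0 HG10 HG HG1 HGb HG1b F T0).
Qed.

(** * Truncated powers *)

Lemma pospow_pos_eq (x q : R) : 0 < x -> pospow x q = Rpower x q.
Proof. intros H; unfold pospow; destruct (Rlt_dec 0 x); lra. Qed.

Lemma pospow_nonpos (x q : R) : x <= 0 -> pospow x q = 0.
Proof. intros H; unfold pospow; destruct (Rlt_dec 0 x); lra. Qed.

Lemma pospow_nonneg (x q : R) : 0 <= pospow x q.
Proof. unfold pospow; destruct (Rlt_dec 0 x); [left; apply exp_pos|lra]. Qed.

Lemma pospow_mono (x y q : R) : 0 <= q -> x <= y -> pospow x q <= pospow y q.
Proof.
intros Hq Hxy; destruct (Rle_lt_dec x 0) as [Hx|Hx].
- rewrite (pospow_nonpos x) by auto; apply pospow_nonneg.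
- rewrite !pospow_pos_eq by lra; apply Rle_Rpower_l; lra.
Qed.

Lemma pospow_step (x q : R) : pospow x q = x * pospow x (q - 1).
Proof.
destruct (Rle_lt_dec x 0) as [Hx|Hx].
- rewrite !pospow_nonpos by auto; ring.
- rewrite !pospow_pos_eq by auto.
  rewrite <- (Rpower_1 x) at 2 by auto; rewrite <- Rpower_plus; f_equal; ring.
Qed.

Lemma locally_gt (x y : R) : x < y -> locally y (fun z => x < z).
Proof. intros H; exact (open_gt x y H). Qed.

Lemma locally_lt (x y : R) : y < x -> locally y (fun z => z < x).
Proof. intros H; exact (open_lt x y H). Qed.

Lemma continuous_pospow (q x : R) : 0 < q -> continuous (fun x => pospow x q) x.
Proof.
intros Hq; destruct (Rtotal_order x 0) as [Hx|[->|Hx]].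
- apply (continuous_ext_loc _ (fun _ => 0)); [|apply continuous_const].
  apply (filter_imp (fun z => z < 0)); [|now apply locally_lt].
  intros z Hz; rewrite pospow_nonpos; lra.
- apply continuous_eps; intros eps He.
  exists (Rpower eps (/ q)); split; [apply exp_pos|]; intros y Hy.
  rewrite Rminus_0_r in Hy; rewrite (pospow_nonpos 0) by lra; rewrite Rminus_0_r.
  rewrite Rabs_pos_eq by apply pospow_nonneg.
  destruct (Rle_lt_dec y 0) as [Hy0|Hy0]; [rewrite pospow_nonpos; lra|].
  rewrite Rabs_pos_eq in Hy by lra.
  rewrite pospow_pos_eq by auto.
  apply (Rlt_le_trans _ (Rpower (Rpower eps (/ q)) q)).
  + apply Rlt_Rpower_l; lra.
  + rewrite Rpower_mult, Rinv_l, Rpower_1; lra.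
- apply (continuous_ext_loc _ (fun x => Rpower x q)).
  + apply (filter_imp (fun z => 0 < z)); [|now apply locally_gt].
    intros z Hz; now rewrite pospow_pos_eq.
  + apply (is_derive_continuous _ _ (q * Rpower x (q - 1))), is_derive_Reals.
    now apply derivable_pt_lim_power.
Qed.

(** At 0 the difference quotient is [pospow y (p - 1)] by [pospow_step], which tends to 0 because p
    > 1. *)
Lemma is_derive_pospow (p x : R) : 1 < p ->
  is_derive (fun x => pospow x p) x (p * pospow x (p - 1)).
Proof.
intros Hp; destruct (Rtotal_order x 0) as [Hx|[->|Hx]].
- apply (is_derive_ext_loc (fun _ => 0)).
  + apply (filter_imp (fun z => z < 0)); [|now apply locally_lt].
    intros z Hz; rewrite pospow_nonpos; lra.
  + rewrite pospow_nonpos, Rmult_0_r by lra; apply is_derive_Reals, derivable_pt_lim_const.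
- apply is_derive_Reals; intros eps He.
  destruct (continuous_eps_elim _ 0 (continuous_pospow (p - 1) 0 ltac:(lra)) eps He) as [d [Hd Hy]].
  exists (mkposreal d Hd); intros y Hy0 Hyd; simpl in Hyd.
  specialize (Hy (0 + y)); rewrite (pospow_nonpos 0 (p - 1)), Rminus_0_r in Hy by lra.
  rewrite (pospow_step (0 + y)), (pospow_nonpos 0), (pospow_nonpos 0) by lra.
  replace (((0 + y) * pospow (0 + y) (p - 1) - 0) / y - p * 0) with (pospow (0 + y) (p - 1)) by (field; auto).
  rewrite Rminus_0_r in Hy; apply Hy; rewrite Rplus_0_l; auto.
- apply (is_derive_ext_loc (fun x => Rpower x p)).
  + apply (filter_imp (fun z => 0 < z)); [|now apply locally_gt].
    intros z Hz; now rewrite pospow_pos_eq.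
  + rewrite pospow_pos_eq by auto; apply is_derive_Reals; now apply derivable_pt_lim_power.
Qed.

Lemma mean_value (f f' : R -> R) (x y : R) :
  (forall s, is_derive f s (f' s)) ->
  exists s, Rmin x y <= s <= Rmax x y /\ f y - f x = f' s * (y - x).
Proof.
intros H; apply MVT_gen; auto.
intros s _; apply continuity_pt_filterlim; exact (is_derive_continuous f s _ (H s)).
Qed.

(** The derivative [p * pospow s (p - 1)] is nondecreasing and zero for [s <= 0], so an upper bound
    for the arguments alone controls it. *)
Lemma pospow_lipschitz (p M x y : R) : 1 < p -> x <= M -> y <= M ->
  Rabs (pospow x p - pospow y p) <= p * pospow M (p - 1) * Rabs (x - y).
Proof.
intros Hp Hx Hy.
destruct (mean_value (fun x => pospow x p) (fun x => p * pospow x (p - 1)) y x) as [s [Hs ->]].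
{ intros s; now apply is_derive_pospow. }
rewrite Rabs_mult; apply Rmult_le_compat_r; [apply Rabs_pos|].
assert (HP := pospow_nonneg s (p - 1)).
rewrite Rabs_pos_eq by nra; apply Rmult_le_compat_l; [lra|].
apply pospow_mono; [lra|]; eapply Rle_trans; [apply Hs|now apply Rmax_lub].
Qed.

Definition clamp (d x : R) : R := Rmax (- d) (Rmin d x).

Lemma clamp_bound (d x : R) : 0 <= d -> Rabs (clamp d x) <= d.
Proof.
intros Hd; unfold clamp; apply Rabs_le; split; [apply Rmax_l|].
apply Rmax_lub; [lra|apply Rmin_l].
Qed.

Lemma clamp_id (d x : R) : Rabs x <= d -> clamp d x = x.
Proof.
intros Hx; apply Rabs_le_between in Hx; unfold clamp.
rewrite Rmin_right, Rmax_right; lra.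
Qed.

Lemma Rmin_lipschitz (d x y : R) : Rabs (Rmin d x - Rmin d y) <= Rabs (x - y).
Proof.
unfold Rmin; destruct (Rle_dec d x), (Rle_dec d y); unfold Rabs;
  repeat destruct Rcase_abs; lra.
Qed.

Lemma Rmax_lipschitz (d x y : R) : Rabs (Rmax d x - Rmax d y) <= Rabs (x - y).
Proof.
unfold Rmax; destruct (Rle_dec d x), (Rle_dec d y); unfold Rabs;
  repeat destruct Rcase_abs; lra.
Qed.

Lemma clamp_lipschitz (d x y : R) : Rabs (clamp d x - clamp d y) <= Rabs (x - y).
Proof.
unfold clamp; eapply Rle_trans; [apply Rmax_lipschitz|apply Rmin_lipschitz].
Qed.

Lemma continuous_nonexpansive (f : R -> R) (x : R) :
  (forall y, Rabs (f y - f x) <= Rabs (y - x)) -> continuous f x.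
Proof.
intros H; apply continuous_eps; intros eps He; exists eps; split; auto.
intros y Hy; eapply Rle_lt_trans; [apply H|exact Hy].
Qed.

Lemma continuous_Rmin (f g : R -> R) (x : R) :
  continuous f x -> continuous g x -> continuous (fun t => Rmin (f t) (g t)) x.
Proof.
intros Hf Hg.
apply (continuous_ext (fun t => (f t + g t - Rabs (f t - g t)) / 2)).
{ intros t; unfold Rmin, Rabs; destruct (Rle_dec (f t) (g t)), Rcase_abs; simpl; lra. }
apply (continuous_mult (K := R_AbsRing)); [|apply continuous_const].
apply (continuous_minus (V := R_NormedModule)).
- now apply (continuous_plus (V := R_NormedModule)).
- apply continuous_comp; [now apply (continuous_minus (V := R_NormedModule))|apply continuous_Rabs].
Qed.

Lemma continuous_add (f g : R -> R) (x : R) :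
  continuous f x -> continuous g x -> continuous (fun t => f t + g t) x.
Proof. exact (continuous_plus (V := R_NormedModule) f g x). Qed.

Lemma continuous_sub (f g : R -> R) (x : R) :
  continuous f x -> continuous g x -> continuous (fun t => f t - g t) x.
Proof. exact (continuous_minus (V := R_NormedModule) f g x). Qed.

Lemma continuous_mul (f g : R -> R) (x : R) :
  continuous f x -> continuous g x -> continuous (fun t => f t * g t) x.
Proof. exact (continuous_mult (K := R_AbsRing) f g x). Qed.

Lemma continuous_cst (c x : R) : continuous (fun _ : R => c) x.
Proof. apply continuous_const. Qed.

(** * Power series *)

(** [h n] is the table of the first [n] values; passing to [h (S n)] changes only the entry [n], so
    the diagonal [h (S n) n] satisfies the recursion. *)
Lemma course_of_values (X : Type) (x0 : X) (step : nat -> (nat -> X) -> X) :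
  (forall n f g, (forall i, (i < n)%nat -> f i = g i) -> step n f = step n g) ->
  exists u, forall n, u n = step n u.
Proof.
intros Hstep.
set (h := fix h n := match n with
  | O => fun _ => x0
  | S n => fun i => if Nat.eqb i n then step n (h n) else h n i end).
assert (Hh : forall m i, (i < m)%nat -> h m i = h (S i) i).
{ induction m; intros i Hi; [lia|].
  simpl; destruct (Nat.eqb_spec i m) as [->|Hn].
  - now rewrite Nat.eqb_refl.
  - rewrite Nat.eqb_refl; rewrite IHm by lia; simpl; now rewrite Nat.eqb_refl. }
exists (fun n => h (S n) n); intros n.
simpl; rewrite Nat.eqb_refl; apply Hstep; intros i Hi; now apply Hh.
Qed.

(** The value at 0 matches formal series without constant term. The convolution square of this
    sequence is at most a multiple of it, which fails for the constant sequence that a purely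
    geometric bound would give. *)
Definition invsq (n : nat) : R := match n with O => 0 | S _ => / (INR n * INR n) end.

Lemma invsq_bounds (n : nat) : 0 <= invsq n <= 1.
Proof.
destruct n as [|n]; [simpl; lra|]; unfold invsq.
assert (1 <= INR (S n)) by (rewrite S_INR; generalize (pos_INR n); lra).
assert (1 <= INR (S n) * INR (S n)) by nra.
split; [left; apply Rinv_0_lt_compat; lra|].
rewrite <- Rinv_1; apply Rinv_le_contravar; lra.
Qed.

(** Telescoping, from 1/(x + 1)^2 <= 1/x - 1/(x + 1). *)
Lemma sum_invsq (n : nat) : sum_f_R0 invsq (S n) <= 2 - / INR (S n).
Proof.
induction n; [simpl; lra|].
rewrite tech5; unfold invsq at 2.
assert (0 < INR (S n)) by apply lt_0_INR, Nat.lt_0_succ.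
rewrite (S_INR (S n)); set (x := INR (S n)) in *; clearbody x.
assert (E : / x - / (x + 1) = / (x * (x + 1))) by (field; lra).
assert (/ ((x + 1) * (x + 1)) <= / (x * (x + 1))) by (apply Rinv_le_contravar; nra).
lra.
Qed.

Lemma sum_f_R0_rev (f : nat -> R) (n : nat) :
  sum_f_R0 f n = sum_f_R0 (fun i => f (n - i)%nat) n.
Proof.
revert f; induction n; intros f; [reflexivity|].
rewrite (decomp_sum (fun i => f (S n - i)%nat)) by lia; simpl pred.
rewrite tech5, (IHn f), Nat.sub_0_r, Rplus_comm; f_equal.
Qed.

(** For x + y = N, 1/(x y)^2 = (1/x + 1/y)^2 / N^2 <= 2 (1/x^2 + 1/y^2) / N^2. Each of the two sums
    of inverse squares is at most 2, hence the 8. *)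
Lemma square_convolution (n : nat) :
  sum_f_R0 (fun i => invsq i * invsq (n - i)) n <= 8 * invsq n.
Proof.
destruct n as [|n]; [simpl; lra|].
set (N := S n).
assert (HN : 0 < INR N) by apply lt_0_INR, Nat.lt_0_succ.
assert (Hs : sum_f_R0 invsq N <= 2).
{ generalize (sum_invsq n) (Rinv_0_lt_compat _ HN); fold N; lra. }
apply (Rle_trans _ (sum_f_R0 (fun i => 2 * / (INR N * INR N) * (invsq i + invsq (N - i))) N)).
- apply sum_Rle; intros i Hi.
  assert (Hc : 0 < / (INR N * INR N)) by (apply Rinv_0_lt_compat, Rmult_lt_0_compat; exact HN).
  destruct (Nat.eq_dec i 0) as [->|Hi0].
  { change (invsq 0) with 0; assert (0 <= / (INR N * INR N) * invsq (N - 0)) by (apply Rmult_le_pos; [lra|apply invsq_bounds]); lra. }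
  destruct (Nat.eq_dec i N) as [->|HiN].
  { rewrite Nat.sub_diag; change (invsq 0) with 0; assert (0 <= / (INR N * INR N) * invsq N) by (apply Rmult_le_pos; [lra|apply invsq_bounds]); lra. }
  assert (Hx : 0 < INR i) by (apply lt_0_INR; lia).
  assert (Hy : 0 < INR (N - i)) by (apply lt_0_INR; lia).
  assert (E : INR N = INR i + INR (N - i)) by (rewrite <- plus_INR; f_equal; lia).
  assert (E1 : invsq i = / INR i * / INR i).
  { destruct i; [lia|]; unfold invsq; rewrite Rinv_mult; auto. }
  assert (E2 : invsq (N - i) = / INR (N - i) * / INR (N - i)).
  { destruct (N - i)%nat; [simpl in Hy; lra|]; unfold invsq; rewrite Rinv_mult; auto. }
  rewrite E1, E2, E.
  set (x := INR i) in *; set (y := INR (N - i)) in *.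
  replace (/ x * / x * (/ y * / y)) with (/ ((x + y) * (x + y)) * ((/ x + / y) * (/ x + / y))) by (field; lra).
  rewrite <- E.
  replace (2 * / (INR N * INR N) * (/ x * / x + / y * / y)) with
    (/ (INR N * INR N) * (2 * (/ x * / x + / y * / y))) by ring.
  apply Rmult_le_compat_l; [lra|].
  generalize (Rle_0_sqr (/ x - / y)); unfold Rsqr; lra.
- replace (invsq N) with (/ (INR N * INR N)) by reflexivity.
  rewrite (sum_eq _ (fun i => (invsq i + invsq (N - i)) * (2 * / (INR N * INR N)))) by (intros; ring).
  rewrite <- scal_sum, sum_plus, <- (sum_f_R0_rev invsq).
  assert (Hc : 0 < / (INR N * INR N)) by (apply Rinv_0_lt_compat, Rmult_lt_0_compat; exact HN).
  nra.
Qed.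

(** The bounds of the terms have ratio at most 1/2. The error retains the factor R0 |x|, so it is
    small for small x already at N = 0; that case gives positivity of the sum near a positive
    constant term. *)
Lemma pseries_geometric (a : nat -> R) (M R0 x : R) :
  0 <= M -> 0 < R0 -> (forall n, (1 <= n)%nat -> Rabs (a n) <= M * R0 ^ n) -> R0 * Rabs x <= / 2 ->
  is_pseries a x (PSeries a x) /\
  forall N, Rabs (sum_f_R0 (fun n => a n * x ^ n) N - PSeries a x) <= 2 * (M * (R0 * Rabs x)) / 2 ^ N.
Proof.
intros HM HR Ha Hx.
destruct (geometric_limit (sum_f_R0 (fun n => a n * x ^ n)) (M * (R0 * Rabs x))) as [l [Hl Hb]].
{ intros n; rewrite tech5; replace (sum_f_R0 (fun n => a n * x ^ n) n + a (S n) * x ^ S n -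
    sum_f_R0 (fun n => a n * x ^ n) n) with (a (S n) * x ^ S n) by ring.
  rewrite Rabs_mult, <- RPow_abs.
  apply (Rle_trans _ (M * R0 ^ S n * Rabs x ^ S n)).
  { apply Rmult_le_compat_r; [apply pow_le, Rabs_pos|apply Ha; lia]. }
  replace (M * R0 ^ S n * Rabs x ^ S n) with (M * (R0 * Rabs x) * (R0 * Rabs x) ^ n)
    by (rewrite Rpow_mult_distr; simpl; ring).
  unfold Rdiv; apply Rmult_le_compat_l.
  { apply Rmult_le_pos; [auto|apply Rmult_le_pos; [lra|apply Rabs_pos]]. }
  rewrite <- pow_inv; apply pow_incr; split; [apply Rmult_le_pos; [lra|apply Rabs_pos]|auto]. }
assert (Hs : is_pseries a x l).
{ apply is_pseries_R; unfold is_series.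
  apply (is_lim_seq_ext _ (sum_n (fun n => a n * x ^ n))) in Hl; [exact Hl|].
  intros n; symmetry; apply sum_n_Reals. }
rewrite (is_pseries_unique _ _ _ Hs); split; auto.
Qed.

Lemma CV_radius_geometric (a : nat -> R) (M R0 x : R) :
  0 < R0 -> (forall n, Rabs (a n) <= M * R0 ^ n) -> R0 * Rabs x < 1 ->
  Rbar_lt (Rabs x) (CV_radius a).
Proof.
intros HR Ha Hx.
destruct (CV_radius_bounded a) as [Hub _].
assert (Hx' : Rabs x < / R0).
{ apply (Rmult_lt_reg_l R0); auto; rewrite Rinv_r by lra; auto. }
apply (Rbar_lt_le_trans _ (Finite (/ R0))); [exact Hx'|].
apply Hub; exists M; intros n.
rewrite Rabs_mult, (Rabs_pos_eq (_ ^ n)) by (left; apply pow_lt, Rinv_0_lt_compat; auto).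
eapply Rle_trans; [apply Rmult_le_compat_r; [left; apply pow_lt, Rinv_0_lt_compat; auto|apply Ha]|].
rewrite Rmult_assoc, <- Rpow_mult_distr, Rinv_r, pow1 by lra; lra.
Qed.

(* The hypothesis on the coefficients says that [W = PSeries a] and [Q = PSeries q] satisfy
   [W Q' = p W' Q], that is, [Q W^(-p)] is constant. *)
Lemma PSeries_Rpower (a q : nat -> R) (p M R0 x1 : R) :
  0 < a O -> q O = Rpower (a O) p -> 0 < R0 -> 0 <= M ->
  (forall n, (1 <= n)%nat -> Rabs (a n) <= M * R0 ^ n /\ Rabs (q n) <= M * R0 ^ n) ->
  (forall n, sum_f_R0 (fun i => (p * INR i - INR (S n - i)) * (a i * q (S n - i)%nat)) (S n) = 0) ->
  R0 * x1 <= / 2 -> 2 * (M * (R0 * x1)) < a O ->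
  forall x, Rabs x < x1 -> 0 < PSeries a x /\ PSeries q x = Rpower (PSeries a x) p.
Proof.
intros Ha0 Hq0 HR HM Hb Hrec Hx1 Hpos.
assert (HW : forall x, Rabs x < x1 -> 0 < PSeries a x).
{ intros x Hx; destruct (pseries_geometric a M R0 x) as [_ H]; auto.
  { intros n Hn; now apply Hb. }
  { apply (Rle_trans _ (R0 * x1)); auto; apply Rmult_le_compat_l; lra. }
  specialize (H O); simpl in H; rewrite Rmult_1_r in H; unfold Rdiv in H; rewrite Rinv_1, Rmult_1_r in H.
  assert (M * (R0 * Rabs x) <= M * (R0 * x1)).
  { apply Rmult_le_compat_l; auto; apply Rmult_le_compat_l; lra. }
  apply Rabs_le_between in H; lra. }
assert (HCV : forall c, (forall n, (1 <= n)%nat -> Rabs (c n) <= M * R0 ^ n) ->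
  forall x, Rabs x < x1 -> Rbar_lt (Rabs x) (CV_radius c)).
(* The coefficients are bounded by [M * R0 ^ n] only from index 1 on, hence the maximum with |c
   0|. *)
{ intros c Hc x Hx; apply (CV_radius_geometric c (Rmax M (Rabs (c O))) R0 x); auto.
  - intros [|n]; [simpl; rewrite Rmult_1_r; apply Rmax_r|].
    eapply Rle_trans; [apply Hc; lia|]; apply Rmult_le_compat_r; [left; now apply pow_lt|apply Rmax_l].
  - apply (Rle_lt_trans _ (R0 * x1)); [apply Rmult_le_compat_l; lra|lra]. }
assert (HCVa := HCV a (fun n Hn => proj1 (Hb n Hn))).
assert (HCVq := HCV q (fun n Hn => proj2 (Hb n Hn))).
(* Comparison of coefficients: the sum in [Hrec] over i + j = n + 1 splits into the part with factor
   i and the part with factor j, which are the coefficients of p W' Q and of W Q'. *)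
assert (Hode : forall x, Rabs x < x1 ->
  PSeries a x * PSeries (PS_derive q) x = p * (PSeries (PS_derive a) x * PSeries q x)).
{ intros x Hx; rewrite <- !PSeries_mult, <- PSeries_scal; auto; try (rewrite CV_radius_derive; auto).
  apply PSeries_ext; intros n.
  unfold PS_scal, PS_mult, PS_derive, scal; simpl; unfold mult; simpl.
  specialize (Hrec n).
  set (f := fun i => a i * q (S n - i)%nat) in *.
  assert (E1 : sum_f_R0 (fun i => INR (S n - i) * f i) (S n) =
    sum_f_R0 (fun i => a i * (INR (S (n - i)) * q (S (n - i)))) n).
  { rewrite tech5, Nat.sub_diag; simpl (INR 0); rewrite Rmult_0_l, Rplus_0_r.
    apply sum_eq; intros i Hi; unfold f; replace (S n - i)%nat with (S (n - i)) by lia; ring. }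
  assert (E2 : sum_f_R0 (fun i => INR i * f i) (S n) =
    sum_f_R0 (fun i => INR (S i) * a (S i) * q (n - i)%nat) n).
  { rewrite decomp_sum by lia; simpl pred; change (INR 0) with 0; rewrite Rmult_0_l, Rplus_0_l.
    apply sum_eq; intros i Hi; unfold f; replace (S n - S i)%nat with (n - i)%nat by lia; ring. }
  transitivity (sum_f_R0 (fun i => INR (S n - i) * f i) (S n)); [exact (eq_sym E1)|].
  transitivity (p * sum_f_R0 (fun i => INR i * f i) (S n)); [|exact (f_equal (Rmult p) E2)].
  assert (E3 : sum_f_R0 (fun i => (p * INR i - INR (S n - i)) * f i) (S n) =
    p * sum_f_R0 (fun i => INR i * f i) (S n) - sum_f_R0 (fun i => INR (S n - i) * f i) (S n)).
  { rewrite scal_sum, <- minus_sum; apply sum_eq; intros i Hi; ring. }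
  symmetry; apply Rminus_diag_uniq; etransitivity; [exact (eq_sym E3)|exact Hrec]. }
assert (Hd : forall x, Rabs x < x1 ->
  is_derive (fun x => PSeries q x * Rpower (PSeries a x) (- p)) x 0).
{ intros x Hx; assert (Dq := is_derive_PSeries q x (HCVq x Hx)); assert (Da := is_derive_PSeries a x (HCVa x Hx)).
  assert (HWx := HW x Hx).
  assert (Dp : is_derive (fun y => Rpower y (- p)) (PSeries a x) (- p * Rpower (PSeries a x) (- p - 1))).
  { apply is_derive_Reals; now apply derivable_pt_lim_power. }
  assert (Dc := is_derive_comp (fun y => Rpower y (- p)) (PSeries a) x _ _ Dp Da).
  eapply is_derive_eq; [exact (is_derive_mult (K := R_AbsRing) _ _ x _ _ Dq Dc Rmult_comm)|].
  unfold scal, plus, mult; simpl; unfold mult; simpl.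
  assert (E : Rpower (PSeries a x) (- p) = PSeries a x * Rpower (PSeries a x) (- p - 1)).
  { rewrite <- (Rpower_1 (PSeries a x)) at 2 by auto; rewrite <- Rpower_plus; f_equal; ring. }
  rewrite E; set (Z := Rpower (PSeries a x) (- p - 1)).
  transitivity ((PSeries a x * PSeries (PS_derive q) x - p * (PSeries (PS_derive a) x * PSeries q x)) * Z).
  - ring.
  - rewrite (Hode x Hx); ring. }
intros x Hx; split; [now apply HW|].
assert (Hx10 : 0 < x1) by (generalize (Rabs_pos x); lra).
assert (Hc : PSeries q x * Rpower (PSeries a x) (- p) = PSeries q 0 * Rpower (PSeries a 0) (- p)).
{ assert (Hbet : forall s, Rmin 0 x <= s <= Rmax 0 x -> Rabs s < x1).
  { intros s Hs; apply Rabs_def2 in Hx; apply Rabs_def1.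
    - eapply Rle_lt_trans; [apply Hs|apply Rmax_lub_lt; lra].
    - eapply Rlt_le_trans; [|apply Hs]; apply Rmin_glb_lt; lra. }
  destruct (MVT_gen (fun x => PSeries q x * Rpower (PSeries a x) (- p)) 0 x (fun _ => 0)) as [s [_ E]].
  - intros s Hs; apply Hd, Hbet; lra.
  - intros s Hs; apply continuity_pt_filterlim; exact (is_derive_continuous _ s 0 (Hd s (Hbet s Hs))).
  - lra. }
rewrite !PSeries_0, Hq0, <- Rpower_plus, Rplus_opp_r, Rpower_O in Hc by auto.
assert (HWx := HW x Hx).
rewrite <- (Rmult_1_r (PSeries q x)), <- (Rpower_O (PSeries a x)) by auto.
replace 0 with (- p + p) by ring; rewrite Rpower_plus, <- Rmult_assoc, Hc; ring.
Qed.

(** Serves for convolutions of sequences that are altered at index 0 only: such a change affects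
    just the two extreme terms. *)
Lemma sum_f_R0_ends (f f' : nat -> R) (n : nat) :
  (forall i, (0 < i < S n)%nat -> f i = f' i) ->
  sum_f_R0 f (S n) = sum_f_R0 f' (S n) + (f O - f' O) + (f (S n) - f' (S n)).
Proof.
intros H; rewrite !tech5.
destruct n as [|n]; [simpl; ring|].
rewrite (decomp_sum f (S n)), (decomp_sum f' (S n)) by lia; simpl pred.
rewrite (sum_eq (fun i => f (S i)) (fun i => f' (S i)) n) by (intros; apply H; lia); ring.
Qed.

Lemma continuous_sum_f_R0 (f : nat -> R -> R) (n : nat) (x : R) :
  (forall i, (i <= n)%nat -> continuous (f i) x) -> continuous (fun t => sum_f_R0 (fun i => f i t) n) x.
Proof.
induction n; intros H; [now apply (H O)|].
apply (continuous_ext (fun t => sum_f_R0 (fun i => f i t) n + f (S n) t)); [intros; now rewrite tech5|].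
apply continuous_add; [apply IHn; intros; apply H; lia|apply H; lia].
Qed.

Lemma is_pseries_of_partial_sums (a : nat -> R) (x l C : R) :
  (forall N, (1 <= N)%nat -> Rabs (l - sum_f_R0 (fun n => a n * x ^ n) N) <= C / 2 ^ N) ->
  is_pseries a x l.
Proof.
intros H; apply is_pseries_R; unfold is_series.
assert (HC : 0 <= C).
{ generalize (Rabs_pos (l - sum_f_R0 (fun n => a n * x ^ n) 1)) (H 1%nat (le_n 1)); simpl; lra. }
assert (Hl : is_lim_seq (sum_n (fun n => a n * x ^ n)) (Finite l)); [|exact Hl].
apply is_lim_seq_spec; intros [eps He]; simpl.
destruct (small_half_pow C (eps / 2)) as [N HN]; [lra|].
exists (S N); intros n Hn; rewrite sum_n_Reals, Rabs_minus_sym.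
eapply Rle_lt_trans; [apply H; lia|].
apply (Rle_lt_trans _ (C / 2 ^ N)); [|lra].
apply Rmult_le_compat_l; auto; apply Rinv_le_contravar; [apply pow_lt; lra|apply Rle_pow; lra || lia].
Qed.

Lemma sum_f_R0_head (f f' : nat -> R) (N : nat) : f' O = 0 ->
  (forall n, f (S n) = f' (S n)) -> sum_f_R0 f N = f O + sum_f_R0 f' N.
Proof.
intros H0 H; induction N; [simpl; lra|].
rewrite !tech5, IHN, H; ring.
Qed.

(** * The equation in logarithmic time *)

Definition tends_past (f : R -> R) (l : R) : Prop :=
  forall eps, 0 < eps -> exists T, forall t, t <= T -> Rabs (f t - l) <= eps.

Lemma tends_past_bounded (f : R -> R) (l : R) : tends_past f l -> past_bounded f.
Proof.
intros H; destruct (H 1 ltac:(lra)) as [T HT]; exists (1 + Rabs l), T; intros t Ht.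
replace (f t) with ((f t - l) + l) by ring.
eapply Rle_trans; [apply Rabs_triang|]; generalize (HT t Ht); lra.
Qed.

(** * Existence and uniqueness of the singular solution *)

Section Family.

Variables (theta b p k0 gam : R) (k g : R -> R).
Let a := b - theta.
Let A := theta * b.
Let h := (p - 1) * A.
Hypothesis Htheta : 0 < theta.
Hypothesis Hb : theta < b.
Hypothesis Hp : 1 < p.
Hypothesis Hk0 : 0 < k0.
Hypothesis Hgam : 0 < gam.
Hypothesis Hbal : k0 * pospow gam (p - 1) = A.
Hypothesis kcont : forall t, continuous k t.
Hypothesis gcont : forall t, continuous g t.
Hypothesis kpos : forall t, 0 <= k t.
Hypothesis klim : tends_past k k0.
Hypothesis glim : tends_past g 0.

(* [singular mu z z1]: the singular solution for the parameter [mu], where [z = r^theta u - gam] in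
   the variable [t = ln r] and [z1] is the derivative of [z]. *)
Definition F (mu t z : R) : R := p * A * z + A * gam - k t * pospow (gam + z) p - mu * g t.

Definition singular (mu : R) (z z1 : R -> R) : Prop :=
  (forall T, solves a h T z z1 (fun t => F mu t (z t))) /\ tends_past z 0.

Variables (e0 D0 : R).
Hypothesis He0 : 0 < e0.
Hypothesis HD0 : 0 < D0.
Hypothesis Hpast : past_stable a h e0 D0.
Hypothesis Hstab : locally_stable a h e0.
Hypothesis Hsolv : contraction_solvable a h e0.

Lemma A_pos : 0 < A.
Proof. unfold A; nra. Qed.

Lemma balance : k0 * pospow gam p = A * gam.
Proof. rewrite pospow_step, <- Hbal; ring. Qed.

(** At [kappa = k0] and [w = gam] the expression vanishes, by [Hbal]; the deviations of [kappa] and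
    of [w] are given half of [e0] each. *)
Lemma small_lipschitz : exists delta rho, 0 < delta < gam /\ 0 < rho /\
  (forall kappa w, Rabs (kappa - k0) <= rho -> Rabs (w - gam) <= delta ->
     Rabs (p * A - kappa * (p * pospow w (p - 1))) <= e0).
Proof.
set (dg := p * pospow gam (p - 1)).
assert (Hdg : 0 <= dg) by (unfold dg; generalize (pospow_nonneg gam (p - 1)); nra).
assert (Hc : continuous (fun w => p * pospow w (p - 1)) gam).
{ apply continuous_mul; [apply continuous_cst|apply continuous_pospow; lra]. }
destruct (continuous_eps_elim _ _ Hc (e0 / (2 * (k0 + 1)))) as [d [Hd Hw]].
{ apply Rdiv_lt_0_compat; lra. }
set (rho := Rmin 1 (e0 / (2 * (dg + 1)))).
assert (Hrho : 0 < rho) by (apply Rmin_pos; [lra|apply Rdiv_lt_0_compat; lra]).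
assert (Hr1 : rho <= 1) by apply Rmin_l.
assert (Hr2 : rho * dg <= e0 / 2).
{ apply (Rle_trans _ (e0 / (2 * (dg + 1)) * dg)); [apply Rmult_le_compat_r; [auto|apply Rmin_r]|].
  apply (Rmult_le_reg_r (2 * (dg + 1))); [lra|].
  replace (e0 / (2 * (dg + 1)) * dg * (2 * (dg + 1))) with (e0 * dg) by (field; lra); nra. }
exists (Rmin (d / 2) (gam / 2)), rho; repeat split; auto.
- apply Rmin_pos; lra.
- eapply Rle_lt_trans; [apply Rmin_r|lra].
- intros kappa w Hk Hwg.
  assert (Hwd : Rabs (w - gam) < d) by (eapply Rle_lt_trans; [apply Hwg|eapply Rle_lt_trans; [apply Rmin_l|lra]]).
  specialize (Hw w Hwd); fold dg in Hw.
  replace (p * A - kappa * (p * pospow w (p - 1))) with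
    (- ((kappa - k0) * dg) + - (kappa * (p * pospow w (p - 1) - dg)))
    by (unfold dg; rewrite <- Hbal; ring).
  eapply Rle_trans; [apply Rabs_triang|]; rewrite !Rabs_Ropp, !Rabs_mult, (Rabs_pos_eq dg) by auto.
  apply (Rle_trans _ (rho * dg + (k0 + 1) * (e0 / (2 * (k0 + 1))))).
  + apply Rplus_le_compat; [now apply Rmult_le_compat_r|].
    apply Rmult_le_compat; try apply Rabs_pos; [|lra].
    replace kappa with ((kappa - k0) + k0) by ring.
    eapply Rle_trans; [apply Rabs_triang|]; rewrite (Rabs_pos_eq k0) by lra; lra.
  + replace ((k0 + 1) * (e0 / (2 * (k0 + 1)))) with (e0 / 2) by (field; lra); lra.
Qed.

Lemma F_diff (mu mu' t x y : R) : exists s, Rmin y x <= s <= Rmax y x /\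
  F mu t x - F mu' t y = (p * A - k t * (p * pospow (gam + s) (p - 1))) * (x - y) - (mu - mu') * g t.
Proof.
destruct (mean_value (fun s => p * A * s - k t * pospow (gam + s) p)
  (fun s => p * A - k t * (p * pospow (gam + s) (p - 1))) y x) as [s [Hs E]].
{ intros s.
  assert (D := is_derive_pospow p (gam + s) Hp).
  auto_derive; [eexists; eassumption|].
  replace (Derive _ _) with (p * pospow (gam + s) (p - 1))
    by (symmetry; apply (is_derive_unique _ _ _ D)); ring. }
exists s; split; auto; unfold F.
transitivity ((p * A * x - k t * pospow (gam + x) p - (p * A * y - k t * pospow (gam + y) p)) - (mu - mu') * g t).
ring. rewrite E; ring.
Qed.

Lemma F_lipschitz_upto (T M : R) : exists L, 0 <= L /\ forall mu mu' t x y,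
  t <= T -> gam + x <= M -> gam + y <= M ->
  Rabs (F mu t x - F mu' t y) <= L * Rabs (x - y) + Rabs (mu - mu') * Rabs (g t).
Proof.
destruct (bounded_upto k T) as [K [HK HkK]]; auto.
{ exact (tends_past_bounded _ _ klim). }
assert (HA := A_pos).
assert (HP := pospow_nonneg M (p - 1)).
assert (HpP : 0 <= p * pospow M (p - 1)) by nra.
exists (p * A + K * (p * pospow M (p - 1))); split.
{ apply Rplus_le_le_0_compat; [nra|now apply Rmult_le_pos]. }
intros mu mu' t x y Ht Hx Hy.
destruct (F_diff mu mu' t x y) as [s [Hs ->]].
eapply Rle_trans; [apply Rabs_triang|]; rewrite Rabs_Ropp, !Rabs_mult; apply Rplus_le_compat_r.
apply Rmult_le_compat_r; [apply Rabs_pos|].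
eapply Rle_trans; [apply Rabs_triang|]; rewrite Rabs_Ropp, (Rabs_mult (k t)).
assert (HPs := pospow_nonneg (gam + s) (p - 1)).
rewrite (Rabs_pos_eq (p * A)), (Rabs_pos_eq (p * _)) by nra.
apply Rplus_le_compat_l, Rmult_le_compat; [apply Rabs_pos|nra|auto|].
apply Rmult_le_compat_l; [lra|]; apply pospow_mono; [lra|].
assert (s <= Rmax y x) by apply Hs.
assert (Rmax y x <= M - gam) by (apply Rmax_lub; lra); lra.
Qed.

Definition calm (delta T1 : R) : Prop :=
  forall mu mu' t x y, t <= T1 -> Rabs x <= delta -> Rabs y <= delta ->
  Rabs (F mu t x - F mu' t y) <= e0 * Rabs (x - y) + Rabs (mu - mu') * Rabs (g t).

Lemma calm_exists : exists delta T1, 0 < delta < gam /\ calm delta T1 /\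
  forall t w, t <= T1 -> Rabs (w - gam) <= delta ->
    Rabs (p * A - k t * (p * pospow w (p - 1))) <= e0.
Proof.
destruct small_lipschitz as [delta [rho [Hd [Hr H]]]].
destruct (klim rho Hr) as [T1 HT1].
exists delta, T1; split; [auto|split; [|intros t w Ht Hw; apply H; auto]].
intros mu mu' t x y Ht Hx Hy.
destruct (F_diff mu mu' t x y) as [s [Hs ->]].
eapply Rle_trans; [apply Rabs_triang|]; rewrite Rabs_Ropp, !Rabs_mult; apply Rplus_le_compat_r.
apply Rmult_le_compat_r; [apply Rabs_pos|].
apply H; [auto|]; replace (gam + s - gam) with s by ring.
apply Rabs_le_between in Hx, Hy; apply Rabs_le.
assert (- delta <= Rmin y x) by (apply Rmin_glb; lra).
assert (Rmax y x <= delta) by (apply Rmax_lub; lra); lra.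
Qed.

(** By [balance], F(mu, t, 0) = -(k - k0) gam^p - mu g, and both terms tend to 0, uniformly for |mu|
    <= m. *)
Lemma F_past_zero (m eta : R) : 0 <= m -> 0 < eta ->
  exists T, forall mu t, Rabs mu <= m -> t <= T -> Rabs (F mu t 0) <= eta.
Proof.
intros Hm Heta.
assert (HP := pospow_nonneg gam p).
destruct (klim (eta / (2 * (pospow gam p + 1)))) as [T1 H1].
{ apply Rdiv_lt_0_compat; lra. }
destruct (glim (eta / (2 * (m + 1)))) as [T2 H2].
{ apply Rdiv_lt_0_compat; lra. }
exists (Rmin T1 T2); intros mu t Hmu Ht.
specialize (H1 t (Rle_trans _ _ _ Ht (Rmin_l _ _))).
specialize (H2 t (Rle_trans _ _ _ Ht (Rmin_r _ _))); rewrite Rminus_0_r in H2.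
unfold F; rewrite Rplus_0_r.
replace (p * A * 0 + A * gam - k t * pospow gam p - mu * g t) with
  (- ((k t - k0) * pospow gam p) + - (mu * g t)) by (rewrite <- balance; ring).
eapply Rle_trans; [apply Rabs_triang|]; rewrite !Rabs_Ropp, !Rabs_mult, (Rabs_pos_eq (pospow gam p)) by auto.
assert (E1 : Rabs (k t - k0) * pospow gam p <= eta / (2 * (pospow gam p + 1)) * (pospow gam p + 1)).
{ apply Rmult_le_compat; try apply Rabs_pos; lra. }
assert (E2 : Rabs mu * Rabs (g t) <= (m + 1) * (eta / (2 * (m + 1)))).
{ apply Rmult_le_compat; try apply Rabs_pos; lra. }
replace (eta / (2 * (pospow gam p + 1)) * (pospow gam p + 1)) with (eta / 2) in E1 by (field; lra).
replace ((m + 1) * (eta / (2 * (m + 1)))) with (eta / 2) in E2 by (field; lra).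
lra.
Qed.

(** Remaining in the small-Lipschitz range already forces the limit 0: the constant [D0] does not
    depend on the time horizon, and before an early time the source F(mu, t, 0) is as small as
    desired. *)
Lemma tends_past_of_bounded (mu delta T1 T0 : R) (z z1 : R -> R) :
  0 < delta -> calm delta T1 -> (forall T, solves a h T z z1 (fun t => F mu t (z t))) ->
  (forall t, t <= T0 -> Rabs (z t) <= delta) -> tends_past z 0.
Proof.
intros Hd Hcalm Hz Hzd eps Heps.
destruct (F_past_zero (Rabs mu) (eps / D0)) as [T HT]; [apply Rabs_pos|now apply Rdiv_lt_0_compat|].
set (T' := Rmin T (Rmin T1 T0)).
assert (H1 : T' <= T) by apply Rmin_l.
assert (H2 : T' <= T1) by (eapply Rle_trans; [apply Rmin_r|apply Rmin_l]).
assert (H3 : T' <= T0) by (eapply Rle_trans; [apply Rmin_r|apply Rmin_r]).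
exists T'; intros t Ht; rewrite Rminus_0_r.
destruct (Hpast T' (eps / D0) z z1 (fun t => F mu t (z t))) with (t := t) as [E _]; auto.
- left; now apply Rdiv_lt_0_compat.
- exists delta, T0; auto.
- intros s Hs.
  replace (F mu s (z s)) with ((F mu s (z s) - F mu s 0) + F mu s 0) by ring.
  eapply Rle_trans; [apply Rabs_triang|]; apply Rplus_le_compat; [|apply HT; lra].
  eapply Rle_trans; [apply Hcalm; [lra|apply Hzd; lra|rewrite Rabs_R0; lra]|].
  rewrite Rminus_diag, Rabs_R0, Rminus_0_r; lra.
- eapply Rle_trans; [apply E|right; field; lra].
Qed.

Lemma singular_past_bounded (mu : R) (z z1 : R -> R) : singular mu z z1 -> past_bounded z.
Proof. intros [_ H]; exact (tends_past_bounded _ _ H). Qed.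

Lemma singular_continuous (mu : R) (z z1 : R -> R) (t : R) : singular mu z z1 -> continuous z t.
Proof. intros [H _]; exact (solves_continuous _ _ t _ _ _ t (H t) (Rle_refl t)). Qed.

(** The difference satisfies the stability estimate with [eta = 0]: early on both solutions lie in
    the range where [F] has Lipschitz constant [e0], and afterwards both are bounded up to the time
    considered. *)
Lemma singular_unique (mu : R) (z z1 y y1 : R -> R) :
  singular mu z z1 -> singular mu y y1 -> forall t, z t = y t /\ z1 t = y1 t.
Proof.
intros Hz Hy t.
destruct calm_exists as [delta [T1 [Hd [Hcalm _]]]].
destruct Hz as [Hz Hz0], Hy as [Hy Hy0].
destruct (Hz0 delta ltac:(lra)) as [S1 HS1], (Hy0 delta ltac:(lra)) as [S2 HS2].
set (T0 := Rmin T1 (Rmin S1 S2)).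
assert (H1 : T0 <= T1) by apply Rmin_l.
assert (H2 : T0 <= S1) by (eapply Rle_trans; [apply Rmin_r|apply Rmin_l]).
assert (H3 : T0 <= S2) by (eapply Rle_trans; [apply Rmin_r|apply Rmin_r]).
destruct (bounded_upto z t) as [B1 [HB1 HzB]].
{ intros s _; exact (solves_continuous _ _ s _ _ _ s (Hz s) (Rle_refl s)). }
{ exact (tends_past_bounded _ _ Hz0). }
destruct (bounded_upto y t) as [B2 [HB2 HyB]].
{ intros s _; exact (solves_continuous _ _ s _ _ _ s (Hy s) (Rle_refl s)). }
{ exact (tends_past_bounded _ _ Hy0). }
destruct (F_lipschitz_upto t (gam + B1 + B2)) as [L [HL HLip]].
destruct (Hstab t T0 L HL) as [D [HD HDs]].
destruct (HDs 0 (fun t => z t - y t) (fun t => z1 t - y1 t)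
  (fun t => F mu t (z t) - F mu t (y t))) with (t := t) as [E E1]; try lra.
- apply solves_minus; auto.
- apply past_bounded_minus; [exact (tends_past_bounded _ _ Hz0)|exact (tends_past_bounded _ _ Hy0)].
- intros s Hs Hs'; eapply Rle_trans.
  + apply Hcalm; [lra| |]; [rewrite <- (Rminus_0_r (z s)); apply HS1; lra|rewrite <- (Rminus_0_r (y s)); apply HS2; lra].
  + rewrite Rminus_diag, Rabs_R0; lra.
- intros s Hs Hs'; eapply Rle_trans.
  + apply HLip; [lra| |].
    * generalize (Rle_abs (z s)) (HzB s Hs); lra.
    * generalize (Rle_abs (y s)) (HyB s Hs); lra.
  + rewrite Rminus_diag, Rabs_R0; lra.
- rewrite Rmult_0_r in E, E1.
  split; apply Rminus_diag_uniq, Rabs_eq_0, Rle_antisym; auto; apply Rabs_pos.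
Qed.

Lemma F_continuous (mu : R) (z : R -> R) (t : R) : continuous z t -> continuous (fun t => F mu t (z t)) t.
Proof.
intros Hz; unfold F.
apply continuous_sub; [apply continuous_sub; [apply continuous_add|]|].
- apply continuous_mul; [apply continuous_cst|auto].
- apply continuous_cst.
- apply continuous_mul; [auto|].
  apply (continuous_comp (fun t => gam + z t) (fun w => pospow w p)).
  + apply continuous_add; [apply continuous_cst|auto].
  + apply continuous_pospow; lra.
- apply continuous_mul; [apply continuous_cst|auto].
Qed.

(* The nonlinearity with [z] clamped near -oo and [gam + z] truncated at [M t] later on; the two
   agree with [F] along the solution that is sought. *)
Let Ftrunc (delta T0 : R) (M : R -> R) (mu t z : R) : R :=
  F mu t (clamp delta z) +
  Rmax 0 (Rmin 1 (t - T0 + 1)) *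
    ((p * A * z - k t * pospow (Rmin (gam + z) (M t)) p) -
     (p * A * clamp delta z - k t * pospow (Rmin (gam + clamp delta z) (M t)) p)).

Lemma clamp_continuous (d : R) (z : R -> R) (t : R) : continuous z t -> continuous (fun t => clamp d (z t)) t.
Proof.
intros Hz; apply continuous_comp; [exact Hz|].
apply continuous_nonexpansive; intros y; apply clamp_lipschitz.
Qed.

Lemma Ftrunc_continuous (delta T0 mu : R) (M : R -> R) : (forall t, continuous M t) ->
  forall z, (forall t, continuous z t) -> forall t, continuous (fun t => Ftrunc delta T0 M mu t (z t)) t.
Proof.
intros HM z Hz t; unfold Ftrunc.
assert (Hq : forall y : R -> R, continuous y t ->
  continuous (fun t => p * A * y t - k t * pospow (Rmin (gam + y t) (M t)) p) t).
{ intros y Hy; apply continuous_sub; apply continuous_mul; auto; try apply continuous_cst.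
  apply (continuous_comp (fun t => Rmin (gam + y t) (M t)) (fun w => pospow w p)).
  - apply continuous_Rmin; auto; apply continuous_add; auto; apply continuous_cst.
  - apply continuous_pospow; lra. }
apply continuous_add; [apply F_continuous; now apply clamp_continuous|].
apply continuous_mul; [|apply continuous_sub; apply Hq; auto; now apply clamp_continuous].
apply (continuous_comp (fun t => t - T0 + 1) (fun x => Rmax 0 (Rmin 1 x))).
- apply continuous_add; [|apply continuous_cst]; apply continuous_sub; [apply continuous_id|apply continuous_cst].
- apply continuous_nonexpansive; intros y; eapply Rle_trans; [apply Rmax_lipschitz|apply Rmin_lipschitz].
Qed.

Lemma Ftrunc_lipschitz (delta T0 T : R) (M : R -> R) : 0 < delta ->
  (exists B, forall t, t <= T -> M t <= B) ->
  exists L, 0 <= L /\ forall mu t x y, t <= T ->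
    Rabs (Ftrunc delta T0 M mu t x - Ftrunc delta T0 M mu t y) <= L * Rabs (x - y).
Proof.
intros Hd [B HB].
destruct (bounded_upto k T) as [K [HK HkK]]; auto.
{ exact (tends_past_bounded _ _ klim). }
destruct (F_lipschitz_upto T (gam + delta)) as [L [HL HLip]].
assert (HA := A_pos).
assert (HpA : 0 <= p * A) by nra.
set (Q := p * A + K * (p * pospow B (p - 1))).
assert (HPB : 0 <= p * pospow B (p - 1)) by (generalize (pospow_nonneg B (p - 1)); nra).
assert (HQ : 0 <= Q) by (unfold Q; nra).
assert (Hq : forall t x y, t <= T -> Rabs ((p * A * x - k t * pospow (Rmin (gam + x) (M t)) p) -
   (p * A * y - k t * pospow (Rmin (gam + y) (M t)) p)) <= Q * Rabs (x - y)).
{ intros t x y Ht.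
  replace (p * A * x - k t * pospow (Rmin (gam + x) (M t)) p -
    (p * A * y - k t * pospow (Rmin (gam + y) (M t)) p)) with
    (p * A * (x - y) + - (k t * (pospow (Rmin (gam + x) (M t)) p - pospow (Rmin (gam + y) (M t)) p))) by ring.
  eapply Rle_trans; [apply Rabs_triang|]; rewrite Rabs_Ropp, !(Rabs_mult _ (_ - _)), (Rabs_pos_eq (p * A)) by auto.
  unfold Q; rewrite Rmult_plus_distr_r, (Rmult_assoc K); apply Rplus_le_compat; [lra|].
  apply Rmult_le_compat; try apply Rabs_pos; auto.
  eapply Rle_trans; [apply (pospow_lipschitz p B); [auto| |]; (eapply Rle_trans; [apply Rmin_r|now apply HB])|].
  apply Rmult_le_compat_l; [auto|].
    rewrite !(Rmin_comm _ (M t)); eapply Rle_trans; [apply Rmin_lipschitz|].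
    right; f_equal; ring. }
exists (L + 2 * Q); split; [lra|]; intros mu t x y Ht; unfold Ftrunc.
set (chi := Rmax 0 (Rmin 1 (t - T0 + 1))).
assert (Hchi : 0 <= chi <= 1).
{ unfold chi; split; [apply Rmax_l|apply Rmax_lub; [lra|apply Rmin_l]]. }
assert (Hc := clamp_lipschitz delta x y).
assert (H1 := HLip mu mu t (clamp delta x) (clamp delta y) Ht).
assert (H2 := Hq t x y Ht); assert (H3 := Hq t (clamp delta x) (clamp delta y) Ht).
assert (Hcb : forall u, gam + clamp delta u <= gam + delta).
{ intros u; generalize (clamp_bound delta u ltac:(lra)) (Rle_abs (clamp delta u)); lra. }
specialize (H1 (Hcb x) (Hcb y)); rewrite Rminus_diag, Rabs_R0, Rmult_0_l, Rplus_0_r in H1.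
set (q := fun x => p * A * x - k t * pospow (Rmin (gam + x) (M t)) p) in *.
change (Rabs (q x - q y) <= Q * Rabs (x - y)) in H2.
change (Rabs (q (clamp delta x) - q (clamp delta y)) <= Q * Rabs (clamp delta x - clamp delta y)) in H3.
change (Rabs (F mu t (clamp delta x) + chi * (q x - q (clamp delta x)) -
  (F mu t (clamp delta y) + chi * (q y - q (clamp delta y)))) <= (L + 2 * Q) * Rabs (x - y)).
replace (F mu t (clamp delta x) + chi * (q x - q (clamp delta x)) -
  (F mu t (clamp delta y) + chi * (q y - q (clamp delta y)))) with
  ((F mu t (clamp delta x) - F mu t (clamp delta y)) +
   chi * ((q x - q y) + - (q (clamp delta x) - q (clamp delta y)))) by ring.
eapply Rle_trans; [apply Rabs_triang|]; rewrite Rabs_mult, (Rabs_pos_eq chi) by lra.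
assert (H4 : Rabs (q x - q y + - (q (clamp delta x) - q (clamp delta y))) <= 2 * Q * Rabs (x - y)).
{ eapply Rle_trans; [apply Rabs_triang|]; rewrite Rabs_Ropp.
  assert (Q * Rabs (clamp delta x - clamp delta y) <= Q * Rabs (x - y)) by now apply Rmult_le_compat_l.
  lra. }
assert (H5 : L * Rabs (clamp delta x - clamp delta y) <= L * Rabs (x - y)) by now apply Rmult_le_compat_l.
assert (H6 := Rabs_pos (q x - q y + - (q (clamp delta x) - q (clamp delta y)))).
set (X := Rabs (q x - q y + - (q (clamp delta x) - q (clamp delta y)))) in *.
assert (chi * X <= 1 * X) by (apply Rmult_le_compat_r; lra). lra.
Qed.

(** With y = w' + b w the equation becomes y' = theta y - s - mu g, where s stands for the
    nonnegative term k w_+^p. Dropping [s] bounds [y] and then [w] from above, so [M] does not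
    depend on the nonlinearity and can be fixed before the truncated problem is posed. *)
Lemma majorant_exists (m delta T0 : R) : 0 <= m -> 0 < delta ->
  exists M : R -> R, (forall t, continuous M t) /\ (forall t, gam + delta <= M t) /\
  (forall T, exists B, forall t, t <= T -> M t <= B) /\
  forall mu (w y s : R -> R), Rabs mu <= m ->
    (forall t, T0 <= t -> is_derive w t (y t - b * w t)) ->
    (forall t, T0 <= t -> is_derive y t (theta * y t - s t - mu * g t)) ->
    (forall t, T0 <= t -> 0 <= s t) ->
    w T0 <= gam + delta -> y T0 <= delta + b * (gam + delta) ->
    forall t, T0 <= t -> w t <= M t.
Proof.
intros Hm Hd.
(* [y0] bounds z1 + b (gam + z) at [T0] when |z| and |z1| are at most [delta]. *)
set (y0 := delta + b * (gam + delta)).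
assert (Hy0 : 0 <= y0) by (unfold y0; nra).
destruct (antiderivative_exists (fun t => Rabs (g t))) as [G0 HG0].
{ intros t; apply continuous_comp; [auto|apply continuous_Rabs]. }
(* After [T0] this is a supersolution: Y' >= theta Y + m |g|, with Y(T0) = y0. *)
set (Y := fun t => exp (theta * (t - T0)) * (y0 + m * (G0 t - G0 T0))).
assert (HG0m : forall t, T0 <= t -> 0 <= G0 t - G0 T0).
{ intros t Ht; assert (G0 T0 <= G0 t); [|lra].
  apply (derive_nonneg_le G0 (fun t => Rabs (g t))); auto; intros; apply Rabs_pos. }
assert (HYpos : forall t, T0 <= t -> 0 <= Y t).
{ intros t Ht; unfold Y; apply Rmult_le_pos; [left; apply exp_pos|].
  generalize (HG0m t Ht); nra. }
destruct (antiderivative_exists Y) as [W0 HW0].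
{ intros t; unfold Y; apply continuous_mul.
  - apply (is_derive_continuous _ _ (theta * exp (theta * (t - T0)))); auto_derive; auto; unfold Rminus; ring.
  - apply continuous_add; [apply continuous_cst|]; apply continuous_mul; [apply continuous_cst|].
    apply continuous_sub; [|apply continuous_cst]; exact (is_derive_continuous _ _ _ (HG0 t)). }
assert (HW0m : forall t u, T0 <= t -> t <= u -> W0 t <= W0 u).
{ intros t u Ht Hu; apply (derive_nonneg_le W0 Y); auto; intros v Hv; apply HYpos; lra. }
exists (fun t => gam + delta + (W0 (Rmax T0 t) - W0 T0)).
repeat match goal with |- _ /\ _ => split end.
- intros t; apply continuous_add; [apply continuous_cst|].
  apply continuous_sub; [|apply continuous_cst].
  apply continuous_comp; [apply continuous_nonexpansive; intros; apply Rmax_lipschitz|].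
  exact (is_derive_continuous _ _ _ (HW0 _)).
- intros t; generalize (HW0m T0 (Rmax T0 t) ltac:(lra) (Rmax_l _ _)); lra.
- intros T; exists (gam + delta + (W0 (Rmax T0 T) - W0 T0)); intros t Ht.
  generalize (HW0m (Rmax T0 t) (Rmax T0 T) (Rmax_l _ _) ltac:(apply Rle_max_compat_l; lra)); lra.
- intros mu w y s Hmu Dw Dy Hs Hw0 Hy0' t Ht.
  assert (HyY : forall u, T0 <= u -> y u <= Y u).
  { intros u Hu.
    assert (E : m * G0 T0 - exp (- theta * (T0 - T0)) * y T0 <= m * G0 u - exp (- theta * (u - T0)) * y u).
    { apply (derive_nonneg_le (fun v => m * G0 v - exp (- theta * (v - T0)) * y v)
        (fun v => m * Rabs (g v) + exp (- theta * (v - T0)) * (s v + mu * g v))); auto.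
      - intros v Hv; assert (D1 := HG0 v); assert (D2 := Dy v ltac:(lra)); derive_known.
      - intros v Hv; assert (H1 := Hs v ltac:(lra)).
        assert (H2 : - (m * Rabs (g v)) <= mu * g v).
        { assert (Rabs (mu * g v) <= m * Rabs (g v)).
          { rewrite Rabs_mult; apply Rmult_le_compat_r; auto; apply Rabs_pos. }
          generalize (Rle_abs (- (mu * g v))); rewrite Rabs_Ropp; lra. }
        assert (H3 : 0 < exp (- theta * (v - T0)) <= 1).
        { split; [apply exp_pos|rewrite <- exp_0; apply exp_le; nra]. }
        assert (0 <= m * Rabs (g v)) by (apply Rmult_le_pos; auto; apply Rabs_pos).
        nra. }
    replace (- theta * (T0 - T0)) with 0 in E by ring; rewrite exp_0 in E.
    unfold Y; replace (y u) with (exp (theta * (u - T0)) * (exp (- theta * (u - T0)) * y u)).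
    - apply Rmult_le_compat_l; [left; apply exp_pos|lra].
    - rewrite <- Rmult_assoc, <- exp_plus; replace (theta * (u - T0) + - theta * (u - T0)) with 0 by ring.
      rewrite exp_0; ring. }
  rewrite Rmax_right by auto.
  (* Minus the excess of [w] over the majorant, times the integrating factor of D + b; it is
     nonnegative at [T0] and nondecreasing because w' + b w = y <= Y. *)
  set (q := fun v => - (exp (b * (v - T0)) * (w v - (gam + delta) - (W0 v - W0 T0)))).
  assert (Hq : q T0 <= q t).
  { apply (derive_nonneg_le q (fun v => exp (b * (v - T0)) *
      ((Y v - y v) + b * (gam + delta) + b * (W0 v - W0 T0)))); auto.
    - intros v Hv; unfold q; assert (D1 := HW0 v); assert (D2 := Dw v ltac:(lra)); derive_known.
    - intros v Hv; apply Rmult_le_pos; [left; apply exp_pos|].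
      generalize (HyY v ltac:(lra)) (HW0m T0 v ltac:(lra) ltac:(lra)); nra. }
  unfold q in Hq; replace (b * (T0 - T0)) with 0 in Hq by ring; rewrite exp_0 in Hq.
  assert (He := exp_pos (b * (t - T0))).
  apply Rnot_lt_le; intros Hlt.
  assert (0 < exp (b * (t - T0)) * (w t - (gam + delta) - (W0 t - W0 T0))) by (apply Rmult_lt_0_compat; lra).
  lra.
Qed.

(** A first solution [x], for the fully clamped nonlinearity, stays within [delta] up to [T0] by
    stability. It also solves the truncated problem there, so by uniqueness the truncated solution
    [z] coincides with it up to [T0], where clamping is inactive; later [majorant_exists] gives
    [gam + z <= M], which makes the other truncation inactive. [T0] and [M] are common to all |mu|
    <= m, as the estimates uniform in the parameter require. *)
Lemma singular_exists (delta T1 m : R) : 0 < delta < gam -> calm delta T1 -> 0 <= m ->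
  exists T0 M, T0 <= T1 /\ (forall T, exists B, forall t, t <= T -> M t <= B) /\
  forall mu, Rabs mu <= m -> exists z z1, singular mu z z1 /\
    (forall t, t <= T0 -> Rabs (z t) <= delta) /\ forall t, gam + z t <= M t.
Proof.
intros Hd Hcalm Hm.
(* A source of size [delta / D0] at z = 0 is turned by the stability constant [D0] into the bound
   [delta]. *)
destruct (F_past_zero m (delta / D0) Hm) as [T2 HT2]; [apply Rdiv_lt_0_compat; lra|].
set (T0 := Rmin T1 T2).
assert (HT01 : T0 <= T1) by apply Rmin_l; assert (HT02 : T0 <= T2) by apply Rmin_r.
destruct (majorant_exists m delta T0 Hm) as (M & HMc & HMd & HMb & HMw); [lra|].
exists T0, M; split; [auto|split; [auto|]]; intros mu Hmu.
assert (HdD : 0 <= delta / D0) by (apply Rdiv_le_0_compat; lra).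
assert (Hcl0 : clamp delta 0 = 0) by (apply clamp_id; rewrite Rabs_R0; lra).
assert (Hclb : forall x, Rabs (clamp delta x) <= delta) by (intros; apply clamp_bound; lra).
set (F1 := fun t x => F mu t (clamp delta x)).
assert (HF1 : forall t x y, t <= T0 -> Rabs (F1 t x - F1 t y) <= e0 * Rabs (x - y)).
{ intros t x y Ht; unfold F1; eapply Rle_trans; [apply Hcalm; auto; lra|].
  rewrite Rminus_diag, Rabs_R0, Rmult_0_l, Rplus_0_r.
  apply Rmult_le_compat_l; [lra|apply clamp_lipschitz]. }
assert (HF10 : past_bounded (fun t => F1 t 0)).
{ exists (delta / D0), T0; intros t Ht; unfold F1; rewrite Hcl0; apply HT2; [auto|lra]. }
destruct (Hsolv F1 T0) as (x & x1 & Hx & Hxb); auto.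
{ intros z Hz t; unfold F1; apply F_continuous; now apply clamp_continuous. }
{ intros T; destruct (F_lipschitz_upto T (gam + delta)) as [L [HL HLip]].
  exists L; split; auto; intros t u v Ht; unfold F1; eapply Rle_trans; [apply HLip; auto|].
  - generalize (Hclb u) (Rle_abs (clamp delta u)); lra.
  - generalize (Hclb v) (Rle_abs (clamp delta v)); lra.
  - rewrite Rminus_diag, Rabs_R0, Rmult_0_l, Rplus_0_r.
    apply Rmult_le_compat_l; [lra|apply clamp_lipschitz]. }
assert (Hxd : forall t, t <= T0 -> Rabs (x t) <= delta /\ Rabs (x1 t) <= delta).
{ intros t Ht; replace delta with (D0 * (delta / D0)) by (field; lra).
  apply (Hpast T0 (delta / D0) x x1 (fun t => F1 t (x t))); auto.
  intros s Hs; replace (F1 s (x s)) with ((F1 s (x s) - F1 s 0) + F1 s 0) by ring.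
  eapply Rle_trans; [apply Rabs_triang|]; apply Rplus_le_compat.
  - eapply Rle_trans; [now apply HF1|]; rewrite Rminus_0_r; lra.
  - unfold F1; rewrite Hcl0; apply HT2; [auto|lra]. }
set (F2 := Ftrunc delta T0 M mu).
assert (HF2past : forall t u, t <= T0 - 1 -> F2 t u = F1 t u).
{ intros t u Ht; unfold F2, Ftrunc, F1; rewrite (Rmin_right 1), Rmax_left by lra; ring. }
assert (HF2small : forall t u, Rabs u <= delta -> F2 t u = F mu t u).
{ intros t u Hu; unfold F2, Ftrunc; rewrite (clamp_id _ _ Hu); ring. }
assert (HF2lip : forall T, exists L, 0 <= L /\ forall t u v, t <= T -> Rabs (F2 t u - F2 t v) <= L * Rabs (u - v)).
{ intros T; destruct (Ftrunc_lipschitz delta T0 T M) as [L [HL HLip]]; auto; [lra|].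
  exists L; split; [auto|intros; now apply HLip]. }
(* The cutoff in [Ftrunc] is 0 up to [T0 - 1] and 1 from [T0] on; the ramp keeps the source
   continuous in t, as the linear theory requires. The small Lipschitz constant is therefore checked
   up to [T0 - 1]. *)
destruct (Hsolv F2 (T0 - 1)) as (z & z1 & Hz & Hzb); auto.
{ apply Ftrunc_continuous; auto. }
{ intros t u v Ht; rewrite !HF2past by auto; apply HF1; lra. }
{ exists (delta / D0), T0; intros t Ht; rewrite HF2small by (rewrite Rabs_R0; lra); apply HT2; [auto|lra]. }
(* Between [T0 - 1] and [T0] the cutoff takes intermediate values, harmless along [x] because
   [clamp] is the identity there. *)
assert (Hzx : forall t, t <= T0 -> z t = x t /\ z1 t = x1 t).
{ intros t Ht; destruct (HF2lip T0) as [L [HL HLip]].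
  destruct (Hstab T0 (T0 - 1) L HL) as [D [HD HDs]].
  destruct (HDs 0 (fun t => z t - x t) (fun t => z1 t - x1 t)
    (fun t => F2 t (z t) - F2 t (x t))) with (t := t) as [E E1]; auto; try lra.
  - apply solves_minus; [apply Hz|].
    apply (solves_ext _ _ _ _ _ (fun t => F1 t (x t))); [|apply Hx].
    intros s Hs; destruct (Hxd s Hs) as [E _]; rewrite HF2small by auto.
    unfold F1; now rewrite clamp_id.
  - now apply past_bounded_minus.
  - intros s Hs Hs'; rewrite !HF2past, Rplus_0_r by auto; apply HF1; lra.
  - intros s Hs Hs'; rewrite Rplus_0_r; now apply HLip.
  - rewrite Rmult_0_r in E, E1.
    split; apply Rminus_diag_uniq, Rabs_eq_0, Rle_antisym; auto; apply Rabs_pos. }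
assert (Hzd : forall t, t <= T0 -> Rabs (z t) <= delta /\ Rabs (z1 t) <= delta).
{ intros t Ht; destruct (Hzx t Ht) as [-> ->]; auto. }
set (F3 := fun t u => p * A * u + A * gam - k t * pospow (Rmin (gam + u) (M t)) p - mu * g t).
assert (HF3 : forall t, F2 t (z t) = F3 t (z t)).
{ intros t; destruct (Rle_lt_dec t T0) as [Ht|Ht].
  - destruct (Hzd t Ht) as [E _]; rewrite HF2small by auto; unfold F, F3.
    rewrite Rmin_left; auto.
    generalize (HMd t) (Rle_abs (z t)); lra.
  - unfold F2, Ftrunc, F3, F; rewrite (Rmin_left 1), Rmax_right by lra.
    rewrite (Rmin_left (gam + clamp delta (z t))); [ring|].
    generalize (HMd t) (Hclb (z t)) (Rle_abs (clamp delta (z t))); lra. }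
assert (HzM : forall t, gam + z t <= M t).
{ intros t; destruct (Rle_lt_dec t T0) as [Ht|Ht].
  { destruct (Hzd t Ht) as [E _]; generalize (HMd t) (Rle_abs (z t)); lra. }
  apply (HMw mu (fun t => gam + z t) (fun t => z1 t + b * (gam + z t))
    (fun t => k t * pospow (Rmin (gam + z t) (M t)) p)); auto; try lra.
  - intros s _; destruct (Hz s s (Rle_refl s)) as [D1 _]; derive_known.
  - intros s _; destruct (Hz s s (Rle_refl s)) as [D1 D2]; rewrite HF3 in D2.
    derive_known; unfold F3, a, h, A; ring.
  - intros s _; apply Rmult_le_pos; [auto|apply pospow_nonneg].
  - destruct (Hzd T0 (Rle_refl T0)) as [E _]; generalize (Rle_abs (z T0)); lra.
  - destruct (Hzd T0 (Rle_refl T0)) as [E E1].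
    generalize (Rle_abs (z T0)) (Rle_abs (z1 T0)); intros.
    assert (b * (gam + z T0) <= b * (gam + delta)) by (apply Rmult_le_compat_l; lra). lra. }
assert (Hsol : forall T, solves a h T z z1 (fun t => F mu t (z t))).
{ intros T; apply (solves_ext _ _ _ _ _ (fun t => F2 t (z t))); [|apply Hz].
  intros t _; rewrite HF3; unfold F3, F; rewrite Rmin_left; auto. }
exists z, z1; split; [split; [exact Hsol|]|split; [intros; now apply Hzd|exact HzM]].
apply (tends_past_of_bounded mu delta T1 T0 z z1); auto; [lra|].
intros t Ht; now apply Hzd.
Qed.

(** * Continuously differentiable dependence on the parameter *)

Section Dependence.

Variables Z Z1 : R -> R -> R.
Hypothesis HZ : forall mu, singular mu (Z mu) (Z1 mu).

(** The derivative of [F] in its last argument, the same for every [mu]. *)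
Definition dF (t x : R) : R := p * A - k t * (p * pospow (gam + x) (p - 1)).

Lemma dF_diff (T : R) : exists K, 0 < K /\ forall t x y, t <= T ->
  Rabs (dF t x - dF t y) <= K * Rabs (pospow (gam + x) (p - 1) - pospow (gam + y) (p - 1)).
Proof.
destruct (bounded_upto k T) as [K [HK HkK]]; auto.
{ exact (tends_past_bounded _ _ klim). }
exists (K * p + 1); split; [nra|]; intros t x y Ht; unfold dF.
replace (p * A - k t * (p * pospow (gam + x) (p - 1)) - (p * A - k t * (p * pospow (gam + y) (p - 1))))
  with (- (k t * p * (pospow (gam + x) (p - 1) - pospow (gam + y) (p - 1)))) by ring.
rewrite Rabs_Ropp, !(Rabs_mult _ (_ - _)); apply Rmult_le_compat_r; [apply Rabs_pos|].
rewrite Rabs_mult, (Rabs_pos_eq p) by lra.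
generalize (HkK t Ht); nra.
Qed.

(** For p < 2 the exponent q = p - 1 is below 1 and the power is not Lipschitz at 0. Uniformity on
    all of (-oo, B] comes from Heine on [0, max(0, B)], since replacing x by [Rmax 0 x] does not
    change the truncated power. *)
Lemma pospow_uniform_continuity (q B eps : R) : 0 < q -> 0 < eps -> exists d, 0 < d /\
  forall x y, x <= B -> y <= B -> Rabs (x - y) < d -> Rabs (pospow x q - pospow y q) < eps.
Proof.
intros Hq He.
assert (Hc : forall x, 0 <= x <= Rmax 0 B -> continuity_pt (fun x => pospow x q) x).
{ intros x _; apply continuity_pt_filterlim, continuous_pospow; auto. }
destruct (Heine_cor2 Hc (mkposreal eps He)) as [[d Hd] H].
exists d; split; auto; intros x y Hx Hy Hxy; simpl in H.
assert (E : forall x, pospow x q = pospow (Rmax 0 x) q).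
{ intros u; destruct (Rle_lt_dec u 0).
  - rewrite Rmax_left, !pospow_nonpos by lra; auto.
  - rewrite Rmax_right by lra; auto. }
rewrite (E x), (E y); apply H.
- split; [apply Rmax_l|apply Rle_max_compat_l; auto].
- split; [apply Rmax_l|apply Rle_max_compat_l; auto].
- eapply Rle_lt_trans; [apply Rmax_lipschitz|auto].
Qed.

(* Bounds valid for all [|mu| <= m] up to time [T], together with the stability estimate for the
   corresponding Lipschitz constants; the slack in [delta / 2] and [B - gam] leaves room for
   perturbations of the solutions. *)
Definition controlled (m T T0 delta B L D : R) : Prop :=
  0 < D /\ 0 <= L /\ 0 < delta < gam /\
  (forall t x, t <= T0 -> Rabs x <= delta -> Rabs (dF t x) <= e0) /\
  (forall t x, t <= T -> gam + x <= B -> Rabs (dF t x) <= L) /\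
  (forall mu t, Rabs mu <= m -> t <= T0 -> Rabs (Z mu t) <= delta / 2) /\
  (forall mu t, Rabs mu <= m -> t <= T -> gam + Z mu t <= B - gam) /\
  (forall eta v v1 H, 0 <= eta -> solves a h T v v1 H -> past_bounded v ->
    (forall t, t <= T -> t <= T0 -> Rabs (H t) <= e0 * Rabs (v t) + eta) ->
    (forall t, t <= T -> T0 <= t -> Rabs (H t) <= L * Rabs (v t) + eta) ->
    forall t, t <= T -> Rabs (v t) <= D * eta /\ Rabs (v1 t) <= D * eta).

(** [singular_exists] with radius [delta / 2] bounds some solution for each [mu]; by uniqueness that
    solution is [Z mu]. *)
Lemma controlled_exists (m T : R) : 0 <= m ->
  exists T0 delta B L D, controlled m T T0 delta B L D.
Proof.
intros Hm.
destruct calm_exists as [delta [T1 [Hd [Hcalm Hdc]]]].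
assert (Hcalm' : calm (delta / 2) T1).
{ intros mu mu' t x y Ht Hx Hy; apply Hcalm; lra. }
destruct (singular_exists (delta / 2) T1 m ltac:(lra) Hcalm' Hm) as (T0 & M & HT0 & HM & Hex).
destruct (HM T) as [B0 HB0].
set (B := B0 + gam).
destruct (bounded_upto k T) as [K [HK HkK]]; auto.
{ exact (tends_past_bounded _ _ klim). }
assert (HA := A_pos).
assert (HP := pospow_nonneg B (p - 1)).
assert (HpA : 0 <= p * A) by nra.
assert (HL : 0 <= p * A + K * (p * pospow B (p - 1))).
{ apply Rplus_le_le_0_compat; auto; apply Rmult_le_pos; [auto|nra]. }
destruct (Hstab T T0 _ HL) as [D [HD HDs]].
exists T0, delta, B, (p * A + K * (p * pospow B (p - 1))), D.
unfold controlled; repeat match goal with |- _ /\ _ => split end; auto; try lra.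
- intros t x Ht Hx; apply Hdc; [lra|]; now replace (gam + x - gam) with x by ring.
- intros t x Ht Hx; unfold dF; eapply Rle_trans; [apply Rabs_triang|].
  rewrite Rabs_Ropp, (Rabs_mult (k t)), (Rabs_pos_eq (p * A)) by auto.
  apply Rplus_le_compat_l, Rmult_le_compat; try apply Rabs_pos; auto.
  rewrite Rabs_pos_eq by (generalize (pospow_nonneg (gam + x) (p - 1)); nra).
  apply Rmult_le_compat_l; [lra|apply pospow_mono; lra].
- intros mu t Hmu Ht; destruct (Hex mu Hmu) as (z & z1 & Hz & Hzd & _).
  destruct (singular_unique mu _ _ _ _ (HZ mu) Hz t) as [-> _]; auto.
- intros mu t Hmu Ht; destruct (Hex mu Hmu) as (z & z1 & Hz & _ & HzM).
  destruct (singular_unique mu _ _ _ _ (HZ mu) Hz t) as [-> _]; auto.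
  unfold B; generalize (HzM t) (HB0 t Ht); lra.
Qed.

Lemma dF_between (m T T0 delta B L D mu mu' t s : R) : controlled m T T0 delta B L D ->
  Rabs mu <= m -> Rabs mu' <= m -> t <= T ->
  Rmin (Z mu t) (Z mu' t) <= s <= Rmax (Z mu t) (Z mu' t) ->
  (t <= T0 -> Rabs (dF t s) <= e0) /\ Rabs (dF t s) <= L.
Proof.
intros (HD & HL & Hd & H1 & H2 & H3 & H4 & _) Hmu Hmu' Ht Hs.
split; [intros Ht0; apply H1; auto|apply H2; auto].
- assert (E := H3 mu t Hmu Ht0); assert (E' := H3 mu' t Hmu' Ht0).
  apply Rabs_le_between in E, E'; apply Rabs_le.
  assert (- (delta / 2) <= Rmin (Z mu t) (Z mu' t)) by (apply Rmin_glb; lra).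
  assert (Rmax (Z mu t) (Z mu' t) <= delta / 2) by (apply Rmax_lub; lra); lra.
- assert (E := H4 mu t Hmu Ht); assert (E' := H4 mu' t Hmu' Ht).
  assert (Rmax (Z mu t) (Z mu' t) <= B - gam) by (apply Rmax_lub; lra); lra.
Qed.

Lemma Z_past_bounded (mu : R) : past_bounded (Z mu).
Proof. exact (singular_past_bounded _ _ _ (HZ mu)). Qed.

Lemma Z_solves (mu T : R) : solves a h T (Z mu) (Z1 mu) (fun t => F mu t (Z mu t)).
Proof. apply (HZ mu). Qed.

Lemma Z_lipschitz (m T : R) : 0 <= m -> exists C, 0 < C /\
  forall mu mu' t, Rabs mu <= m -> Rabs mu' <= m -> t <= T ->
  Rabs (Z mu t - Z mu' t) <= C * Rabs (mu - mu') /\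
  Rabs (Z1 mu t - Z1 mu' t) <= C * Rabs (mu - mu').
Proof.
intros Hm; destruct (controlled_exists m T Hm) as (T0 & delta & B & L & D & HC).
assert (HC' := HC); destruct HC' as (HD & HL & _ & _ & _ & _ & _ & Hst).
destruct (bounded_upto g T) as [Gm [HG HgG]]; auto.
{ exact (tends_past_bounded _ _ glim). }
exists (D * (Gm + 1)); split; [nra|]; intros mu mu' t Hmu Hmu' Ht.
assert (Heta : 0 <= Gm * Rabs (mu - mu')) by (apply Rmult_le_pos; [auto|apply Rabs_pos]).
assert (Hgen : forall s c, s <= T ->
  (forall x, Rmin (Z mu' s) (Z mu s) <= x <= Rmax (Z mu' s) (Z mu s) -> Rabs (dF s x) <= c) ->
  Rabs (F mu s (Z mu s) - F mu' s (Z mu' s)) <= c * Rabs (Z mu s - Z mu' s) + Gm * Rabs (mu - mu')).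
{ intros s c Hs Hc; destruct (F_diff mu mu' s (Z mu s) (Z mu' s)) as [x [Hx ->]].
  eapply Rle_trans; [apply Rabs_triang|]; rewrite Rabs_Ropp, !Rabs_mult; apply Rplus_le_compat.
  - apply Rmult_le_compat_r; [apply Rabs_pos|now apply Hc].
  - rewrite Rmult_comm; apply Rmult_le_compat_r; [apply Rabs_pos|auto]. }
destruct (Hst (Gm * Rabs (mu - mu')) (fun t => Z mu t - Z mu' t) (fun t => Z1 mu t - Z1 mu' t)
  (fun t => F mu t (Z mu t) - F mu' t (Z mu' t))) with (t := t) as [E E1]; auto.
- apply solves_minus; apply Z_solves.
- apply past_bounded_minus; apply Z_past_bounded.
- intros s Hs Hs0; apply Hgen; auto; intros x Hx.
  now apply (dF_between m T T0 delta B L D mu' mu).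
- intros s Hs Hs0; apply Hgen; auto; intros x Hx.
  now apply (dF_between m T T0 delta B L D mu' mu).
- assert (D * (Gm * Rabs (mu - mu')) <= D * (Gm + 1) * Rabs (mu - mu')).
  { rewrite Rmult_assoc; apply Rmult_le_compat_l; [lra|]; generalize (Rabs_pos (mu - mu')); nra. }
  lra.
Qed.

Lemma dF_continuous (mu t : R) : continuous (fun t => dF t (Z mu t)) t.
Proof.
unfold dF; apply continuous_sub; [apply continuous_cst|].
apply continuous_mul; [auto|]; apply continuous_mul; [apply continuous_cst|].
apply (continuous_comp (fun t => gam + Z mu t) (fun w => pospow w (p - 1))).
- apply continuous_add; [apply continuous_cst|exact (singular_continuous _ _ _ t (HZ mu))].
- apply continuous_pospow; lra.
Qed.

Lemma linear_solvable (q s : R -> R) (T0 : R) :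
  (forall t, continuous q t) -> (forall t, t <= T0 -> Rabs (q t) <= e0) ->
  (forall t, continuous s t) -> past_bounded s ->
  exists y y1, (forall T, solves a h T y y1 (fun t => q t * y t + s t)) /\ past_bounded y.
Proof.
intros Hq Hqb Hs Hsb; apply (Hsolv (fun t y => q t * y + s t) T0).
- intros z Hz t; apply continuous_add; auto; apply continuous_mul; auto.
- intros t x y Ht; replace (q t * x + s t - (q t * y + s t)) with (q t * (x - y)) by ring.
  rewrite Rabs_mult; apply Rmult_le_compat_r; [apply Rabs_pos|auto].
- intros T; destruct (bounded_upto q T) as [L [HL HqL]]; auto.
  { exists e0, T0; auto. }
  exists L; split; auto; intros t x y Ht.
  replace (q t * x + s t - (q t * y + s t)) with (q t * (x - y)) by ring.
  rewrite Rabs_mult; apply Rmult_le_compat_r; [apply Rabs_pos|auto].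
- destruct Hsb as [B [S HB]]; exists B, S; intros t Ht.
  rewrite Rmult_0_r, Rplus_0_l; auto.
Qed.

(** This is the equation differentiated formally in [mu], with - g the derivative of [F] in [mu];
    its solution is the candidate for the derivative of [Z]. *)
Lemma variation_exists (mu : R) : exists y y1,
  (forall T, solves a h T y y1 (fun t => dF t (Z mu t) * y t + - g t)) /\ past_bounded y.
Proof.
destruct (controlled_exists (Rabs mu) 0 (Rabs_pos mu)) as (T0 & delta & B & L & D & HC).
destruct HC as (HD & HL & Hd & H1 & H2 & H3 & _).
apply (linear_solvable _ _ T0).
- apply dF_continuous.
- intros t Ht; apply H1; auto; generalize (H3 mu t (Rle_refl _) Ht); lra.
- intros t; apply (continuous_opp (V := R_NormedModule)); auto.
- destruct (tends_past_bounded _ _ glim) as [B' [S HB]]; exists B', S; intros t Ht.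
  rewrite Rabs_Ropp; auto.
Qed.

Variables Y Y1 : R -> R -> R.
Hypothesis HY : forall mu,
  (forall T, solves a h T (Y mu) (Y1 mu) (fun t => dF t (Z mu t) * Y mu t + - g t)) /\
  past_bounded (Y mu).

Lemma Rabs_near_le (mu mu' : R) : Rabs (mu' - mu) < 1 -> Rabs mu' <= Rabs mu + 1.
Proof.
intros H; replace mu' with ((mu' - mu) + mu) by ring.
eapply Rle_trans; [apply Rabs_triang|lra].
Qed.

Lemma dF_uniform (mu T eps : R) : 0 < eps -> exists d, 0 < d /\ d <= 1 /\
  forall mu' t s, Rabs (mu' - mu) < d -> t <= T ->
  Rmin (Z mu t) (Z mu' t) <= s <= Rmax (Z mu t) (Z mu' t) ->
  Rabs (dF t s - dF t (Z mu t)) <= eps.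
Proof.
intros He.
assert (Hm : 0 <= Rabs mu + 1) by (generalize (Rabs_pos mu); lra).
destruct (controlled_exists (Rabs mu + 1) T Hm) as (T0 & delta & B & L & D & HC).
destruct HC as (_ & _ & _ & _ & _ & _ & H4 & _).
destruct (Z_lipschitz (Rabs mu + 1) T Hm) as [C [HC HLip]].
destruct (dF_diff T) as [K [HK HKd]].
destruct (pospow_uniform_continuity (p - 1) B (eps / K)) as [d [Hd Hu]]; [lra|now apply Rdiv_lt_0_compat|].
exists (Rmin 1 (d / C)); split; [apply Rmin_pos; [lra|now apply Rdiv_lt_0_compat]|].
split; [apply Rmin_l|]; intros mu' t s Hmu Ht Hs.
assert (Hmu1 : Rabs (mu' - mu) < 1) by (eapply Rlt_le_trans; [apply Hmu|apply Rmin_l]).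
assert (Hmu2 : Rabs (mu' - mu) < d / C) by (eapply Rlt_le_trans; [apply Hmu|apply Rmin_r]).
assert (Hb' := Rabs_near_le mu mu' Hmu1).
assert (Hb0 : Rabs mu <= Rabs mu + 1) by lra.
destruct (HLip mu' mu t Hb' Hb0 Ht) as [E _].
assert (Hs1 : Rabs (s - Z mu t) < d).
{ apply (Rle_lt_trans _ (Rabs (Z mu' t - Z mu t))).
  - revert Hs; unfold Rmin, Rmax; destruct (Rle_dec (Z mu t) (Z mu' t)); intros Hs;
      unfold Rabs; repeat destruct Rcase_abs; lra.
  - eapply Rle_lt_trans; [apply E|]; apply (Rmult_lt_compat_l C) in Hmu2; auto.
    replace (C * (d / C)) with d in Hmu2 by (field; lra); auto. }
eapply Rle_trans; [now apply HKd|].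
apply (Rle_trans _ (K * (eps / K))); [|right; field; lra].
apply Rmult_le_compat_l; [lra|]; left; apply Hu.
- assert (E1 := H4 mu t Hb0 Ht); assert (E2 := H4 mu' t Hb' Ht).
  assert (Rmax (Z mu t) (Z mu' t) <= B - gam) by (apply Rmax_lub; lra); lra.
- generalize (H4 mu t Hb0 Ht); lra.
- now replace (gam + s - (gam + Z mu t)) with (s - Z mu t) by ring.
Qed.

(** The remainder solves the linearized equation with source (dF(s) - dF(Z mu)) (Z mu' - Z mu) for
    some intermediate s. The first factor is small by [dF_uniform], the second at most C |mu' - mu|;
    stability multiplies by [D], whence the tolerance [eps / (D * C)]. *)
Lemma Z_expansion (mu T eps : R) : 0 < eps -> exists d, 0 < d /\
  forall mu' t, Rabs (mu' - mu) < d -> t <= T ->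
  Rabs (Z mu' t - Z mu t - (mu' - mu) * Y mu t) <= eps * Rabs (mu' - mu) /\
  Rabs (Z1 mu' t - Z1 mu t - (mu' - mu) * Y1 mu t) <= eps * Rabs (mu' - mu).
Proof.
intros He.
assert (Hm : 0 <= Rabs mu + 1) by (generalize (Rabs_pos mu); lra).
destruct (controlled_exists (Rabs mu + 1) T Hm) as (T0 & delta & B & L & D & HC).
assert (HC' := HC); destruct HC' as (HD & HL & Hdel & H1 & H2 & H3 & H4 & Hst).
destruct (Z_lipschitz (Rabs mu + 1) T Hm) as [C [HCp HLip]].
assert (HDC : 0 < D * C) by now apply Rmult_lt_0_compat.
destruct (dF_uniform mu T (eps / (D * C))) as [d [Hd [Hd1 Hu]]]; [now apply Rdiv_lt_0_compat|].
exists d; split; auto; intros mu' t Hmu Ht.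
assert (Hb' := Rabs_near_le mu mu' ltac:(lra)).
assert (Hb0 : Rabs mu <= Rabs mu + 1) by lra.
destruct (HY mu) as [HYs HYb].
set (eta := eps / (D * C) * (C * Rabs (mu' - mu))).
assert (Heta : 0 <= eta).
{ unfold eta; apply Rmult_le_pos; [left; now apply Rdiv_lt_0_compat|].
  apply Rmult_le_pos; [lra|apply Rabs_pos]. }
replace (eps * Rabs (mu' - mu)) with (D * eta) by (unfold eta; field; lra).
set (e := fun t => Z mu' t - Z mu t - (mu' - mu) * Y mu t).
set (H := fun t => F mu' t (Z mu' t) - F mu t (Z mu t) - (mu' - mu) * (dF t (Z mu t) * Y mu t + - g t)).
assert (Hgen : forall s c, s <= T -> Rabs (dF s (Z mu s)) <= c -> Rabs (H s) <= c * Rabs (e s) + eta).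
{ intros s c Hs Hc; unfold H.
  destruct (F_diff mu' mu s (Z mu' s) (Z mu s)) as [x [Hx ->]]; fold (dF s x).
  replace (dF s x * (Z mu' s - Z mu s) - (mu' - mu) * g s - (mu' - mu) * (dF s (Z mu s) * Y mu s + - g s))
    with (dF s (Z mu s) * e s + (dF s x - dF s (Z mu s)) * (Z mu' s - Z mu s)) by (unfold e; ring).
  eapply Rle_trans; [apply Rabs_triang|]; rewrite !Rabs_mult; apply Rplus_le_compat.
  - apply Rmult_le_compat_r; [apply Rabs_pos|auto].
  - unfold eta; apply Rmult_le_compat; try apply Rabs_pos.
    + now apply (Hu mu').
    + now apply HLip. }
apply (Hst eta e (fun t => Z1 mu' t - Z1 mu t - (mu' - mu) * Y1 mu t) H); auto.
- intros s Hs; destruct (Z_solves mu' s s (Rle_refl s)) as [A1 A2], (Z_solves mu s s (Rle_refl s)) as [A3 A4],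
    (HYs s s (Rle_refl s)) as [A5 A6]; unfold e, H; split; derive_known.
- apply past_bounded_minus; [apply past_bounded_minus; apply Z_past_bounded|].
  destruct HYb as [B' [S HB]]; exists (Rabs (mu' - mu) * B'), S; intros s Hs.
  rewrite Rabs_mult; apply Rmult_le_compat_l; [apply Rabs_pos|auto].
- intros s Hs Hs0; apply Hgen; auto; apply H1; auto.
  generalize (H3 mu s Hb0 Hs0); lra.
- intros s Hs Hs0; apply Hgen; auto; apply H2; auto.
  generalize (H4 mu s Hb0 Hs); lra.
Qed.

Lemma is_derive_of_expansion (f : R -> R) (x l : R) :
  (forall eps, 0 < eps -> exists d, 0 < d /\
     forall y, Rabs (y - x) < d -> Rabs (f y - f x - (y - x) * l) <= eps * Rabs (y - x)) ->
  is_derive f x l.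
Proof.
intros H; apply is_derive_Reals; intros eps He.
destruct (H (eps / 2) ltac:(lra)) as [d [Hd Hy]]; exists (mkposreal d Hd); intros u Hu0 Hu; simpl in Hu.
specialize (Hy (x + u)); replace (x + u - x) with u in Hy by ring; specialize (Hy Hu).
assert (Hp' : 0 < Rabs u) by now apply Rabs_pos_lt.
replace ((f (x + u) - f x) / u - l) with ((f (x + u) - f x - u * l) / u) by (field; auto).
unfold Rdiv; rewrite Rabs_mult, Rabs_inv.
apply (Rmult_lt_reg_r (Rabs u)); auto; rewrite Rmult_assoc, Rinv_l, Rmult_1_r by lra.
nra.
Qed.

Lemma is_derive_Z_param (mu t : R) :
  is_derive (fun m => Z m t) mu (Y mu t) /\ is_derive (fun m => Z1 m t) mu (Y1 mu t).
Proof.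
split; apply is_derive_of_expansion; intros eps He;
  destruct (Z_expansion mu t eps He) as [d [Hd H]]; exists d; split; auto; intros y Hy;
  apply (H y t Hy (Rle_refl t)).
Qed.

(** The difference of the two derivatives solves the equation linearized at [Z mu'] with source
    (dF(Z mu') - dF(Z mu)) Y mu, small because [Y mu] is bounded up to [T]. *)
Lemma Y_uniform (mu T eps : R) : 0 < eps -> exists d, 0 < d /\
  forall mu' t, Rabs (mu' - mu) < d -> t <= T -> Rabs (Y mu' t - Y mu t) <= eps.
Proof.
intros He.
assert (Hm : 0 <= Rabs mu + 1) by (generalize (Rabs_pos mu); lra).
destruct (controlled_exists (Rabs mu + 1) T Hm) as (T0 & delta & B & L & D & HC).
assert (HC' := HC); destruct HC' as (HD & HL & Hdel & H1 & H2 & H3 & H4 & Hst).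
destruct (HY mu) as [HYs HYb].
destruct (bounded_upto (Y mu) T) as [Ym [HYm HYY]]; auto.
{ intros s _; exact (solves_continuous _ _ s _ _ _ s (HYs s) (Rle_refl s)). }
assert (HDY : 0 < D * (Ym + 1)) by (apply Rmult_lt_0_compat; lra).
destruct (dF_uniform mu T (eps / (D * (Ym + 1)))) as [d [Hd [Hd1 Hu]]]; [now apply Rdiv_lt_0_compat|].
exists d; split; auto; intros mu' t Hmu Ht.
assert (Hb' := Rabs_near_le mu mu' ltac:(lra)).
destruct (HY mu') as [HYs' HYb'].
set (eta := eps / (D * (Ym + 1)) * (Ym + 1)).
assert (Heta : 0 <= eta).
{ unfold eta; apply Rmult_le_pos; [left; now apply Rdiv_lt_0_compat|lra]. }
replace eps with (D * eta) by (unfold eta; field; lra).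
set (H := fun t => dF t (Z mu' t) * Y mu' t + - g t - (dF t (Z mu t) * Y mu t + - g t)).
assert (Hgen : forall s c, s <= T -> Rabs (dF s (Z mu' s)) <= c -> Rabs (H s) <= c * Rabs (Y mu' s - Y mu s) + eta).
{ intros s c Hs Hc; unfold H.
  replace (dF s (Z mu' s) * Y mu' s + - g s - (dF s (Z mu s) * Y mu s + - g s)) with
    (dF s (Z mu' s) * (Y mu' s - Y mu s) + (dF s (Z mu' s) - dF s (Z mu s)) * Y mu s) by ring.
  eapply Rle_trans; [apply Rabs_triang|]; rewrite !Rabs_mult; apply Rplus_le_compat.
  - apply Rmult_le_compat_r; [apply Rabs_pos|auto].
  - unfold eta; apply Rmult_le_compat; try apply Rabs_pos.
    + apply (Hu mu'); auto; split; [apply Rmin_r|apply Rmax_r].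
    + generalize (HYY s Hs); lra. }
apply (Hst eta (fun t => Y mu' t - Y mu t) (fun t => Y1 mu' t - Y1 mu t) H); auto.
- unfold H; apply solves_minus; auto.
- now apply past_bounded_minus.
- intros s Hs Hs0; apply Hgen; auto; apply H1; auto.
  generalize (H3 mu' s Hb' Hs0); lra.
- intros s Hs Hs0; apply Hgen; auto; apply H2; auto.
  generalize (H4 mu' s Hb' Hs); lra.
Qed.

Lemma jointly_continuous (U : R -> R -> R) (mu t : R) : continuous (U mu) t ->
  (forall eps, 0 < eps -> exists d, 0 < d /\
    forall mu' s, Rabs (mu' - mu) < d -> s <= t + 1 -> Rabs (U mu' s - U mu s) <= eps) ->
  forall eps, 0 < eps -> exists d, 0 < d /\
    forall mu' s, Rabs (mu' - mu) < d -> Rabs (s - t) < d -> Rabs (U mu' s - U mu t) < eps.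
Proof.
intros Hc Hu eps He.
destruct (continuous_eps_elim _ _ Hc (eps / 2) ltac:(lra)) as [d1 [Hd1 H1]].
destruct (Hu (eps / 4) ltac:(lra)) as [d2 [Hd2 H2]].
exists (Rmin 1 (Rmin d1 d2)); split; [repeat apply Rmin_pos; lra|]; intros mu' s Hmu Hs.
assert (E1 := Rmin_l 1 (Rmin d1 d2)); assert (E2 := Rmin_r 1 (Rmin d1 d2)).
assert (E3 := Rmin_l d1 d2); assert (E4 := Rmin_r d1 d2).
assert (E5 : s <= t + 1) by (generalize (Rle_abs (s - t)); lra).
specialize (H1 s ltac:(lra)); specialize (H2 mu' s ltac:(lra) E5).
replace (U mu' s - U mu t) with ((U mu' s - U mu s) + (U mu s - U mu t)) by ring.
eapply Rle_lt_trans; [apply Rabs_triang|lra].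
Qed.

Lemma Y_jointly_continuous (mu t eps : R) : 0 < eps -> exists d, 0 < d /\
  forall mu' s, Rabs (mu' - mu) < d -> Rabs (s - t) < d -> Rabs (Y mu' s - Y mu t) < eps.
Proof.
apply jointly_continuous.
- destruct (HY mu) as [HYs _]; exact (solves_continuous _ _ t _ _ _ t (HYs t) (Rle_refl t)).
- intros e He; exact (Y_uniform mu (t + 1) e He).
Qed.

Lemma Z_uniform (mu T eps : R) : 0 < eps -> exists d, 0 < d /\
  forall mu' t, Rabs (mu' - mu) < d -> t <= T ->
  Rabs (Z mu' t - Z mu t) <= eps /\ Rabs (Z1 mu' t - Z1 mu t) <= eps.
Proof.
intros He.
assert (Hm : 0 <= Rabs mu + 1) by (generalize (Rabs_pos mu); lra).
destruct (Z_lipschitz (Rabs mu + 1) T Hm) as [C [HC HLip]].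
exists (Rmin 1 (eps / C)); split; [apply Rmin_pos; [lra|now apply Rdiv_lt_0_compat]|].
intros mu' t Hmu Ht.
assert (Hmu1 : Rabs (mu' - mu) < 1) by (eapply Rlt_le_trans; [apply Hmu|apply Rmin_l]).
assert (Hmu2 : Rabs (mu' - mu) < eps / C) by (eapply Rlt_le_trans; [apply Hmu|apply Rmin_r]).
destruct (HLip mu' mu t (Rabs_near_le _ _ Hmu1) ltac:(lra) Ht) as [E E1].
apply (Rmult_lt_compat_l C) in Hmu2; auto.
replace (C * (eps / C)) with eps in Hmu2 by (field; lra); lra.
Qed.

Lemma Z_jointly_continuous (mu t eps : R) : 0 < eps -> exists d, 0 < d /\
  forall mu' s, Rabs (mu' - mu) < d -> Rabs (s - t) < d ->
  Rabs (Z mu' s - Z mu t) < eps /\ Rabs (Z1 mu' s - Z1 mu t) < eps.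
Proof.
intros He.
destruct (jointly_continuous Z mu t) with (eps := eps) as [d [Hd H]]; auto.
{ exact (singular_continuous _ _ _ t (HZ mu)). }
{ intros e He'; destruct (Z_uniform mu (t + 1) e He') as [d [Hd H]]; exists d; split; auto.
  intros; now apply H. }
destruct (jointly_continuous Z1 mu t) with (eps := eps) as [d' [Hd' H']]; auto.
{ destruct (Z_solves mu t t (Rle_refl t)) as [_ D]; exact (is_derive_continuous _ _ _ D). }
{ intros e He'; destruct (Z_uniform mu (t + 1) e He') as [d'' [Hd'' H'']]; exists d''; split; auto.
  intros; now apply H''. }
exists (Rmin d d'); split; [now apply Rmin_pos|]; intros mu' s Hmu Hs.
assert (E1 := Rmin_l d d'); assert (E2 := Rmin_r d d').
split; [apply H|apply H']; lra.
Qed.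

(** * Analytic dependence along positive solutions *)

Lemma continuous_Rinv_pos (f : R -> R) (t : R) : 0 < f t -> continuous f t -> continuous (fun t => / f t) t.
Proof.
intros Hf Hc; apply (continuous_comp f Rinv); auto.
apply (is_derive_continuous _ _ (- / (f t) ^ 2)); auto_derive; [lra|field; lra].
Qed.

(* Coefficients of the formal expansions of [Z] and of [(gam + Z)^p] in powers of [mu - mu0]; the
   last clause is the identity [w q' = p w' q].  To have a recursion on the whole line the divisor
   [gam + Z mu0 t] is replaced by [Rmax c (gam + Z mu0 t)], which changes nothing for [t <= T].
   The bound [E R0^n / n^2] reproduces itself by [square_convolution]. *)
Lemma formal_expansion (mu0 T c : R) : 0 < c -> (forall t, t <= T -> c <= gam + Z mu0 t) ->
  exists (v v1 Q : nat -> R -> R) (E R0 : R), 0 < E /\ 0 < R0 /\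
  (forall t, v O t = 0 /\ v1 O t = 0 /\ Q O t = 0) /\
  (forall n t, (1 <= n)%nat -> t <= T -> Rabs (v n t) <= E * R0 ^ n /\ Rabs (Q n t) <= E * R0 ^ n) /\
  (forall n, solves a h T (v (S n)) (v1 (S n))
    (fun t => p * A * v (S n) t - k t * Q (S n) t - match n with O => g t | _ => 0 end)) /\
  (forall n t, t <= T -> INR (S n) * (gam + Z mu0 t) * Q (S n) t =
    p * INR (S n) * v (S n) t * pospow (gam + Z mu0 t) p +
    sum_f_R0 (fun i => (p * INR i - INR (S n - i)) * (v i t * Q (S n - i)%nat t)) (S n)).
Proof.
intros Hc HZc.
assert (Hm : 0 <= Rabs mu0) by apply Rabs_pos.
destruct (controlled_exists (Rabs mu0) T Hm) as (T0 & delta & B & L & D & HCtl).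
destruct HCtl as (HD & HL & Hdel & H1 & H2 & H3 & H4 & Hst).
destruct (bounded_upto k T) as [K [HK HkK]]; auto.
{ exact (tends_past_bounded _ _ klim). }
destruct (bounded_upto g T) as [Gm [HG HgG]]; auto.
{ exact (tends_past_bounded _ _ glim). }
set (w0 := fun t => Rmax c (gam + Z mu0 t)).
assert (Hw0c : forall t, continuous w0 t).
{ intros t; unfold w0; apply (continuous_comp (fun t => gam + Z mu0 t) (Rmax c)).
  - apply continuous_add; [apply continuous_cst|exact (singular_continuous _ _ _ t (HZ mu0))].
  - apply continuous_nonexpansive; intros; apply Rmax_lipschitz. }
assert (Hw0 : forall t, c <= w0 t) by (intros; apply Rmax_l).
assert (Hw0Z : forall t, t <= T -> w0 t = gam + Z mu0 t).
{ intros t Ht; unfold w0; apply Rmax_right; auto. }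
set (q := fun t => dF t (Z mu0 t)).
assert (Hqb : forall t, t <= T -> Rabs (q t) <= L).
{ intros t Ht; apply H2; auto; generalize (H4 mu0 t (Rle_refl _) Ht); lra. }
destruct (functional_choice (fun (s : R -> R) (y : (R -> R) * (R -> R)) =>
  (forall t, continuous s t) -> past_bounded s ->
  (forall T, solves a h T (fst y) (snd y) (fun t => q t * fst y t + s t)) /\ past_bounded (fst y)))
  as [Sol HSol].
{ intros s; destruct (classic ((forall t, continuous s t) /\ past_bounded s)) as [[A1 A2]|Hn].
  - destruct (linear_solvable q s T0) as (y & y1 & Hy); auto.
    + apply dF_continuous.
    + intros t Ht; apply H1; auto; generalize (H3 mu0 t (Rle_refl _) Ht); lra.
    + exists (y, y1); auto.
  - exists ((fun _ => 0), (fun _ => 0)); tauto. }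
set (X := ((R -> R) * (R -> R) * (R -> R))%type).
set (zero := ((fun _ => 0, fun _ => 0, fun _ => 0) : X)).
(* At order n the identity reads n w0 Q_n = p n v_n w0^p + sum of (p i - (n - i)) v_i Q_(n-i).
   Dividing by n w0 leaves Q_n = p w0^(p-1) v_n + rem, and [rem] involves only indices below n
   because v_0 = Q_0 = 0. *)
set (rem := fun (n : nat) (f : nat -> X) (t : R) => / (INR n * w0 t) *
  sum_f_R0 (fun i => (p * INR i - INR (n - i)) * (fst (fst (f i)) t * snd (f (n - i)%nat) t)) n).
(* Inserting Q_n in the equation for v_n moves p w0^(p-1) v_n into the coefficient [q], so every v_n
   solves the same linearized equation with a known source; [g] enters at order 1 only, as mu g is
   linear in mu. *)
set (src := fun (n : nat) (f : nat -> X) (t : R) => - k t * rem n f t - match n with 1%nat => g t | _ => 0 end).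
set (next := fun (n : nat) (f : nat -> X) => match n with O => zero | _ =>
  let y := Sol (src n f) in
  ((fst y, snd y, fun t => p * pospow (w0 t) (p - 1) * fst y t + rem n f t) : X) end).
destruct (course_of_values X zero (fun n f => next n (fun i => if Nat.ltb i n then f i else zero))) as [u Hu].
{ intros n f f' Hff; f_equal; apply functional_extensionality; intros i.
  destruct (Nat.ltb_spec i n); auto. }
set (v := fun n => fst (fst (u n))); set (v1 := fun n => snd (fst (u n))); set (Q := fun n => snd (u n)).
assert (Hu0 : u O = zero) by (rewrite Hu; reflexivity).
assert (Hrem : forall n, rem (S n) (fun i => if Nat.ltb i (S n) then u i else zero) = rem (S n) u).
{ intros n; apply functional_extensionality; intros t; unfold rem; f_equal.
  apply sum_eq; intros i Hi.
  destruct (Nat.ltb_spec i (S n)), (Nat.ltb_spec (S n - i) (S n)); auto.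
  - replace i with O by lia; rewrite Hu0; simpl; ring.
  - replace i with (S n) by lia; rewrite Nat.sub_diag, Hu0; simpl; ring.
  - lia. }
assert (Hun : forall n, u (S n) = next (S n) u).
{ intros n; rewrite Hu at 1; unfold next.
  assert (Es : src (S n) (fun i => if Nat.ltb i (S n) then u i else zero) = src (S n) u).
  { unfold src; apply functional_extensionality; intros t; now rewrite Hrem. }
  now rewrite Es, Hrem. }
set (P1 := p * pospow B (p - 1)).
assert (HP1 : 0 <= P1) by (unfold P1; generalize (pospow_nonneg B (p - 1)); nra).
assert (HP1w : forall t, t <= T -> 0 <= p * pospow (w0 t) (p - 1) <= P1).
{ intros t Ht; split; [generalize (pospow_nonneg (w0 t) (p - 1)); nra|].
  apply Rmult_le_compat_l; [lra|]; apply pospow_mono; [lra|].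
  rewrite Hw0Z by auto; generalize (H4 mu0 t (Rle_refl _) Ht); lra. }
(* In [rem] the coefficient p i - (n - i) is at most (p + 1) n in absolute value, the convolution
   costs 8 and the division by w0 costs 1 / c; hence |rem| <= J E bd. *)
set (J := 8 * ((p + 1) / c)).
assert (HJ : 0 < J) by (unfold J; assert (0 < (p + 1) / c) by (apply Rdiv_lt_0_compat; lra); lra).
(* [W] collects what [rem] contributes to v_n (factor D K) and to Q_n (factors P1 D K and 1). *)
set (W := D * K + P1 * (D * K) + 1).
assert (HDK : 0 <= D * K) by (apply Rmult_le_pos; lra).
assert (HW : 0 < W) by (unfold W; assert (0 <= P1 * (D * K)) by (apply Rmult_le_pos; auto); lra).
(* The bound on [rem] is quadratic in [E], so a small [E] limits its contribution to half of the
   desired bound; [R0] is then large enough for the source [g] at order 1 to fit into the other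
   half. *)
set (E := / (2 * W * J)).
assert (HE : 0 < E) by (apply Rinv_0_lt_compat; apply Rmult_lt_0_compat; [lra|exact HJ]).
set (R0 := 2 * ((D * Gm + P1 * (D * Gm)) / E) + 1).
assert (HDG : 0 <= D * Gm) by (apply Rmult_le_pos; lra).
assert (HPDG : 0 <= P1 * (D * Gm)) by now apply Rmult_le_pos.
assert (HR0 : 0 < R0).
{ unfold R0; assert (0 <= (D * Gm + P1 * (D * Gm)) / E) by (apply Rdiv_le_0_compat; lra); lra. }
assert (HER : D * Gm + P1 * (D * Gm) <= E * R0 / 2).
{ unfold R0; replace (E * (2 * ((D * Gm + P1 * (D * Gm)) / E) + 1) / 2) with
    (D * Gm + P1 * (D * Gm) + E / 2) by (field; lra); lra. }
assert (HEW : W * (J * E) = / 2) by (unfold E; field; split; lra).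
set (bd := fun n => E * R0 ^ n * invsq n).
assert (Hbd0 : forall n, 0 <= bd n).
{ intros n; unfold bd; apply Rmult_le_pos; [|apply invsq_bounds].
  apply Rmult_le_pos; [lra|apply pow_le; lra]. }
assert (Hrb : forall n t, t <= T -> (forall i, (i <= n)%nat -> Rabs (v i t) <= bd i /\ Rabs (Q i t) <= bd i) ->
  Rabs (rem (S n) u t) <= J * E * bd (S n)).
{ intros n t Ht Hi; unfold rem; set (N := S n).
  assert (HN : 0 < INR N) by apply lt_0_INR, Nat.lt_0_succ.
  assert (Hwt : 0 < w0 t) by (generalize (Hw0 t); lra).
  rewrite Rabs_mult, Rabs_pos_eq by (left; apply Rinv_0_lt_compat; nra).
  apply (Rle_trans _ (/ (INR N * w0 t) * ((p + 1) * INR N * (E * E * R0 ^ N) * (8 * invsq N)))).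
  - apply Rmult_le_compat_l; [left; apply Rinv_0_lt_compat; nra|].
    eapply Rle_trans; [apply Rsum_abs|].
    apply (Rle_trans _ (sum_f_R0 (fun i => invsq i * invsq (N - i) * ((p + 1) * INR N * (E * E * R0 ^ N))) N)).
    + apply sum_Rle; intros i HiN; rewrite !Rabs_mult; fold (v i) (Q (N - i)%nat).
      destruct (Nat.eq_dec i 0) as [->|Hi0].
      { unfold v; rewrite Hu0; simpl fst; rewrite Rabs_R0; simpl (invsq 0); right; ring. }
      destruct (Nat.eq_dec i N) as [->|HiN'].
      { rewrite Nat.sub_diag; unfold Q; rewrite Hu0; simpl snd; rewrite Rabs_R0; simpl (invsq 0); right; ring. }
      assert (Hc1 : Rabs (p * INR i - INR (N - i)) <= (p + 1) * INR N).
      { assert (E1 : INR N = INR i + INR (N - i)) by (rewrite <- plus_INR; f_equal; lia).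
        assert (E2 := pos_INR i); assert (E3 := pos_INR (N - i)); rewrite E1.
        apply Rabs_le; nra. }
      assert (Hv := proj1 (Hi i ltac:(lia))); assert (HQ := proj2 (Hi (N - i)%nat ltac:(lia))).
      apply (Rle_trans _ ((p + 1) * INR N * (bd i * bd (N - i)%nat))).
      * apply Rmult_le_compat; try apply Rabs_pos; auto.
        { apply Rmult_le_pos; apply Rabs_pos. }
        apply Rmult_le_compat; try apply Rabs_pos; auto.
      * right; unfold bd; replace (R0 ^ N) with (R0 ^ i * R0 ^ (N - i)) by (rewrite <- pow_add; f_equal; lia); ring.
    + rewrite <- scal_sum; apply Rmult_le_compat_l; [|apply square_convolution].
      assert (0 < R0 ^ N) by now apply pow_lt.
      assert (0 < E * E * R0 ^ N) by (apply Rmult_lt_0_compat; [now apply Rmult_lt_0_compat|auto]).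
      apply Rmult_le_pos; [apply Rmult_le_pos; lra|lra].
  - replace (/ (INR N * w0 t) * ((p + 1) * INR N * (E * E * R0 ^ N) * (8 * invsq N))) with
      (/ w0 t * ((p + 1) * 8 * E * bd N)) by (unfold bd; field; lra).
    replace (J * E * bd N) with (/ c * ((p + 1) * 8 * E * bd N)) by (unfold J; field; lra).
    apply Rmult_le_compat_r; [|apply Rinv_le_contravar; auto].
    generalize (Hbd0 N); intros; apply Rmult_le_pos; [|auto]; apply Rmult_le_pos; lra. }
assert (HP : forall n, (forall t, continuous (v n) t) /\ (forall t, continuous (Q n) t) /\
  (forall t, t <= T -> Rabs (v n t) <= bd n /\ Rabs (Q n t) <= bd n) /\
  match n with O => True | S _ => solves a h T (v n) (v1 n) (fun t => q t * v n t + src n u t) end).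
{ induction n as [n IH] using (well_founded_induction Nat.lt_wf_0).
  destruct n as [|n].
  { unfold v, Q; rewrite Hu0; unfold zero; simpl fst; simpl snd.
    split; [intros; apply continuous_cst|split; [intros; apply continuous_cst|split; auto]].
    intros t _; rewrite Rabs_R0; split; apply Hbd0. }
  assert (HrT : forall t, t <= T -> Rabs (rem (S n) u t) <= J * E * bd (S n)).
  { intros t Ht; apply Hrb; auto; intros i Hi; apply (IH i ltac:(lia)); auto. }
  assert (Hrc : forall t, continuous (rem (S n) u) t).
  { intros t; unfold rem.
    (* The extreme terms, which carry a factor of index 0 and so vanish, are replaced by 0: the
       induction hypothesis gives no continuity at index [S n]. *)
    rewrite (functional_extensionality _ (fun t => / (INR (S n) * w0 t) * sum_f_R0 (fun i => (p * INR i - INR (S n - i)) *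
      (match i with O => 0 | _ => if Nat.ltb i (S n) then v i t * Q (S n - i)%nat t else 0 end)) (S n))).
    - apply continuous_mul.
      + apply continuous_Rinv_pos.
        * apply Rmult_lt_0_compat; [apply lt_0_INR; lia|generalize (Hw0 t); lra].
        * apply continuous_mul; [apply continuous_cst|auto].
      + apply (continuous_sum_f_R0 (fun i t => (p * INR i - INR (S n - i)) *
          (match i with O => 0 | _ => if Nat.ltb i (S n) then v i t * Q (S n - i)%nat t else 0 end))).
        intros i Hi; apply continuous_mul; [apply continuous_cst|].
        destruct i as [|i]; [apply continuous_cst|].
        destruct (Nat.ltb_spec (S i) (S n)); [|apply continuous_cst].
        apply continuous_mul; [apply (IH (S i) ltac:(lia))|apply (IH (S n - S i)%nat ltac:(lia))].
    - intros x; f_equal; apply sum_eq; intros i Hi; f_equal.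
      destruct i as [|i]; [rewrite Hu0; simpl; ring|].
      destruct (Nat.ltb_spec (S i) (S n)); [reflexivity|].
      replace (S n - S i)%nat with O by lia; rewrite Hu0; simpl; ring. }
  assert (Hsc : forall t, continuous (src (S n) u) t).
  { intros t; unfold src; apply continuous_sub.
    - apply continuous_mul; [apply (continuous_opp (V := R_NormedModule)); auto|auto].
    - destruct n; [auto|apply continuous_cst]. }
  assert (HsT : forall t, t <= T -> Rabs (src (S n) u t) <= K * (J * E * bd (S n)) + match n with O => Gm | _ => 0 end).
  { intros t Ht; unfold src; eapply Rle_trans; [apply Rabs_triang|]; rewrite Rabs_Ropp; apply Rplus_le_compat.
    - rewrite Rabs_mult, Rabs_Ropp; apply Rmult_le_compat; try apply Rabs_pos; auto.
    - destruct n; [auto|rewrite Rabs_R0; lra]. }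
  assert (Hspb : past_bounded (src (S n) u)).
  { exists (K * (J * E * bd (S n)) + match n with O => Gm | _ => 0 end), T; auto. }
  destruct (HSol (src (S n) u) Hsc Hspb) as [Hs1 Hs2].
  assert (Hv : v (S n) = fst (Sol (src (S n) u))) by (unfold v; rewrite Hun; reflexivity).
  assert (Hv1 : v1 (S n) = snd (Sol (src (S n) u))) by (unfold v1; rewrite Hun; reflexivity).
  assert (HQ : Q (S n) = fun t => p * pospow (w0 t) (p - 1) * v (S n) t + rem (S n) u t)
    by (rewrite Hv; unfold Q; rewrite Hun; reflexivity).
  rewrite <- Hv in Hs1, Hs2; rewrite <- Hv1 in Hs1.
  assert (Hvc : forall t, continuous (v (S n)) t).
  { intros t; exact (solves_continuous _ _ t _ _ _ t (Hs1 t) (Rle_refl t)). }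
  set (eta := K * (J * E * bd (S n)) + match n with O => Gm | _ => 0 end) in *.
  assert (Hgm : 0 <= match n with O => Gm | _ => 0 end) by (destruct n; lra).
  assert (HJEb : 0 <= J * E * bd (S n)) by (apply Rmult_le_pos; [apply Rmult_le_pos; lra|auto]).
  assert (Heta : 0 <= eta) by (unfold eta; assert (0 <= K * (J * E * bd (S n))) by (apply Rmult_le_pos; auto); lra).
  assert (Hvb : forall t, t <= T -> Rabs (v (S n) t) <= D * eta).
  { intros t Ht; apply (Hst eta (v (S n)) (v1 (S n)) (fun t => q t * v (S n) t + src (S n) u t)); auto.
    - intros s Hs Hs0; eapply Rle_trans; [apply Rabs_triang|]; rewrite Rabs_mult.
      apply Rplus_le_compat; [|auto]; apply Rmult_le_compat_r; [apply Rabs_pos|].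
      apply H1; auto; generalize (H3 mu0 s (Rle_refl _) Hs0); lra.
    - intros s Hs Hs0; eapply Rle_trans; [apply Rabs_triang|]; rewrite Rabs_mult.
      apply Rplus_le_compat; [|auto]; apply Rmult_le_compat_r; [apply Rabs_pos|auto]. }
  assert (Hfin : D * eta + P1 * (D * eta) + J * E * bd (S n) <= bd (S n)).
  { replace (D * eta + P1 * (D * eta) + J * E * bd (S n)) with
      (W * (J * E) * bd (S n) + (D * match n with O => Gm | _ => 0 end + P1 * (D * match n with O => Gm | _ => 0 end)))
      by (unfold W, eta; ring).
    rewrite HEW; destruct n as [|n].
    - unfold bd at 1 2; simpl invsq; simpl pow; rewrite !Rmult_1_r, Rinv_1, !Rmult_1_r; lra.
    - generalize (Hbd0 (S (S n))); lra. }
  assert (HPDe : 0 <= P1 * (D * eta)) by (apply Rmult_le_pos; [auto|apply Rmult_le_pos; lra]).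
  split; [auto|split; [|split; [|exact (Hs1 T)]]].
  - rewrite HQ; intros t; apply continuous_add; [|auto]; apply continuous_mul; [|auto].
    apply continuous_mul; [apply continuous_cst|].
    apply (continuous_comp w0 (fun x => pospow x (p - 1))); [auto|apply continuous_pospow; lra].
  - intros t Ht; split; [eapply Rle_trans; [now apply Hvb|lra]|].
    rewrite HQ; eapply Rle_trans; [apply Rabs_triang|]; rewrite Rabs_mult.
    destruct (HP1w t Ht) as [HPa HPb]; rewrite (Rabs_pos_eq (p * _)) by auto.
    assert (HDe : 0 <= D * eta) by (apply Rmult_le_pos; lra).
    assert (p * pospow (w0 t) (p - 1) * Rabs (v (S n) t) <= P1 * (D * eta)).
    { apply Rmult_le_compat; auto; apply Rabs_pos. }
    generalize (HrT t Ht); lra. }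
assert (HQn : forall n t, Q (S n) t = p * pospow (w0 t) (p - 1) * v (S n) t + rem (S n) u t).
{ intros n t; unfold v, Q; rewrite Hun; reflexivity. }
exists v, v1, Q, E, R0; repeat match goal with |- _ /\ _ => split end; auto.
- intros t; unfold v, v1, Q; rewrite Hu0; simpl; auto.
- intros n t Hn Ht.
  assert (bd n <= E * R0 ^ n).
  { unfold bd; rewrite <- (Rmult_1_r (E * R0 ^ n)) at 2; apply Rmult_le_compat_l; [|apply invsq_bounds].
    apply Rmult_le_pos; [lra|apply pow_le; lra]. }
  destruct (HP n) as (_ & _ & Hb' & _); destruct (Hb' t Ht); split; lra.
- intros n; destruct (HP (S n)) as (_ & _ & _ & Hs).
  eapply solves_ext; [|exact Hs]; intros t Ht; cbv beta.
  rewrite HQn; unfold q, dF, src; rewrite (Hw0Z t Ht); destruct n; ring.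
- intros n t Ht; rewrite HQn; unfold rem.
  assert (HN : 0 < INR (S n)) by apply lt_0_INR, Nat.lt_0_succ.
  rewrite (Hw0Z t Ht), (pospow_step (gam + Z mu0 t) p).
  assert (0 < gam + Z mu0 t) by (generalize (HZc t Ht); lra).
  match goal with |- _ = _ + ?s => set (sm := s) end.
  match goal with |- context [sum_f_R0 ?f ?N] => change (sum_f_R0 f N) with sm end.
  field; lra.
Qed.

(** The limit [gam > 0] at -oo keeps the solution away from 0 in the past, and compactness does so
    afterwards. This makes positivity on an unbounded half-line stable under uniformly small
    changes. *)
Lemma positive_lower_bound (mu T : R) : (forall t, t <= T -> 0 < gam + Z mu t) ->
  exists c, 0 < c /\ forall t, t <= T -> c <= gam + Z mu t.
Proof.
intros Hpos; destruct (HZ mu) as [_ Hlim].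
destruct (Hlim (gam / 2) ltac:(lra)) as [S HS].
assert (HS' : forall t, t <= S -> gam / 2 <= gam + Z mu t).
{ intros t Ht; generalize (HS t Ht); rewrite Rminus_0_r; intros E; apply Rabs_le_between in E; lra. }
destruct (Rle_lt_dec T S) as [Hl|Hl].
- exists (gam / 2); split; [lra|]; intros t Ht; apply HS'; lra.
- destruct (continuity_ab_min (fun t => gam + Z mu t) S T) as [x [Hx Hx']]; [lra| |].
  + intros y Hy; apply continuity_pt_filterlim, (continuous_add (fun _ => gam));
      [apply continuous_cst|exact (singular_continuous _ _ _ y (HZ mu))].
  + exists (Rmin (gam / 2) (gam + Z mu x)); split; [apply Rmin_pos; [lra|apply Hpos; lra]|].
    intros t Ht; destruct (Rle_lt_dec t S).
    * eapply Rle_trans; [apply Rmin_l|now apply HS'].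
    * eapply Rle_trans; [apply Rmin_r|apply Hx; lra].
Qed.

Lemma positive_open (mu T : R) : (forall t, t <= T -> 0 < gam + Z mu t) ->
  exists d, 0 < d /\ forall mu', Rabs (mu' - mu) < d -> forall t, t <= T -> 0 < gam + Z mu' t.
Proof.
intros Hpos; destruct (positive_lower_bound mu T Hpos) as [c [Hc Hcb]].
destruct (Z_uniform mu T (c / 2)) as [d [Hd H]]; [lra|].
exists d; split; auto; intros mu' Hmu t Ht.
destruct (H mu' t Hmu Ht) as [E _]; apply Rabs_le_between in E.
generalize (Hcb t Ht); lra.
Qed.

Lemma solves_sum (T x : R) (f f1 H : nat -> R -> R) (N : nat) :
  (forall n, solves a h T (f n) (f1 n) (H n)) ->
  solves a h T (fun t => sum_f_R0 (fun n => f n t * x ^ n) N) (fun t => sum_f_R0 (fun n => f1 n t * x ^ n) N)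
    (fun t => sum_f_R0 (fun n => H n t * x ^ n) N).
Proof.
intros Hs.
assert (Hone : forall n, solves a h T (fun t => f n t * x ^ n) (fun t => f1 n t * x ^ n) (fun t => H n t * x ^ n)).
{ intros n t Ht; destruct (Hs n t Ht) as [A1 A2]; split.
  - eapply is_derive_eq; [exact (is_derive_scal_l (f n) t _ (x ^ n) A1)|reflexivity].
  - eapply is_derive_eq; [exact (is_derive_scal_l (f1 n) t _ (x ^ n) A2)|].
    unfold scal; simpl; unfold mult; simpl; ring. }
induction N; [exact (Hone O)|].
intros t Ht; destruct (IHN t Ht) as [A1 A2], (Hone (S N) t Ht) as [A3 A4]; split.
- exact (is_derive_add _ _ _ _ _ A1 A3).
- eapply is_derive_eq; [exact (is_derive_add _ _ _ _ _ A2 A4)|].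
  rewrite !tech5; ring.
Qed.

Lemma past_bounded_sum (x : R) (f : nat -> R -> R) (N : nat) :
  (forall n, past_bounded (f n)) -> past_bounded (fun t => sum_f_R0 (fun n => f n t * x ^ n) N).
Proof.
intros Hf.
assert (Hone : forall n, past_bounded (fun t => - (f n t * x ^ n))).
{ intros n; destruct (Hf n) as [B [S HB]]; exists (B * Rabs (x ^ n)), S; intros t Ht.
  rewrite Rabs_Ropp, Rabs_mult; apply Rmult_le_compat_r; [apply Rabs_pos|auto]. }
induction N.
- destruct (Hone O) as [B [S HB]]; exists B, S; intros t Ht; simpl; rewrite <- Rabs_Ropp; now apply HB.
- destruct (past_bounded_minus _ _ IHN (Hone (S N))) as [B [S HB]]; exists B, S; intros t Ht.
  rewrite tech5; replace (sum_f_R0 (fun n => f n t * x ^ n) N + f (Datatypes.S N) t * x ^ (Datatypes.S N)) with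
   (sum_f_R0 (fun n => f n t * x ^ n) N - - (f (Datatypes.S N) t * x ^ (Datatypes.S N))) by ring.
  now apply HB.
Qed.

(** By [PSeries_Rpower] the series for q sums to the p-th power of the series for w, so the partial
    sums satisfy the equation up to the tails of the two series. Stability turns these tails, of
    size 2^(-N), into the distance from the true solution; the infinite series are never
    differentiated in t. *)
Lemma Z_analytic (mu0 T : R) : (forall t, t <= T -> 0 < gam + Z mu0 t) ->
  analytic_at (fun mu => Z mu T) mu0 /\ analytic_at (fun mu => Z1 mu T) mu0.
Proof.
intros Hpos; destruct (positive_lower_bound mu0 T Hpos) as [c [Hc Hcb]].
destruct (formal_expansion mu0 T c Hc Hcb) as (v & v1 & Q & E & R0 & HE & HR & H0 & Hb' & Hs & Hrec).
assert (Hm : 0 <= Rabs mu0 + 1) by (generalize (Rabs_pos mu0); lra).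
destruct (controlled_exists (Rabs mu0 + 1) T Hm) as (T0 & delta & B & L & D & HCtl).
destruct HCtl as (HD & HL & Hdel & H1 & H2 & H3 & H4 & Hst).
destruct (bounded_upto k T) as [K [HK HkK]]; auto.
{ exact (tends_past_bounded _ _ klim). }
assert (HpA : 0 <= p * A) by (generalize A_pos; nra).
(* [c] keeps the sum of the series positive, [delta / 2] keeps it in the small-Lipschitz range
   before [T0], and [gam] matches the slack below [B]. *)
set (kap := Rmin c (Rmin (delta / 2) gam)).
assert (Hkap : 0 < kap) by (unfold kap; repeat apply Rmin_pos; lra).
assert (Hk1 : kap <= c) by apply Rmin_l.
assert (Hk2 : kap <= delta / 2) by (eapply Rle_trans; [apply Rmin_r|apply Rmin_l]).
assert (Hk3 : kap <= gam) by (eapply Rle_trans; [apply Rmin_r|apply Rmin_r]).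
assert (HER : 0 < E * R0) by now apply Rmult_lt_0_compat.
(* The three terms ensure |mu'| <= |mu0| + 1, ratio at most 1/2 in the series, and deviation from
   the constant term at most [kap / 2]. *)
set (x1 := Rmin 1 (Rmin (/ (2 * R0)) (kap / (4 * (E * R0))))).
assert (Hx1 : 0 < x1).
{ unfold x1; repeat apply Rmin_pos; [lra|apply Rinv_0_lt_compat; lra|apply Rdiv_lt_0_compat; lra]. }
assert (Hx1a : x1 <= 1) by apply Rmin_l.
assert (Hx1b : R0 * x1 <= / 2).
{ apply (Rle_trans _ (R0 * / (2 * R0))); [|right; field; lra].
  apply Rmult_le_compat_l; [lra|eapply Rle_trans; [apply Rmin_r|apply Rmin_l]]. }
assert (Hx1c : 2 * (E * (R0 * x1)) <= kap / 2).
{ apply (Rle_trans _ (2 * (E * (R0 * (kap / (4 * (E * R0))))))); [|right; field; lra].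
  apply Rmult_le_compat_l; [lra|]; apply Rmult_le_compat_l; [lra|]; apply Rmult_le_compat_l; [lra|].
  eapply Rle_trans; [apply Rmin_r|apply Rmin_r]. }
set (aw := fun t n => match n with O => gam + Z mu0 t | _ => v n t end).
set (qw := fun t n => match n with O => pospow (gam + Z mu0 t) p | _ => Q n t end).
assert (Hbw : forall t n, t <= T -> (1 <= n)%nat -> Rabs (aw t n) <= E * R0 ^ n /\ Rabs (qw t n) <= E * R0 ^ n).
{ intros t [|n] Ht Hn; [lia|]; now apply Hb'. }
assert (HW : forall x t, Rabs x < x1 -> t <= T ->
  0 < PSeries (aw t) x /\ PSeries (qw t) x = pospow (PSeries (aw t) x) p).
{ intros x t Hx Ht.
  destruct (PSeries_Rpower (aw t) (qw t) p E R0 x1) with (x := x) as [A1 A2]; auto; try lra.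
  - simpl; auto.
  - simpl; apply pospow_pos_eq; auto.
  - intros n.
    rewrite (sum_f_R0_ends _ (fun i => (p * INR i - INR (S n - i)) * (v i t * Q (S n - i)%nat t))).
    + rewrite Nat.sub_0_r, Nat.sub_diag; destruct (H0 t) as (-> & _ & ->).
      unfold aw, qw; specialize (Hrec n t Ht); change (INR 0) with 0; lra.
    + intros i Hi; unfold aw, qw; destruct i as [|i]; [lia|].
      destruct (S n - S i)%nat as [|j] eqn:Ej; [lia|]; reflexivity.
  - simpl; generalize (Hcb t Ht); lra.
  - split; auto; now rewrite pospow_pos_eq. }
set (Lx := e0 + L + p * A + K).
assert (Hmain : forall mu' N, Rabs (mu' - mu0) < x1 -> (1 <= N)%nat ->
  Rabs (Z mu' T - Z mu0 T - sum_f_R0 (fun n => v n T * (mu' - mu0) ^ n) N) <= D * (Lx * kap) / 2 ^ N /\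
  Rabs (Z1 mu' T - Z1 mu0 T - sum_f_R0 (fun n => v1 n T * (mu' - mu0) ^ n) N) <= D * (Lx * kap) / 2 ^ N).
{ intros mu' N Hmu HN; set (x := mu' - mu0) in *.
  assert (Hmu1 : Rabs mu' <= Rabs mu0 + 1) by (apply Rabs_near_le; fold x; lra).
  set (sv := fun n t => match n with O => 0 | S n' =>
    p * A * v (S n') t - k t * Q (S n') t - match n' with O => g t | _ => 0 end end).
  assert (Hsv : forall n, solves a h T (v n) (v1 n) (sv n)).
  { intros [|n]; [|exact (Hs n)].
    intros t Ht; destruct (H0 t) as (E1 & E2 & _); split.
    - rewrite E2; apply (is_derive_ext (fun _ => 0)); [intros s; symmetry; apply (H0 s)|].
      apply (is_derive_const (V := R_NormedModule)).
    - rewrite E1, E2; simpl; replace (0 - a * 0 - h * 0) with 0 by ring.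
      apply (is_derive_ext (fun _ => 0)); [intros s; symmetry; apply (H0 s)|].
      apply (is_derive_const (V := R_NormedModule)). }
  assert (Hvpb : forall n, past_bounded (v n)).
  { intros [|n]; [exists 0, 0; intros t _; destruct (H0 t) as (-> & _); rewrite Rabs_R0; lra|].
    exists (E * R0 ^ S n), T; intros t Ht; apply Hb'; auto; lia. }
  assert (Hssum : forall t, sum_f_R0 (fun n => sv n t * x ^ n) N =
    p * A * sum_f_R0 (fun n => v n t * x ^ n) N - k t * sum_f_R0 (fun n => Q n t * x ^ n) N - g t * x).
  { intros t; destruct N as [|N]; [lia|]; clear HN; destruct (H0 t) as (E1 & _ & E2).
    induction N; [simpl; rewrite E1, E2; ring|].
    rewrite (tech5 (fun n => sv n t * x ^ n)), IHN, !(tech5 _ (S N)); simpl sv; ring. }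
  set (tail := kap / 2 ^ N).
  assert (H2N : 0 < 2 ^ N) by (apply pow_lt; lra).
  assert (Htail : 0 <= tail) by (unfold tail; apply Rdiv_le_0_compat; lra).
  assert (HLx : 0 <= Lx) by (unfold Lx; lra).
  replace (D * (Lx * kap) / 2 ^ N) with (D * (Lx * tail)) by (unfold tail; field; lra).
  set (e := fun t => Z mu' t - Z mu0 t - sum_f_R0 (fun n => v n t * x ^ n) N).
  set (H := fun t => F mu' t (Z mu' t) - F mu0 t (Z mu0 t) - sum_f_R0 (fun n => sv n t * x ^ n) N).
  assert (Hx2 : 2 * (E * (R0 * Rabs x)) <= kap).
  { assert (E * (R0 * Rabs x) <= E * (R0 * x1)).
    { apply Rmult_le_compat_l; [lra|]; apply Rmult_le_compat_l; lra. } lra. }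
  assert (Hx3 : R0 * Rabs x <= / 2).
  { apply (Rle_trans _ (R0 * x1)); auto; apply Rmult_le_compat_l; lra. }
  assert (Htl : forall t, t <= T ->
    Rabs (PSeries (aw t) x - (gam + Z mu0 t)) <= kap /\
    Rabs (PSeries (aw t) x - (gam + Z mu0 t) - sum_f_R0 (fun n => v n t * x ^ n) N) <= tail /\
    Rabs (PSeries (qw t) x - pospow (gam + Z mu0 t) p - sum_f_R0 (fun n => Q n t * x ^ n) N) <= tail).
  { intros t Ht; destruct (H0 t) as (E1 & _ & E2).
    destruct (pseries_geometric (aw t) E R0 x) as [_ A1]; auto; try lra.
    { intros n Hn; now apply Hbw. }
    destruct (pseries_geometric (qw t) E R0 x) as [_ A2]; auto; try lra.
    { intros n Hn; now apply Hbw. }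
    assert (Htl : 2 * (E * (R0 * Rabs x)) / 2 ^ N <= tail).
    { unfold tail, Rdiv; apply Rmult_le_compat_r; [left; now apply Rinv_0_lt_compat|auto]. }
    assert (B1 := A1 O); assert (B2 := A1 N); assert (B3 := A2 N).
    rewrite (sum_f_R0_head (fun n => aw t n * x ^ n) (fun n => v n t * x ^ n)) in B2
      by (auto; rewrite E1; ring).
    rewrite (sum_f_R0_head (fun n => qw t n * x ^ n) (fun n => Q n t * x ^ n)) in B3
      by (auto; rewrite E2; ring).
    simpl in B1, B2, B3; rewrite Rmult_1_r in B1, B2, B3.
    unfold Rdiv in B1; rewrite Rinv_1, Rmult_1_r in B1.
    rewrite Rabs_minus_sym in B1, B2, B3.
    split; [lra|split]; (eapply Rle_trans; [|apply Htl]);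
      [eapply Rle_trans; [|apply B2]|eapply Rle_trans; [|apply B3]]; right; f_equal; ring. }
  assert (Hgen : forall t cc, t <= T -> cc <= e0 + L ->
    (forall s, Rmin (PSeries (aw t) x - gam) (Z mu' t) <= s <= Rmax (PSeries (aw t) x - gam) (Z mu' t) ->
      Rabs (dF t s) <= cc) -> Rabs (H t) <= cc * Rabs (e t) + Lx * tail).
  { intros t cc Ht Hcc Hds.
    destruct (Htl t Ht) as (C1 & C2 & C3); destruct (HW x t Hmu Ht) as [W1 W2].
    destruct (F_diff mu0 mu0 t (Z mu' t) (PSeries (aw t) x - gam)) as [s [Hs' Es]]; fold (dF t s) in Es.
    specialize (Hds s Hs').
    set (V := PSeries (aw t) x - (gam + Z mu0 t) - sum_f_R0 (fun n => v n t * x ^ n) N) in *.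
    set (QV := PSeries (qw t) x - pospow (gam + Z mu0 t) p - sum_f_R0 (fun n => Q n t * x ^ n) N) in *.
    (* [V] and [QV] are the tails of the series for w and q. The mean value is taken between
       [Z mu' t] and the full series, not its partial sum, hence the correction [dF t s * V]. *)
    assert (EH : H t = dF t s * e t + (- (dF t s * V) + (p * A * V + - (k t * QV)))).
    { transitivity (F mu0 t (Z mu' t) - F mu0 t (PSeries (aw t) x - gam) + (p * A * V + - (k t * QV))).
      - unfold H; rewrite Hssum; unfold F, V, QV; rewrite W2.
        replace (gam + (PSeries (aw t) x - gam)) with (PSeries (aw t) x) by ring.
        assert (Emu : mu' * g t = mu0 * g t + x * g t) by (unfold x; ring); rewrite Emu; ring.
      - rewrite Es; unfold e, V; ring. }
    rewrite EH; eapply Rle_trans; [apply Rabs_triang|]; apply Rplus_le_compat.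
    { rewrite Rabs_mult; apply Rmult_le_compat_r; [apply Rabs_pos|auto]. }
    eapply Rle_trans; [apply Rabs_triang|]; rewrite Rabs_Ropp.
    eapply Rle_trans; [apply Rplus_le_compat_l, Rabs_triang|]; rewrite Rabs_Ropp.
    rewrite (Rabs_mult (dF t s)), (Rabs_mult (p * A)), (Rabs_mult (k t)), (Rabs_pos_eq (p * A)) by auto.
    assert (Rabs (dF t s) * Rabs V <= (e0 + L) * tail).
    { apply Rmult_le_compat; try apply Rabs_pos; [lra|auto]. }
    assert (p * A * Rabs V <= p * A * tail) by now apply Rmult_le_compat_l.
    assert (Rabs (k t) * Rabs QV <= K * tail) by (apply Rmult_le_compat; try apply Rabs_pos; auto).
    unfold Lx; lra. }
  apply (Hst (Lx * tail) e (fun t => Z1 mu' t - Z1 mu0 t - sum_f_R0 (fun n => v1 n t * x ^ n) N) H); auto; try lra.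
  - now apply Rmult_le_pos.
  - unfold e, H; apply solves_minus; [apply solves_minus; apply Z_solves|now apply solves_sum].
  - unfold e; apply past_bounded_minus; [apply past_bounded_minus; apply Z_past_bounded|now apply past_bounded_sum].
  - intros t Ht Ht0; apply Hgen; auto; [lra|]; intros s Hs'; apply H1; auto.
    destruct (Htl t Ht) as (C1 & _ & _).
    assert (E1 := H3 mu' t Hmu1 Ht0); assert (E2 := H3 mu0 t ltac:(lra) Ht0).
    apply Rabs_le_between in C1, E1, E2; apply Rabs_le.
    assert (- delta <= Rmin (PSeries (aw t) x - gam) (Z mu' t)) by (apply Rmin_glb; lra).
    assert (Rmax (PSeries (aw t) x - gam) (Z mu' t) <= delta) by (apply Rmax_lub; lra). lra.
  - intros t Ht Ht0; apply Hgen; auto; [lra|]; intros s Hs'; apply H2; auto.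
    destruct (Htl t Ht) as (C1 & _ & _).
    assert (E1 := H4 mu' t Hmu1 Ht); assert (E2 := H4 mu0 t ltac:(lra) Ht).
    apply Rabs_le_between in C1.
    assert (Rmax (PSeries (aw t) x - gam) (Z mu' t) <= B - gam) by (apply Rmax_lub; lra). lra. }
assert (Hfin : forall (U : R -> R) (w : nat -> R), w O = 0 ->
  (forall mu' N, Rabs (mu' - mu0) < x1 -> (1 <= N)%nat ->
    Rabs (U mu' - U mu0 - sum_f_R0 (fun n => w n * (mu' - mu0) ^ n) N) <= D * (Lx * kap) / 2 ^ N) ->
  analytic_at U mu0).
{ intros U w Hw0 HU; exists (fun n => match n with O => U mu0 | _ => w n end), x1; split; auto.
  intros mu' Hmu; apply (is_pseries_of_partial_sums _ _ _ (D * (Lx * kap))); intros N HN.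
  rewrite (sum_f_R0_head _ (fun n => w n * (mu' - mu0) ^ n)); [|rewrite Hw0; ring|reflexivity].
  simpl (_ ^ 0); rewrite Rmult_1_r.
  replace (U mu' - (U mu0 + sum_f_R0 (fun n => w n * (mu' - mu0) ^ n) N)) with
    (U mu' - U mu0 - sum_f_R0 (fun n => w n * (mu' - mu0) ^ n) N) by ring.
  now apply HU. }
destruct (H0 T) as (E1 & E2 & _).
split.
- apply (Hfin (fun mu => Z mu T) (fun n => v n T)); auto; intros; now apply Hmain.
- apply (Hfin (fun mu => Z1 mu T) (fun n => v1 n T)); auto; intros; now apply Hmain.
Qed.

End Dependence.

Lemma singular_family : exists Z Z1 Y : R -> R -> R,
  (forall mu, singular mu (Z mu) (Z1 mu)) /\
  (forall mu t, is_derive (fun m => Z m t) mu (Y mu t)) /\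
  (forall mu t eps, 0 < eps -> exists d, 0 < d /\
    forall mu' s, Rabs (mu' - mu) < d -> Rabs (s - t) < d ->
    Rabs (Y mu' s - Y mu t) < eps /\ Rabs (Z mu' s - Z mu t) < eps /\ Rabs (Z1 mu' s - Z1 mu t) < eps) /\
  (forall mu T, (forall t, t <= T -> 0 < gam + Z mu t) ->
    (exists d, 0 < d /\ forall mu', Rabs (mu' - mu) < d -> forall t, t <= T -> 0 < gam + Z mu' t) /\
    analytic_at (fun mu => Z mu T) mu /\ analytic_at (fun mu => Z1 mu T) mu).
Proof.
destruct calm_exists as [delta [T1 [Hd [Hcalm _]]]].
destruct (functional_choice (fun mu (z : (R -> R) * (R -> R)) => singular mu (fst z) (snd z))) as [ZZ HZZ].
{ intros mu; destruct (singular_exists delta T1 (Rabs mu) Hd Hcalm (Rabs_pos mu)) as (T0 & M & _ & _ & H).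
  destruct (H mu (Rle_refl _)) as (z & z1 & Hz & _); now exists (z, z1). }
set (Z := fun mu => fst (ZZ mu)); set (Z1 := fun mu => snd (ZZ mu)).
change (forall mu, singular mu (Z mu) (Z1 mu)) in HZZ.
destruct (functional_choice (fun mu (y : (R -> R) * (R -> R)) =>
  (forall T, solves a h T (fst y) (snd y) (fun t => dF t (Z mu t) * fst y t + - g t)) /\
  past_bounded (fst y))) as [YY HYY].
{ intros mu; destruct (variation_exists Z Z1 HZZ mu) as (y & y1 & Hy); now exists (y, y1). }
set (Y := fun mu => fst (YY mu)); set (Y1 := fun mu => snd (YY mu)).
exists Z, Z1, Y; repeat match goal with |- _ /\ _ => split end; auto.
- intros mu t; apply (is_derive_Z_param Z Z1 HZZ Y Y1 HYY).
- intros mu t eps He.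
  destruct (Y_jointly_continuous Z Z1 HZZ Y Y1 HYY mu t eps He) as [d [Hd1 H1]].
  destruct (Z_jointly_continuous Z Z1 HZZ mu t eps He) as [d' [Hd2 H2]].
  exists (Rmin d d'); split; [now apply Rmin_pos|]; intros mu' s Hmu Hs.
  assert (E1 := Rmin_l d d'); assert (E2 := Rmin_r d d').
  split; [apply H1; lra|apply H2; lra].
- intros mu T Hpos; split; [exact (positive_open Z Z1 HZZ mu T Hpos)|exact (Z_analytic Z Z1 HZZ mu T Hpos)].
Qed.

End Family.

(** * Back to the radial variable *)

Lemma pospow_mult_Rpower (x y p s : R) : 0 < y -> pospow (Rpower y s * x) p = Rpower y (s * p) * pospow x p.
Proof.
intros Hy.
assert (Hs : 0 < Rpower y s) by apply exp_pos.
destruct (Rle_lt_dec x 0) as [Hx|Hx].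
- rewrite !pospow_nonpos; [ring|auto|nra].
- rewrite !pospow_pos_eq; auto; [|nra].
  rewrite <- Rpower_mult_distr, Rpower_mult; auto.
Qed.

Lemma Rpower_exp_l (t s : R) : Rpower (exp t) s = exp (s * t).
Proof. unfold Rpower; now rewrite ln_exp. Qed.

Lemma is_derive_power_log (e r : R) (w : R -> R) (l : R) : 0 < r -> is_derive w (ln r) l ->
  is_derive (fun r => Rpower r e * w (ln r)) r (Rpower r (e - 1) * (l + e * w (ln r))).
Proof.
intros Hr Hw.
assert (D1 : is_derive (fun r => Rpower r e) r (e * Rpower r (e - 1))).
{ apply is_derive_Reals; now apply derivable_pt_lim_power. }
assert (D2 : is_derive ln r (/ r)) by (apply is_derive_Reals; now apply derivable_pt_lim_ln).
assert (D3 := is_derive_comp w ln r _ _ Hw D2).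
eapply is_derive_eq; [exact (is_derive_mult (K := R_AbsRing) _ _ r _ _ D1 D3 Rmult_comm)|].
unfold scal, plus, mult; simpl; unfold mult; simpl.
assert (E : Rpower r e = r * Rpower r (e - 1)).
{ rewrite <- (Rpower_1 r) at 2 by auto; rewrite <- Rpower_plus; f_equal; ring. }
rewrite E; field; lra.
Qed.

Lemma is_derive_exp_comp (th t : R) (v : R -> R) (l : R) : is_derive v (exp t) l ->
  is_derive (fun t => exp (th * t) * v (exp t)) t (exp (th * t) * (th * v (exp t) + exp t * l)).
Proof.
intros Hv.
assert (D1 : is_derive (fun t => exp (th * t)) t (th * exp (th * t))) by (auto_derive; [auto|ring]).
assert (D2 : is_derive exp t (exp t)) by (apply is_derive_Reals, derivable_pt_lim_exp).
assert (D3 := is_derive_comp v exp t _ _ Hv D2).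
eapply is_derive_eq; [exact (is_derive_mult (K := R_AbsRing) _ _ t _ _ D1 D3 Rmult_comm)|].
unfold scal, plus, mult; simpl; unfold mult; simpl; ring.
Qed.

Lemma at_right_exp (P : R -> Prop) : at_right 0 P -> exists T, forall t, t <= T -> P (exp t).
Proof.
intros [[d Hd] H]; destruct (exp_neg_lt 1 (d / 2)) as [T HT]; [lra|lra|].
exists T; intros t Ht; specialize (HT t Ht); rewrite Rmult_1_l in HT.
assert (He := exp_pos t); apply H; auto; simpl.
unfold ball; simpl; unfold AbsRing_ball, abs, minus, plus, opp; simpl.
rewrite Ropp_0, Rplus_0_r, Rabs_pos_eq; lra.
Qed.

Lemma at_right_ln (P : R -> Prop) (T : R) : (forall t, t <= T -> P (exp t)) -> at_right 0 P.
Proof.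
intros H; exists (mkposreal (exp T) (exp_pos T)); intros r Hr Hr0; simpl in Hr.
unfold ball in Hr; simpl in Hr; unfold AbsRing_ball, abs, minus, plus, opp in Hr; simpl in Hr.
rewrite Ropp_0, Rplus_0_r, Rabs_pos_eq in Hr by lra.
rewrite <- (exp_ln r) by auto; apply H.
rewrite <- (ln_exp T); left; now apply ln_increasing.
Qed.

Lemma filterlim_at_right_tends_past (u : R -> R) (l : R) :
  filterlim u (at_right 0) (locally l) <-> tends_past (fun t => u (exp t)) l.
Proof.
split.
- intros H eps He; apply filterlim_locally with (eps := mkposreal eps He) in H.
  destruct (at_right_exp _ H) as [T HT]; exists T; intros t Ht; left; exact (HT t Ht).
- intros H; apply filterlim_locally; intros [eps He].
  destruct (H (eps / 2) ltac:(lra)) as [T HT].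
  apply (at_right_ln _ T); intros t Ht.
  change (Rabs (u (exp t) - l) < eps); generalize (HT t Ht); lra.
Qed.

Lemma continuous_exp (t : R) : continuous exp t.
Proof. apply (is_derive_continuous _ _ (exp t)), is_derive_Reals, derivable_pt_lim_exp. Qed.

Lemma continuous_ln (r : R) : 0 < r -> continuous ln r.
Proof. intros Hr; apply (is_derive_continuous _ _ (/ r)), is_derive_Reals; now apply derivable_pt_lim_ln. Qed.

Lemma continuous_Rpower_l (s r : R) : 0 < r -> continuous (fun r => Rpower r s) r.
Proof.
intros Hr; apply (is_derive_continuous _ _ (s * Rpower r (s - 1))), is_derive_Reals.
now apply derivable_pt_lim_power.
Qed.

Lemma continuous_jointly_log (V : R -> R -> R) (mu r : R) : 0 < r ->
  (forall eps, 0 < eps -> exists d, 0 < d /\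
    forall mu' s, Rabs (mu' - mu) < d -> Rabs (s - ln r) < d -> Rabs (V mu' s - V mu (ln r)) < eps) ->
  continuous (fun x : R * R => V (fst x) (ln (snd x))) (mu, r).
Proof.
intros Hr H; apply filterlim_locally; intros [eps He].
destruct (H eps He) as [d [Hd HV]].
destruct (continuous_eps_elim ln r (continuous_ln r Hr) d Hd) as [d' [Hd' Hln]].
exists (mkposreal _ (Rmin_pos _ _ Hd Hd')); intros [mu' s] [H1 H2]; simpl in H1, H2.
change (Rabs (mu' - mu) < Rmin d d') in H1; change (Rabs (s - r) < Rmin d d') in H2.
assert (E1 := Rmin_l d d'); assert (E2 := Rmin_r d d').
change (Rabs (V mu' (ln s) - V mu (ln r)) < eps); apply HV; [lra|apply Hln; lra].
Qed.

Lemma analytic_at_lin (f g : R -> R) (c0 c1 c2 x : R) : analytic_at f x -> analytic_at g x ->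
  analytic_at (fun y => c1 * f y + c2 * g y + c0) x.
Proof.
intros [a [d [Hd Ha]]] [b [d' [Hd' Hb]]].
exists (PS_plus (PS_plus (PS_scal c1 a) (PS_scal c2 b)) (fun n => match n with O => c0 | _ => 0 end)), (Rmin d d').
split; [now apply Rmin_pos|]; intros y Hy.
assert (E1 := Rmin_l d d'); assert (E2 := Rmin_r d d').
specialize (Ha y ltac:(lra)); specialize (Hb y ltac:(lra)).
apply (is_pseries_plus (V := R_NormedModule)); [apply (is_pseries_plus (V := R_NormedModule))|].
- apply (is_pseries_scal (V := R_NormedModule)); [apply Rmult_comm|exact Ha].
- apply (is_pseries_scal (V := R_NormedModule)); [apply Rmult_comm|exact Hb].
- apply (is_pseries_of_partial_sums _ _ _ 0); intros N _.
  rewrite (sum_f_R0_head _ (fun _ => 0)); [|reflexivity|intros; ring].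
  rewrite sum_cte; simpl; unfold Rdiv.
  replace (c0 - (c0 * 1 + 0 * _)) with 0 by ring; rewrite Rabs_R0; lra.
Qed.

Lemma analytic_at_ext (f g : R -> R) (x : R) : (forall y, f y = g y) -> analytic_at f x -> analytic_at g x.
Proof. intros E [a [d [Hd H]]]; exists a, d; split; auto; intros y Hy; rewrite <- E; auto. Qed.

(** * The change of variables between r and t = ln r *)

Section LogarithmicVariable.

Variables (n th alpha p gam mu : R) (K f : R -> R).
Hypothesis Halpha : th * (p - 1) = 2 + alpha.
Let k (t : R) : R := K (exp t) / Rpower (exp t) alpha.
Let g (t : R) : R := Rpower (exp t) (th + 2) * f (exp t).
Let b := n - 2 - th.
Let a := b - th.
Let h := (p - 1) * (th * b).

(** Since theta (p - 1) = 2 + alpha, multiplication by r^(theta + 2) turns K u_+^p into k w_+^p with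
    w = r^theta u, and f into g. *)
Lemma singular_of_radial (u : R -> R) : C2_pos u ->
  (forall r, 0 < r -> Derive_n u 2 r + (n - 1) / r * Derive u r + K r * pospow (u r) p + mu * f r = 0) ->
  filterlim (fun r => Rpower r th * u r) (at_right 0) (locally gam) ->
  exists z1, singular th b p gam k g mu (fun t => exp (th * t) * u (exp t) - gam) z1.
Proof.
intros HC Hode Hlim.
set (w := fun t => exp (th * t) * u (exp t)).
set (w1 := fun t => exp (th * t) * (th * u (exp t) + exp t * Derive u (exp t))).
exists w1; split.
- intros T t _; destruct (HC (exp t) (exp_pos t)) as [D1 [D2 _]].
  assert (H1 := is_derive_exp_comp th t u _ (Derive_correct _ _ D1)).
  assert (H2 := is_derive_exp_comp (th + 1) t (Derive u) _ (Derive_correct _ _ D2)).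
  assert (Hw1 : forall s, w1 s = th * w s + exp ((th + 1) * s) * Derive u (exp s)).
  { intros s; unfold w1, w; rewrite Rmult_plus_distr_r, exp_plus, Rmult_1_l; ring. }
  split.
  + eapply is_derive_eq; [apply is_derive_sub; [exact H1|apply (is_derive_const (V := R_NormedModule))]|].
    unfold w1; apply Rminus_0_r.
  + apply (is_derive_ext (fun s => th * w s + exp ((th + 1) * s) * Derive u (exp s))).
    { intros s; symmetry; apply Hw1. }
    eapply is_derive_eq.
    { apply is_derive_add; [exact (is_derive_scal w t th _ H1)|exact H2]. }
    assert (Ho := Hode (exp t) (exp_pos t)); change (Derive_n u 2 (exp t)) with (Derive (Derive u) (exp t)) in Ho.
    set (E := exp t) in *; set (X := exp (th * t)) in *.
    assert (HE : 0 < E) by apply exp_pos.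
    set (u0 := u E) in *; set (u1 := Derive u E) in *; set (u2 := Derive (Derive u) E) in *.
    assert (HX1 : exp ((th + 1) * t) = X * E) by (unfold X, E; rewrite <- exp_plus; f_equal; ring).
    assert (Hk : k t * pospow (gam + (X * u0 - gam)) p = X * E * E * (K E * pospow u0 p)).
    { replace (gam + (X * u0 - gam)) with (Rpower E th * u0) by (unfold X, E; rewrite Rpower_exp_l; ring).
      rewrite pospow_mult_Rpower by auto; unfold k; fold E.
      unfold Rdiv; rewrite <- Rpower_Ropp.
      replace (X * E * E) with (Rpower E (th + 2)).
      - replace (th + 2) with (- alpha + th * p) by lra; rewrite Rpower_plus; ring.
      - unfold E, X; rewrite Rpower_exp_l, <- !exp_plus; f_equal; ring. }
    assert (Hg : g t = X * E * E * f E).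
    { unfold g; fold E; f_equal; unfold E, X; rewrite Rpower_exp_l, <- !exp_plus; f_equal; ring. }
    assert (Hu2 : E * E * u2 = - ((n - 1) * E * u1 + E * E * (K E * pospow u0 p) + mu * (E * E * f E))).
    { replace u2 with (- ((n - 1) / E * u1 + K E * pospow u0 p + mu * f E)) by lra; field; lra. }
    unfold F; rewrite HX1, Hk, Hg; unfold w1; fold E X u0 u1.
    unfold scal; simpl; unfold mult; simpl.
    replace (X * E * ((th + 1) * u1 + E * u2)) with (X * ((th + 1) * E * u1 + E * E * u2)) by ring.
    rewrite Hu2; unfold a, b; ring.
- apply filterlim_at_right_tends_past in Hlim; intros eps He; destruct (Hlim eps He) as [T HT].
  exists T; intros t Ht; specialize (HT t Ht); rewrite Rpower_exp_l in HT.
  now rewrite Rminus_0_r.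
Qed.

(** The inverse substitution; continuity of u'' is read off the equation for z, which expresses z''
    through continuous functions of t. *)
Lemma radial_of_singular (z z1 : R -> R) :
  (forall r, 0 < r -> continuous K r) -> (forall r, 0 < r -> continuous f r) -> 1 < p ->
  singular th b p gam k g mu z z1 ->
  let u r := Rpower r (- th) * (gam + z (ln r)) in
  C2_pos u /\
  (forall r, 0 < r -> Derive u r = Rpower r (- th - 1) * (z1 (ln r) - th * (gam + z (ln r)))) /\
  (forall r, 0 < r -> Derive_n u 2 r + (n - 1) / r * Derive u r + K r * pospow (u r) p + mu * f r = 0) /\
  filterlim (fun r => Rpower r th * u r) (at_right 0) (locally gam).
Proof.
intros HK Hf Hp [Hz Hz0] u.
assert (Dz : forall t, is_derive z t (z1 t)) by (intros t; apply (Hz t t (Rle_refl t))).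
set (z2 := fun t => F th b p gam k g mu t (z t) - a * z1 t - h * z t).
assert (Dz1 : forall t, is_derive z1 t (z2 t)) by (intros t; apply (Hz t t (Rle_refl t))).
assert (Dw : forall t, is_derive (fun t => gam + z t) t (z1 t)).
{ intros t; eapply is_derive_eq; [apply is_derive_add; [apply (is_derive_const (V := R_NormedModule))|apply Dz]|].
  apply Rplus_0_l. }
set (u1 := fun r => Rpower r (- th - 1) * (z1 (ln r) - th * (gam + z (ln r)))).
assert (Du : forall r, 0 < r -> is_derive u r (u1 r)).
{ intros r Hr; eapply is_derive_eq; [exact (is_derive_power_log (- th) r (fun t => gam + z t) _ Hr (Dw (ln r)))|].
  unfold u1; ring. }
set (u2 := fun r => Rpower r (- th - 2) *
  (z2 (ln r) - (2 * th + 1) * z1 (ln r) + th * (th + 1) * (gam + z (ln r)))).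
assert (Du1 : forall r, 0 < r -> is_derive u1 r (u2 r)).
{ intros r Hr.
  assert (D : is_derive (fun t => z1 t - th * (gam + z t)) (ln r) (z2 (ln r) - th * z1 (ln r))).
  { apply is_derive_sub; [apply Dz1|]; exact (is_derive_scal (fun t => gam + z t) (ln r) th _ (Dw (ln r))). }
  eapply is_derive_eq; [exact (is_derive_power_log (- th - 1) r (fun t => z1 t - th * (gam + z t)) _ Hr D)|].
  unfold u2; replace (- th - 1 - 1) with (- th - 2) by ring; ring. }
assert (Hloc : forall r, 0 < r -> locally r (fun s => u1 s = Derive u s)).
{ intros r Hr; apply (filter_imp (fun s => 0 < s)); [|now apply locally_gt].
  intros s Hs; symmetry; apply is_derive_unique, Du, Hs. }
assert (Du1' : forall r, 0 < r -> is_derive (Derive u) r (u2 r)).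
{ intros r Hr; apply (is_derive_ext_loc u1); auto. }
assert (Hd2 : forall r, 0 < r -> Derive_n u 2 r = u2 r).
{ intros r Hr; change (Derive_n u 2 r) with (Derive (Derive u) r); apply is_derive_unique; auto. }
assert (kc : forall t, continuous k t).
{ intros t; unfold k, Rdiv; apply continuous_mul.
  - apply (continuous_comp exp K); [apply continuous_exp|apply HK, exp_pos].
  - apply (continuous_comp exp (fun r => / Rpower r alpha)); [apply continuous_exp|].
    apply (continuous_ext (fun r => Rpower r (- alpha))); [intros; apply Rpower_Ropp|].
    apply continuous_Rpower_l, exp_pos. }
assert (gc : forall t, continuous g t).
{ intros t; unfold g; apply (continuous_comp exp (fun r => Rpower r (th + 2) * f r)); [apply continuous_exp|].
  apply continuous_mul; [apply continuous_Rpower_l, exp_pos|apply Hf, exp_pos]. }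
assert (zc : forall t, continuous z t) by (intros t; exact (is_derive_continuous _ _ _ (Dz t))).
assert (z1c : forall t, continuous z1 t) by (intros t; exact (is_derive_continuous _ _ _ (Dz1 t))).
assert (z2c : forall t, continuous z2 t).
{ intros t; unfold z2; apply continuous_sub; [apply continuous_sub|].
  - now apply F_continuous.
  - apply continuous_mul; [apply continuous_cst|auto].
  - apply continuous_mul; [apply continuous_cst|auto]. }
repeat match goal with |- _ /\ _ => split end.
- intros r Hr; split; [exists (u1 r); auto|split; [exists (u2 r); auto|]].
  apply (continuous_ext_loc _ u2).
  { apply (filter_imp (fun s => 0 < s)); [|now apply locally_gt].
    intros s Hs; symmetry; now apply Hd2. }
  unfold u2; apply continuous_mul; [now apply continuous_Rpower_l|].
  apply (continuous_comp ln (fun t => z2 t - (2 * th + 1) * z1 t + th * (th + 1) * (gam + z t))).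
  + now apply continuous_ln.
  + apply continuous_add; [apply continuous_sub; [auto|]|]; apply continuous_mul; auto; try apply continuous_cst.
    apply continuous_add; [apply continuous_cst|auto].
- intros r Hr; now apply is_derive_unique, Du.
- intros r Hr; rewrite Hd2, (is_derive_unique _ _ _ (Du r Hr)) by auto.
  assert (El : exp (ln r) = r) by now apply exp_ln.
  set (P := Rpower r (- th - 2)).
  assert (HP1 : Rpower r (- th - 1) = P * r).
  { unfold P; rewrite <- (Rpower_1 r) at 3 by auto; rewrite <- Rpower_plus; f_equal; ring. }
  assert (Hku : K r * pospow (u r) p = P * (k (ln r) * pospow (gam + z (ln r)) p)).
  { unfold u; rewrite pospow_mult_Rpower by auto; unfold k; rewrite El; unfold Rdiv; rewrite <- Rpower_Ropp.
    replace (- th * p) with ((- th - 2) + - alpha) by lra; rewrite Rpower_plus; fold P; ring. }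
  assert (Hgf : f r = P * g (ln r)).
  { unfold g; rewrite El, <- Rmult_assoc; unfold P; rewrite <- Rpower_plus.
    replace (- th - 2 + (th + 2)) with 0 by ring; rewrite Rpower_O by auto; ring. }
  rewrite Hku, Hgf; unfold u1, u2; fold P; rewrite HP1; unfold z2, F, h, a, b; field; lra.
- apply filterlim_at_right_tends_past; intros eps He; destruct (Hz0 eps He) as [T HT].
  exists T; intros t Ht; specialize (HT t Ht); rewrite Rminus_0_r in HT.
  unfold u; rewrite ln_exp, <- Rmult_assoc, <- Rpower_plus, Rplus_opp_r, Rpower_O, Rmult_1_l by apply exp_pos.
  now replace (gam + z t - gam) with (z t) by ring.
Qed.

End LogarithmicVariable.

(** Multiplied by p - 1, theta < N - 2 - theta reads 2 (2 + alpha) < (N - 2) (p - 1), which is p >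
    p_S; and p_S > 1 because alpha > -2. *)
Lemma supercritical_exponents (N : nat) (alpha p : R) :
  (3 <= N)%nat -> alpha > -2 -> p > pS N alpha ->
  1 < p /\ 0 < theta_of alpha p /\ theta_of alpha p < INR N - 2 - theta_of alpha p /\
  theta_of alpha p * (p - 1) = 2 + alpha.
Proof.
intros HN Ha Hp.
apply le_INR in HN; simpl in HN.
assert (Hp1 : (INR N + 2 + 2 * alpha) < p * (INR N - 2)).
{ unfold pS in Hp; apply (Rmult_lt_compat_r (INR N - 2)) in Hp; [|lra].
  replace ((INR N + 2 + 2 * alpha) / (INR N - 2) * (INR N - 2)) with (INR N + 2 + 2 * alpha) in Hp by (field; lra).
  exact Hp. }
assert (H1 : 1 < p) by nra.
unfold theta_of; repeat split; auto.
- apply Rdiv_lt_0_compat; lra.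
- apply (Rmult_lt_reg_r (p - 1)); [lra|].
  replace ((INR N - 2 - (2 + alpha) / (p - 1)) * (p - 1)) with ((INR N - 2) * (p - 1) - (2 + alpha)) by (field; lra).
  replace ((2 + alpha) / (p - 1) * (p - 1)) with (2 + alpha) by (field; lra); lra.
- field; lra.
Qed.

(** The identity says that gamma r^(-theta) is an explicit singular solution when K = k0 r^alpha and
    mu = 0. *)
Lemma gamma_balance (N : nat) (k0 alpha p : R) : 0 < k0 -> 1 < p ->
  0 < theta_of alpha p * (INR N - 2 - theta_of alpha p) ->
  0 < gamma_of N k0 alpha p /\
  k0 * pospow (gamma_of N k0 alpha p) (p - 1) = theta_of alpha p * (INR N - 2 - theta_of alpha p).
Proof.
intros Hk Hp HA.
assert (Hg : 0 < gamma_of N k0 alpha p) by (apply Rmult_lt_0_compat; apply exp_pos).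
split; auto; rewrite pospow_pos_eq by auto; unfold gamma_of.
rewrite <- Rpower_mult_distr, !Rpower_mult by apply exp_pos.
replace (- (1 / (p - 1)) * (p - 1)) with (- (1)) by (field; lra).
replace (1 / (p - 1) * (p - 1)) with 1 by (field; lra).
rewrite Rpower_Ropp, !Rpower_1 by auto; field; lra.
Qed.

Theorem theorem3p3 (N : nat) (K f : R -> R) (alpha k0 nu p : R) :
  (3 <= N)%nat ->
  hyp_K0 K alpha k0 ->
  hyp_F0 f nu ->
  p > pS N alpha ->
  exists U : R -> R -> R,
    (forall mu, is_singular_solution N K f k0 alpha p mu (U mu)) /\
    (forall mu v, is_singular_solution N K f k0 alpha p mu v ->
       forall r, 0 < r -> v r = U mu r) /\
    C1_param U /\
    (forall r, 0 < r ->
       open_subset (Pset U r) /\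
       forall C, is_component (Pset U r) C ->
         analytic_on C (fun mu => U mu r) /\
         analytic_on C (fun mu => Derive (U mu) r)).
Proof.
intros HN (Halpha & Hk0 & HKc & HKp & HKl) (Hnu & Hfc & _ & _ & C & delta & Hdelta & HfO) Hp.
destruct (supercritical_exponents N alpha p HN Halpha Hp) as (Hp1 & Hth & Hthb & Hthp).
set (th := theta_of alpha p) in *; set (b := INR N - 2 - th) in *.
destruct (gamma_balance N k0 alpha p Hk0 Hp1) as (Hgam & Hbal); [apply Rmult_lt_0_compat; fold th b; lra|].
fold th b in Hbal; set (gam := gamma_of N k0 alpha p) in *.
set (k := fun t => K (exp t) / Rpower (exp t) alpha).
set (g := fun t => Rpower (exp t) (th + 2) * f (exp t)).
assert (kc : forall t, continuous k t).
{ intros t; apply (continuous_comp exp (fun r => K r / Rpower r alpha)); [apply continuous_exp|].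
  apply (continuous_ext (fun r => K r * Rpower r (- alpha))); [intros; now rewrite Rpower_Ropp|].
  apply continuous_mul; [apply HKc, exp_pos|apply continuous_Rpower_l, exp_pos]. }
assert (gc : forall t, continuous g t).
{ intros t; apply (continuous_comp exp (fun r => Rpower r (th + 2) * f r)); [apply continuous_exp|].
  apply continuous_mul; [apply continuous_Rpower_l, exp_pos|apply Hfc, exp_pos]. }
assert (kp : forall t, 0 <= k t).
{ intros t; left; apply Rdiv_lt_0_compat; [apply HKp, exp_pos|apply exp_pos]. }
assert (kl : tends_past k k0) by now apply filterlim_at_right_tends_past in HKl.
assert (gl : tends_past g 0).
(* g = r^(theta + 2) f is O(r^(theta + 2 + nu)), with positive exponent because theta > 0 and nu >
   -2. *)
{ intros eps He; destruct (exp_neg_lt (th + 2 + nu) (eps / (Rabs C + 1))) as [T HT]; [lra| |].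
  { apply Rdiv_lt_0_compat; [lra|generalize (Rabs_pos C); lra]. }
  exists (Rmin T (ln (delta / 2))); intros t Ht; rewrite Rminus_0_r.
  assert (Ht1 : t <= T) by (eapply Rle_trans; [apply Ht|apply Rmin_l]).
  assert (Ht2 : exp t < delta).
  { apply (Rle_lt_trans _ (exp (ln (delta / 2)))); [apply exp_le; eapply Rle_trans; [apply Ht|apply Rmin_r]|].
    rewrite exp_ln; lra. }
  unfold g; rewrite Rabs_mult, Rabs_pos_eq by (left; apply exp_pos).
  specialize (HfO (exp t) (conj (exp_pos t) Ht2)); specialize (HT t Ht1).
  rewrite Rpower_exp_l in HfO |- *.
  assert (HC := Rle_abs C); assert (HC' := Rabs_pos C).
  apply (Rle_trans _ ((Rabs C + 1) * (eps / (Rabs C + 1)))); [|right; field; lra].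
  apply (Rle_trans _ (exp ((th + 2) * t) * (C * exp (nu * t)))).
  { apply Rmult_le_compat_l; [left; apply exp_pos|exact HfO]. }
  replace ((th + 2 + nu) * t) with ((th + 2) * t + nu * t) in HT by ring; rewrite exp_plus in HT.
  apply (Rle_trans _ (C * (exp ((th + 2) * t) * exp (nu * t)))); [right; ring|].
  assert (0 < exp ((th + 2) * t) * exp (nu * t)) by (apply Rmult_lt_0_compat; apply exp_pos).
  apply (Rle_trans _ ((Rabs C + 1) * (exp ((th + 2) * t) * exp (nu * t)))); [apply Rmult_le_compat_r|apply Rmult_le_compat_l]; lra. }
assert (Ha : 0 < b - th) by lra.
assert (Hh : 0 < (p - 1) * (th * b)).
{ apply Rmult_lt_0_compat; [lra|apply Rmult_lt_0_compat; lra]. }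
destruct (oscillator_theory (b - th) ((p - 1) * (th * b)) Ha Hh) as (e0 & D0 & He0 & HD0 & S1 & S2 & S3).
destruct (singular_family th b p k0 gam k g Hth Hthb Hp1 Hk0 Hgam Hbal kc gc kp kl gl e0 D0 He0 HD0 S1 S2 S3)
  as (Z & Z1 & Y & HZ & HY & Hj & Hpos).
assert (Huniq := singular_unique th b p k0 gam k g Hth Hthb Hp1 Hk0 Hgam Hbal kc kl e0 He0 S2).
set (U := fun mu r => Rpower r (- th) * (gam + Z mu (ln r))).
assert (HU := fun mu => radial_of_singular (INR N) th alpha p gam mu K f Hthp (Z mu) (Z1 mu) HKc Hfc Hp1 (HZ mu)).
assert (HUD : forall mu r, is_derive (fun m => U m r) mu (Rpower r (- th) * Y mu (ln r))).
{ intros mu r.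
  apply (is_derive_scal (fun m => gam + Z m (ln r)) mu (Rpower r (- th)) (Y mu (ln r))).
  eapply is_derive_eq; [apply is_derive_add; [apply (is_derive_const (V := R_NormedModule))|apply HY]|].
  apply Rplus_0_l. }
assert (HPset : forall r mu, 0 < r -> Pset U r mu <-> forall t, t <= ln r -> 0 < gam + Z mu t).
{ intros r mu Hr; split.
  - intros H t Ht; assert (Hrho : 0 < exp t <= r).
    { split; [apply exp_pos|]; rewrite <- (exp_ln r) by auto; now apply exp_le. }
    specialize (H (exp t) Hrho); unfold U in H; rewrite ln_exp in H.
    assert (Hq : 0 < Rpower (exp t) (- th)) by apply exp_pos.
    apply (Rmult_lt_reg_l (Rpower (exp t) (- th))); auto; now rewrite Rmult_0_r.
  - intros H rho [Hrho Hrr]; apply Rmult_lt_0_compat; [apply exp_pos|apply H].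
    destruct Hrr as [Hl| ->]; [left; now apply ln_increasing|right; reflexivity]. }
exists U; split; [|split; [|split]].
- intros mu; destruct (HU mu) as (U1 & _ & U2 & U3); split; [exact U1|split; [exact U2|exact U3]].
- intros mu v (V1 & V2 & V3) r Hr.
  destruct (singular_of_radial (INR N) th alpha p gam mu K f Hthp v V1 V2 V3) as [z1 Hz].
  destruct (Huniq mu _ _ _ _ Hz (HZ mu) (ln r)) as [E _].
  rewrite exp_ln in E by auto; unfold U; rewrite <- E.
  replace (gam + (exp (th * ln r) * v r - gam)) with (Rpower r th * v r) by (unfold Rpower; ring).
  rewrite <- Rmult_assoc, <- Rpower_plus, Rplus_opp_l, Rpower_O by auto; ring.
- intros mu r Hr; destruct (HU mu) as (U1 & _ & _ & _).
  split; [now exists (Rpower r (- th) * Y mu (ln r))|].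
  split; [apply U1; auto|split].
  + apply (continuous_ext (fun x : R * R => Rpower (snd x) (- th) * Y (fst x) (ln (snd x)))).
    { intros x; symmetry; apply is_derive_unique, HUD. }
    apply (continuous_mult (K := R_AbsRing) (fun x : R * R => Rpower (snd x) (- th))).
    * apply (continuous_comp snd (fun r => Rpower r (- th))); [apply continuous_snd|now apply continuous_Rpower_l].
    * apply continuous_jointly_log; auto; intros eps He; destruct (Hj mu (ln r) eps He) as [d [Hd H]].
      exists d; split; auto; intros; now apply H.
  + apply (continuous_ext_loc _ (fun x : R * R => Rpower (snd x) (- th - 1) *
      (Z1 (fst x) (ln (snd x)) - th * (gam + Z (fst x) (ln (snd x)))))).
    (* The formula for the derivative in r holds at positive radii; the ball of radius [r] about [r]
       contains no others. *)
    { exists (mkposreal r Hr); intros [m s] [_ Hs]; simpl in Hs |- *.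
      change (Rabs (s - r) < r) in Hs; apply Rabs_def2 in Hs.
      destruct (HU m) as (_ & UD & _); symmetry; apply UD; lra. }
    apply (continuous_mult (K := R_AbsRing) (fun x : R * R => Rpower (snd x) (- th - 1))).
    * apply (continuous_comp snd (fun r => Rpower r (- th - 1))); [apply continuous_snd|now apply continuous_Rpower_l].
    * apply (continuous_minus (V := R_NormedModule) (fun x : R * R => Z1 (fst x) (ln (snd x)))).
      -- apply continuous_jointly_log; auto; intros eps He; destruct (Hj mu (ln r) eps He) as [d [Hd H]].
         exists d; split; auto; intros; now apply H.
      -- apply (continuous_mult (K := R_AbsRing) (fun _ : R * R => th)); [apply continuous_const|].
         apply (continuous_plus (V := R_NormedModule) (fun _ : R * R => gam)); [apply continuous_const|].
         apply continuous_jointly_log; auto; intros eps He; destruct (Hj mu (ln r) eps He) as [d [Hd H]].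
         exists d; split; auto; intros; now apply H.
- intros r Hr; split.
  + intros mu Hmu0; assert (Hmu := proj1 (HPset r mu Hr) Hmu0).
    destruct (Hpos mu (ln r) Hmu) as [[d [Hd H]] _]; exists d; split; auto.
    intros y Hy; apply (proj2 (HPset r y Hr)); exact (H y Hy).
  + intros Cc (_ & HCs & _).
    split; intros mu Hmu0; assert (Hmu := proj1 (HPset r mu Hr) (HCs mu Hmu0)); destruct (Hpos mu (ln r) Hmu) as [_ [A1 A2]].
    (* At fixed [r] the solution and its derivative in r are affine in [Z] and [Z1], with
       coefficients independent of [mu]. *)
    * apply (analytic_at_ext (fun m => Rpower r (- th) * Z m (ln r) + 0 * Z m (ln r) + Rpower r (- th) * gam)).
      { intros m; unfold U; ring. }
      now apply analytic_at_lin.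
    * apply (analytic_at_ext (fun m => Rpower r (- th - 1) * Z1 m (ln r) +
        (- Rpower r (- th - 1) * th) * Z m (ln r) + - Rpower r (- th - 1) * th * gam)).
      { intros m; destruct (HU m) as (_ & UD & _); rewrite UD by auto; ring. }
      now apply analytic_at_lin.
Qed.
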